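(* Let $d\in\mathbb N\cup\{\infty\}$ and let $Z=(Z_n)_{n\in\mathbb N}$ be a sequence in the NC unit ball $\mathcal B_d$. Then $Z$ is interpolating for $\mathcal H^\infty_d$ if and only if the sequence of subspaces $(\mathcal H_n)_{n\in\mathbb N}$, where $$\mathcal H_n:=\mathcal H^2_d\ominus\{f\in\mathcal H^2_d : f(Z_n)=0\},$$ is a Riesz system in $\mathcal H^2_d$.
   Context: For $m\ge1$, $\mathbb M^d_m$ is the set of $d$-tuples $X=(X^i)_i$ of complex $m\times m$ matrices (if $d=\infty$, with $\sum_iX^i(X^i)^*$ bounded), with the row norm topology, and $\mathbb M_d=\bigsqcup_{m\ge1}\mathbb M^d_m$. The NC unit ball is $\mathcal B_d=\{X\in\mathbb M_d : \|\sum_iX^i(X^i)^*\|<1\}$, with $\mathcal B_d(m)=\mathcal B_d\cap\mathbb M^d_m$; a set is open in $\mathbb M_d$ if each of its intersections with $\mathbb M^d_m$ is open. A function $f:\mathcal B_d\to\mathbb M_1$ is an NC function if it is graded ($X\in\mathcal B_d(m)\Rightarrow f(X)\in\mathbb M^1_m$), respects direct sums ($f(X\oplus Y)=f(X)\oplus f(Y)$), and respects similarities ($f(P^{-1}XP)=P^{-1}f(X)P$ for invertible $P$ whenever $P^{-1}XP\in\mathcal B_d$). It is holomorphic if locally bounded. $\mathcal H^\infty_d$ is the algebra of NC holomorphic functions $f$ on $\mathcal B_d$ with $\|f\|_\infty:=\sup_{X\in\mathcal B_d}\|f(X)\|<\infty$. The NC Drury–Arveson space $\mathcal H^2_d$ is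 the Hilbert space of NC power series $f=\sum_{l\in\mathbb W_d}a_lZ^l$ with $\|f\|_2^2=\sum_l|a_l|^2<\infty$, where $\mathbb W_d$ is the set of words in $d$ generators; such $f$ is evaluated at points of $\mathcal B_d$ by summing the series (grouped by homogeneous degree). $Z=(Z_n)$ in $\mathcal B_d$ (matrix sizes may vary with $n$) is interpolating for $\mathcal H^\infty_d$ if for every bounded sequence $(\phi_n)$ in $\mathcal H^\infty_d$ there is $\phi\in\mathcal H^\infty_d$ with $\phi(Z_n)=\phi_n(Z_n)$ for all $n$. A sequence $(H_n)$ of closed subspaces of a Hilbert space is a Riesz system if there is $C>0$ such that for every choice of unit vectors $h_n\in H_n$ and every $(a_n)\in\ell^2$, $\frac1{C^2}\sum_n|a_n|^2\le\left\|\sum_n a_nh_n\right\|^2\le C^2\sum_n|a_n|^2$. *)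

(* Defs.v *)
From HB Require Import structures.
From mathcomp Require Import all_boot all_order all_algebra finmap.
From mathcomp Require Import complex.
From mathcomp Require Import boolp classical_sets reals ereal topology.
From mathcomp Require Import normedtype sequences esum summability.

Set Implicit Arguments.
Unset Strict Implicit.
Unset Printing Implicit Defensive.

Import Order.TTheory GRing.Theory Num.Theory numFieldNormedType.Exports.

Local Open Scope classical_set_scope.
Local Open Scope ring_scope.
Local Open Scope complex_scope.

HB.instance Definition _ (R : realType) := NormedModule.copy R[i] R[i]^o.

(* The number d of generators is [Some n] or, for d = oo, [None]. *)
Definition is_letter (d : option nat) (k : nat) : bool :=
  if d is Some n then (k < n)%N else true.

Definition letter (d : option nat) : Type := {k : nat | is_letter d k}.

Definition word (d : option nat) : Type := seq (letter d).

Section MatrixNorm.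
Context {R : realType}.

Definition adjmx m n (A : 'M[R[i]]_(m, n)) : 'M[R[i]]_(n, m) :=
  map_mx (@conjc R) A^T.

Definition vnorm m (v : 'cV[R[i]]_m) : R :=
  Num.sqrt (\sum_(k < m) Normc.normc (v k 0) ^+ 2).

Definition opnorm m (A : 'M[R[i]]_m) : R :=
  sup [set vnorm (A *m v) | v in [set v : 'cV[R[i]]_m | vnorm v <= 1]].

End MatrixNorm.

Section NCBall.
Context {R : realType} {d : option nat}.

Definition mtuple (m : nat) : Type := letter d -> 'M[R[i]]_m.

Definition gram m (X : mtuple m) (i : letter d) : 'M[R[i]]_m :=
  X i *m adjmx (X i).

(* The size restriction m >= 1 is part of membership in the NC space, hence
   also in the NC ball; the boundedness condition is automatic for d < oo. *)
Definition nc_space m : set (mtuple m) :=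
  [set X | (0 < m)%N /\
     exists c : R, forall F : {fset letter d},
       opnorm (partial_sum (gram X) F) <= c].

Definition row_normsq m (X : mtuple m) : R :=
  opnorm (summability.sum (gram X)).

Definition row_norm m (X : mtuple m) : R := Num.sqrt (row_normsq X).

Definition nc_ball m : set (mtuple m) :=
  [set X | nc_space X /\ row_normsq X < 1].

Definition nc_open (U : forall m, set (mtuple m)) : Prop :=
  forall m, U m `<=` @nc_space m /\
    forall X, U m X -> exists2 e : R, 0 < e &
      forall Y, nc_space Y -> row_norm (fun i => Y i - X i) < e -> U m Y.

(* A graded function; only its values on the NC ball are meaningful, and no
   condition below depends on the other ones. *)
Definition graded_fun : Type := forall m, mtuple m -> 'M[R[i]]_m.

Definition dsum m n (X : mtuple m) (Y : mtuple n) : mtuple (m + n) :=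
  fun i => block_mx (X i) 0 0 (Y i).

Definition simil m (P : 'M[R[i]]_m) (X : mtuple m) : mtuple m :=
  fun i => invmx P *m X i *m P.

Definition nc_function (f : graded_fun) : Prop :=
  (forall m n (X : mtuple m) (Y : mtuple n), nc_ball X -> nc_ball Y ->
     f (m + n)%N (dsum X Y) = block_mx (f m X) 0 0 (f n Y)) /\
  (forall m (P : 'M[R[i]]_m) (X : mtuple m), nc_ball X ->
     P \in unitmx -> nc_ball (simil P X) ->
     f m (simil P X) = invmx P *m f m X *m P).

Definition locally_bounded (f : graded_fun) : Prop :=
  forall m (X : mtuple m), nc_ball X ->
    exists U : forall k, set (mtuple k),
      [/\ nc_open U, U m X &
        exists c : R, forall k (Y : mtuple k),
          nc_ball Y -> U k Y -> opnorm (f k Y) <= c].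

Definition nc_holomorphic (f : graded_fun) : Prop :=
  nc_function f /\ locally_bounded f.

Definition hinf_norm (f : graded_fun) : \bar R :=
  ereal_sup [set e | exists m (X : mtuple m),
                       nc_ball X /\ e = (opnorm (f m X))%:E].

Definition hinf (f : graded_fun) : Prop :=
  nc_holomorphic f /\ (hinf_norm f < +oo)%E.

Definition interpolating (m : nat -> nat) (Z : forall n, mtuple (m n)) : Prop :=
  forall phi : nat -> graded_fun,
    (forall n, hinf (phi n)) ->
    (exists c : R, forall n, (hinf_norm (phi n) <= c%:E)%E) ->
    exists psi : graded_fun,
      hinf psi /\ forall n, psi (m n) (Z n) = phi n (m n) (Z n).

End NCBall.
Arguments mtuple : clear implicits.
Arguments graded_fun : clear implicits.

Section Ell2.
Context {R : realType} {I : choiceType}.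

Definition normsq (a : I -> R[i]) : \bar R :=
  \esum_(k in [set: I]) (Normc.normc (a k) ^+ 2)%:E.

Definition ell2 : set (I -> R[i]) := [set a | (normsq a < +oo)%E].

Definition inner (a b : I -> R[i]) : R[i] :=
  summability.sum (fun k => a k * (b k)^*).

Definition ortho (K : set (I -> R[i])) : set (I -> R[i]) :=
  [set h | ell2 h /\ forall f, K f -> inner h f = 0].

Definition norm_cvg (u : nat -> I -> R[i]) (s : I -> R[i]) : Prop :=
  (fun N => normsq (fun k => u N k - s k)) @ \oo --> 0%E.

End Ell2.

(* To be used for closed subspaces H n of ell2, such as orthogonal complements;
   the convergence of the series in norm is part of the assertion. *)
Definition riesz_system {R : realType} {I : choiceType}
    (H : nat -> set (I -> R[i])) : Prop :=
  exists2 C : R, 0 < C &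
    forall (h : nat -> I -> R[i]) (a : nat -> R[i]),
      (forall n, H n (h n) /\ normsq (h n) = 1%E) ->
      ell2 a ->
      exists s : I -> R[i],
        [/\ ell2 s,
            norm_cvg (fun N k => \sum_(n < N) a n * h n k) s,
            ((C ^- 2)%:E * normsq a <= normsq s)%E &
            (normsq s <= (C ^+ 2)%:E * normsq a)%E].

Section DruryArveson.
Context {R : realType} {d : option nat}.

(* An NC power series is identified with its coefficient family, so that the
   NC Drury-Arveson space is ell2 over the words. *)
Definition drury_arveson : set (word d -> R[i]) := ell2.

Definition monomial m (X : mtuple R d m) (w : word d) : 'M[R[i]]_m :=
  \big[mulmx/1%:M]_(i <- w) X i.

Definition hom_part (a : word d -> R[i]) (n : nat) m (X : mtuple R d m) :
    'M[R[i]]_m :=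
  summability.sum (fun w : n.-tuple (letter d) => a w *: monomial X w).

Definition nc_eval (a : word d -> R[i]) m (X : mtuple R d m) : 'M[R[i]]_m :=
  lim (series (fun n => hom_part a n X) @ \oo).

Definition vanishing_at m (X : mtuple R d m) : set (word d -> R[i]) :=
  [set f | drury_arveson f /\ nc_eval f X = 0].

Definition model_space m (X : mtuple R d m) : set (word d -> R[i]) :=
  ortho (vanishing_at X).

End DruryArveson.

(* Main.v *)
Require Import Defs.
From mathcomp Require Import all_boot all_order all_algebra finmap.
From mathcomp Require Import complex spectral ring lra.
From mathcomp Require Import boolp classical_sets functions cardinality fsbigop.
From mathcomp Require Import reals ereal.
From mathcomp Require Import normedtype sequences esum summability.

(* The functional [f |-> tr (A f(X))] on the Drury-Arveson space is represented by
   the conjugate of [kernel_fun A X], the family [w |-> tr (A X^w)], and these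
   vectors form the whole model space of [X]. The adjoint of multiplication by a
   function [f] of [H^oo] maps the vector of [A] to the vector of [A f(X)], so its
   norm is at most [sup |f|] (kernel_contraction, obtained by compressing the
   creation operators to finitely many words).

   If Z is interpolating, interpolating the constants 1 and -1 shows that each
   choice of signs acts boundedly on finite sums of vectors of the model spaces; a
   gliding hump argument makes the bound independent of the signs, and averaging
   over the signs gives the two-sided Riesz estimate.

   Conversely, if the model spaces form a Riesz system, then the map that sends the
   vector of [A_n] to the vector of [A_n phi_n(Z_n)] extends linearly to a bounded
   operator commuting with the backward shifts, and such an operator is determined
   by the linear form "coefficient at the empty word of the image". Hahn-Banach
   steps that preserve the shift invariance and the norm extend this form to all
   finitely supported families (a commutant lifting). Its values at the monomials
   are the coefficients of a bounded multiplier, which lies in [H^oo] by von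
   Neumann's inequality and interpolates the data. *)

Set Implicit Arguments.
Unset Strict Implicit.
Unset Printing Implicit Defensive.

Import Order.TTheory GRing.Theory Num.Theory numFieldNormedType.Exports.

Local Open Scope classical_set_scope.
Local Open Scope ring_scope.
Local Open Scope complex_scope.

#[local] Existing Instance totally_filter.

(** * Square summable families *)

Section SquaredModulus.
Context {R : realType}.
Implicit Types z w : R[i].

(** An element of H^oo enters only as a graded function, never through a power series expansion.
    What is used of it is its value at block triangular points, where the corner f(Z) J - J f(X) is
    bounded by the sup norm; multiplying J by a large constant turns an approximate intertwining
    into an estimate without loss.

    Being interpolating gives no control of the norm of the interpolant, so the bounds obtained for
    single choices of signs have to be made uniform afterwards.

    In the converse, an ordinary Hahn-Banach extension would keep the norm of the form, but not that
    of the operator generated by the form and the shifts. A vector is therefore adjoined only when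
    all its backward shifts already lie in the domain: every coefficient of its image except the one
    at the empty word is then fixed, and the room left for that one is a nonnegative quadratic form.
    By induction on the length, a maximal domain contains every word. *)

Definition nsq z : R := complex.Re z ^+ 2 + complex.Im z ^+ 2.

Lemma normc_sqr z : Normc.normc z ^+ 2 = nsq z.
Proof. by case: z => a b; rewrite /= sqr_sqrtr // addr_ge0 // sqr_ge0. Qed.

Lemma nsq_ge0 z : 0 <= nsq z.
Proof. by rewrite addr_ge0 // sqr_ge0. Qed.

Lemma nsq0 : nsq 0 = 0.
Proof. by rewrite /nsq /= expr0n addr0. Qed.

Lemma nsqM z w : nsq (z * w) = nsq z * nsq w.
Proof. case: z w => a b [c d]; rewrite /nsq /=; ring. Qed.

Lemma nsqN z : nsq (- z) = nsq z.
Proof. case: z => a b; rewrite /nsq /=; ring. Qed.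

Lemma nsqJ z : nsq z^* = nsq z.
Proof. case: z => a b; rewrite /nsq /=; ring. Qed.

Lemma nsqR (x : R) : nsq x%:C = x ^+ 2.
Proof. rewrite /nsq /=; ring. Qed.

Lemma nsq_eq0 z : nsq z = 0 -> z = 0.
Proof.
case: z => a b; rewrite /nsq /= => /eqP.
by rewrite paddr_eq0 ?sqr_ge0// !sqrf_eq0 => /andP[/eqP -> /eqP ->].
Qed.

Lemma mulCJ z : z * z^* = (nsq z)%:C.
Proof. by case: z => a b; apply/eqP; rewrite eq_complex /= /nsq /=; apply/andP; split; apply/eqP; ring. Qed.

(** The squared modulus along a real line is the quadratic polynomial in [t] with leading
    coefficient [nsq w] and the given values at 0 and 1. Summed over an index set, this takes the
    place of polarization ([N2_lin], [defect_line]). *)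
Lemma nsq_lin (t : R) z w :
  nsq (z + t%:C * w) =
  (1 - t) * nsq z + t * nsq (z + w) + (t ^+ 2 - t) * nsq w.
Proof. case: z w => a b [c d]; rewrite /nsq /=; ring. Qed.

(** Stands in for the triangle inequality: with small [e] the main term keeps a factor close to 1,
    and all estimates stay in squared norms. *)
Lemma nsq_young (e : R) z w : 0 < e ->
  nsq (z + w) <= (1 + e) * nsq z + (1 + e^-1) * nsq w.
Proof.
case: z w => a b [c d] e0; rewrite /nsq /= -subr_ge0.
have e1 : e != 0 by rewrite gt_eqF.
suff -> : (1 + e) * (a ^+ 2 + b ^+ 2) + (1 + e^-1) * (c ^+ 2 + d ^+ 2) -
    ((a + c) ^+ 2 + (b + d) ^+ 2) =
    e * ((a - c / e) ^+ 2 + (b - d / e) ^+ 2).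
  by rewrite mulr_ge0 ?(ltW e0)// addr_ge0// sqr_ge0.
by field.
Qed.

Lemma nsq_add z w : nsq (z + w) <= 2 * nsq z + 2 * nsq w.
Proof. by have := @nsq_young 1 z w ltr01; rewrite invr1. Qed.

Lemma nsq_sum_le (T : Type) (s : seq T) (f : T -> R[i]) (P : pred T) :
  nsq (\sum_(k <- s | P k) f k) <= (size s)%:R * \sum_(k <- s | P k) nsq (f k).
Proof.
elim: s => [|k s IH]; first by rewrite !big_nil nsq0 mulr0.
rewrite !big_cons; case: ifP => Pk; last first.
  by apply: le_trans IH _; rewrite ler_wpM2r ?ler_nat// sumr_ge0// => ? _; exact: nsq_ge0.
case: s IH => [|k' s] IH; first by rewrite !big_nil !addr0 mul1r.
have -> : (size (k :: k' :: s))%:R = 1 + (size (k' :: s))%:R :> R.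
  by rewrite addrC natr1.
have m0 : 0 < (size (k' :: s))%:R :> R by rewrite ltr0n.
move: (\sum_(j <- k' :: s | P j) f j) (\sum_(j <- k' :: s | P j) nsq (f j)) IH m0.
move: (size _)%:R => m z A IH m0.
(* The weight is [m], the number of remaining terms: the factors become 1 + m and (1 + 1/m) m. *)
apply: le_trans (nsq_young _ _ m0) _.
rewrite [leRHS]mulrDr lerD2l.
apply: le_trans (ler_wpM2l _ IH) _; first by rewrite addr_ge0// invr_ge0 ltW.
rewrite mulrA le_eqVlt; apply/orP; left; apply/eqP; congr (_ * _).
by field; rewrite gt_eqF.
Qed.

(** Cauchy-Schwarz from termwise bounds alone, so that the terms may themselves be inner products.
    In the induction the cross term is at most the square root of a b A B, hence at most (a B + b A)
    / 2. *)
Lemma nsq_sum_bound (T : Type) (s : seq T) (P : pred T) (f : T -> R[i])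
    (p q : T -> R) :
  (forall k, 0 <= p k) -> (forall k, 0 <= q k) ->
  (forall k, nsq (f k) <= p k * q k) ->
  nsq (\sum_(k <- s | P k) f k) <=
  (\sum_(k <- s | P k) p k) * (\sum_(k <- s | P k) q k).
Proof.
move=> p0 q0 fpq; elim: s => [|k s IH]; first by rewrite !big_nil nsq0 mul0r.
rewrite !big_cons; case: ifP => // Pk.
set A := \sum_(k <- s | _) p k in IH *.
set B := \sum_(k <- s | _) q k in IH *.
set z := \sum_(k <- s | _) _ in IH *.
have A0 : 0 <= A by exact: sumr_ge0.
have B0 : 0 <= B by exact: sumr_ge0.
move: IH (p0 k) (q0 k) (fpq k).
move: (p k) (q k) => a b.
move: (f k) z => [x y] [x' y']; rewrite /nsq /= => IH a0 b0 e.
have h : (x * x' + y * y') ^+ 2 <= ((a * B + b * A) / 2) ^+ 2.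
  apply: (@le_trans _ _ ((a * b) * (A * B))).
    apply: (@le_trans _ _ ((x ^+ 2 + y ^+ 2) * (x' ^+ 2 + y' ^+ 2))).
      rewrite -subr_ge0.
      suff -> : (x ^+ 2 + y ^+ 2) * (x' ^+ 2 + y' ^+ 2) - (x * x' + y * y') ^+ 2 =
        (x * y' - y * x') ^+ 2 by exact: sqr_ge0.
      by ring.
    by apply: ler_pM => //; rewrite addr_ge0// sqr_ge0.
  rewrite -subr_ge0.
  suff -> : ((a * B + b * A) / 2) ^+ 2 - a * b * (A * B) =
      ((a * B - b * A) / 2) ^+ 2 by exact: sqr_ge0.
  by field.
have pos : 0 <= (a * B + b * A) / 2 by rewrite divr_ge0// addr_ge0// mulr_ge0.
have {}h : x * x' + y * y' <= (a * B + b * A) / 2.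
  case: (leP 0 (x * x' + y * y')) => [s0|/ltW s0]; last exact: le_trans s0 pos.
  by rewrite -(ler_pXn2r (n:=2))// nnegrE.
have -> : (a + A) * (b + B) = a * b + A * B + 2 * ((a * B + b * A) / 2) by field.
have -> : (x + x') ^+ 2 + (y + y') ^+ 2 = (x ^+ 2 + y ^+ 2) +
  (x' ^+ 2 + y' ^+ 2) + 2 * (x * x' + y * y') by ring.
by rewrite lerD// ?lerD// ler_wpM2l.
Qed.

Lemma nsq_sum_mul (T : Type) (s : seq T) (P : pred T) (f g : T -> R[i]) :
  nsq (\sum_(k <- s | P k) f k * g k) <=
  (\sum_(k <- s | P k) nsq (f k)) * (\sum_(k <- s | P k) nsq (g k)).
Proof.
apply: nsq_sum_bound => k; [exact: nsq_ge0|exact: nsq_ge0|].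
by rewrite nsqM.
Qed.

End SquaredModulus.

Lemma ler_sum_subset (R : realType) (I : eqType) (f : I -> R) (s t : seq I) :
  (forall k, 0 <= f k) -> uniq s -> uniq t -> {subset s <= t} ->
  \sum_(k <- s) f k <= \sum_(k <- t) f k.
Proof.
move=> f0 us ut st; rewrite [leRHS](bigID (mem s))/=.
have -> : \sum_(k <- t | k \in s) f k = \sum_(k <- s) f k.
  rewrite -big_filter; apply: perm_big; apply: uniq_perm => //.
    exact: filter_uniq.
  by move=> k; rewrite mem_filter; apply: andb_idr; exact: st.
by rewrite lerDl sumr_ge0.
Qed.

(** * Unordered sums of nonnegative families *)

Section NonnegativeSums.
Context {R : realType} {I : choiceType}.
Implicit Types f g : I -> R.

Definition nsum f : \bar R := \esum_(k in [set: I]) (f k)%:E.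

Definition nsummable f : bool := (nsum f < +oo)%E.

Definition rsum f : R := fine (nsum f).

Lemma nsum_ge0 f : (forall k, 0 <= f k) -> (0 <= nsum f)%E.
Proof. by move=> f0; apply: esum_ge0 => k _; rewrite lee_fin. Qed.

Lemma partial_sumE (V : zmodType) (f : I -> V) (F : {fset I}) :
  partial_sum f F = \sum_(k <- F) f k.
Proof. by rewrite /partial_sum big_seq_fsetE. Qed.

Lemma nsum_leP f (c : R) : (forall k, 0 <= f k) ->
  (nsum f <= c%:E)%E <-> (forall s : seq I, uniq s -> \sum_(k <- s) f k <= c).
Proof.
move=> f0; split=> [fc s us|h].
  rewrite -lee_fin; apply: le_trans fc; apply: esum_ge.
  exists [set` s]; first by split=> //; exact: finite_seq.
  by rewrite -fsbig_seq// sumEFin.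
apply: ge_ereal_sup => _ [X [finX _] <-].
by rewrite fsbig_finite//= sumEFin lee_fin h// fset_uniq.
Qed.

Lemma nsum_lt f (c : R) : (forall k, 0 <= f k) ->
  (forall s : seq I, uniq s -> \sum_(k <- s) f k <= c) -> nsummable f.
Proof. by move=> f0 /(nsum_leP _ f0) /le_lt_trans; apply; rewrite ltry. Qed.

Lemma nsum_rsum f : (forall k, 0 <= f k) -> nsummable f ->
  nsum f = (rsum f)%:E.
Proof. by move=> f0 fo; rewrite /rsum fineK// ge0_fin_numE// nsum_ge0. Qed.

Lemma rsum_ge0 f : (forall k, 0 <= f k) -> 0 <= rsum f.
Proof. by move=> f0; rewrite fine_ge0// nsum_ge0. Qed.

Lemma rsum_ge f (s : seq I) : (forall k, 0 <= f k) -> nsummable f ->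
  uniq s -> \sum_(k <- s) f k <= rsum f.
Proof.
by move=> f0 fo us; apply: (proj1 (nsum_leP (rsum f) f0)) => //; rewrite nsum_rsum.
Qed.

Lemma rsum_le f (c : R) : (forall k, 0 <= f k) ->
  (forall s : seq I, uniq s -> \sum_(k <- s) f k <= c) -> rsum f <= c.
Proof.
move=> f0 h; rewrite -lee_fin -nsum_rsum//; last exact: nsum_lt h.
exact/nsum_leP.
Qed.

Lemma le_nsum f g : (forall k, f k <= g k) -> (nsum f <= nsum g)%E.
Proof. by move=> fg; apply: le_esum => k _; rewrite lee_fin. Qed.

Lemma rsum_cvg f : (forall k, 0 <= f k) -> nsummable f ->
  partial_sum f @ totally --> rsum f.
Proof.
move=> f0 fo; apply/cvgrPdist_lt => e e0.
have /ereal_sup_gt [_ [X [finX _] <-] hX] : ((rsum f - e)%:E < nsum f)%E.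
  by rewrite (nsum_rsum f0 fo) lte_fin ltrBlDr ltrDl.
move: hX; rewrite fsbig_finite//= sumEFin lte_fin => hX.
exists (fset_set X) => //= F XF; rewrite ger0_norm; last first.
  by rewrite subr_ge0 partial_sumE rsum_ge// fset_uniq.
rewrite ltrBlDr -ltrBlDl; apply: lt_le_trans hX _.
rewrite partial_sumE ler_sum_subset// ?fset_uniq//.
exact/fsubsetP.
Qed.

Lemma rsum_unique f (l : R) : (forall k, 0 <= f k) -> nsummable f ->
  partial_sum f @ totally --> l -> rsum f = l.
Proof. by move=> f0 fo; apply: cvg_unique => //; exact: rsum_cvg. Qed.

Lemma nsum_lin f g (a b : R) : (forall k, 0 <= f k) -> (forall k, 0 <= g k) ->
  0 <= a -> 0 <= b -> nsummable f -> nsummable g ->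
  nsummable (fun k => a * f k + b * g k).
Proof.
move=> f0 g0 a0 b0 fo go; apply: (@nsum_lt _ (a * rsum f + b * rsum g)).
  by move=> k; rewrite addr_ge0// mulr_ge0.
move=> s us; rewrite big_split/= -!mulr_sumr lerD// ler_wpM2l//.
- exact: rsum_ge.
- exact: rsum_ge.
Qed.

Lemma cvg_partial_sum_lin f g (a b x y : R) :
  partial_sum f @ totally --> x -> partial_sum g @ totally --> y ->
  partial_sum (fun k => a * f k + b * g k) @ totally --> a * x + b * y.
Proof.
move=> fx gy; rewrite (_ : partial_sum _ = fun F => a * partial_sum f F +
    b * partial_sum g F); last by apply/funext => F;
    rewrite /partial_sum big_split/= -!mulr_sumr.
by apply: cvgD; exact: cvgMl_tmp.
Qed.

Lemma rsum_lin f g (a b : R) : (forall k, 0 <= f k) -> (forall k, 0 <= g k) ->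
  (forall k, 0 <= a * f k + b * g k) ->
  nsummable f -> nsummable g ->
  nsummable (fun k => a * f k + b * g k) /\
  rsum (fun k => a * f k + b * g k) = a * rsum f + b * rsum g.
Proof.
move=> f0 g0 h0 fo go; have ho : nsummable (fun k => a * f k + b * g k).
  apply: le_lt_trans (nsum_lin f0 g0 (normr_ge0 a) (normr_ge0 b) fo go).
  by apply: le_nsum => k; rewrite lerD// ler_wpM2r// ler_norm.
split=> //; apply: rsum_unique => //.
by apply: cvg_partial_sum_lin; exact: rsum_cvg.
Qed.

End NonnegativeSums.

(** * Complex sums, square summable families and their bilinear pairing *)

Section ComplexSums.
Context {R : realType}.

Lemma cvgC (T : Type) (F : set_system T) {FF : Filter F} (u : T -> R[i])
    (x y : R) :
  (fun t => complex.Re (u t)) @ F --> x -> (fun t => complex.Im (u t)) @ F --> y ->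
  u @ F --> (x +i* y : R[i]).
Proof.
move=> /cvgrPdist_lt ux /cvgrPdist_lt uy; apply/cvgrPdist_lt => e.
case: e => e e'; rewrite ltcE /= => /andP[/eqP -> e0].
have e2 : 0 < e / 2 by rewrite divr_gt0.
near=> t.
have hx : `|x - complex.Re (u t)| < e / 2 by near: t; exact: ux.
have hy : `|y - complex.Im (u t)| < e / 2 by near: t; exact: uy.
rewrite normc_def ltcR -[ltRHS]gtr0_norm// -sqrtr_sqr ltr_sqrt ?exprn_gt0//.
rewrite !raddfB /=; move: hx hy; rewrite !ltr_norml.
move: (x - _) (y - _) => p q /andP[p1 p2] /andP[q1 q2].
by nra.
Unshelve. all: by end_near. Qed.

Lemma cvgC_Re (T : Type) (F : set_system T) {FF : Filter F} (u : T -> R[i])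
    (z : R[i]) :
  u @ F --> z -> (fun t => complex.Re (u t)) @ F --> complex.Re z /\
  (fun t => complex.Im (u t)) @ F --> complex.Im z.
Proof.
move=> /cvgrPdist_lt uz.
split; apply/cvgrPdist_lt => e e0; have /uz : 0 < (e%:C : R[i]) by rewrite ltcR.
- apply: filterS => t; rewrite normc_def ltcR; apply: le_lt_trans.
  rewrite -(sqrtr_sqr (complex.Re z - _)) ler_sqrt ?addr_ge0 ?sqr_ge0//.
  by rewrite !raddfB /= lerDl sqr_ge0.
- apply: filterS => t; rewrite normc_def ltcR; apply: le_lt_trans.
  rewrite -(sqrtr_sqr (complex.Im z - _)) ler_sqrt ?addr_ge0 ?sqr_ge0//.
  by rewrite !raddfB /= lerDr sqr_ge0.
Qed.

Lemma cvgC_lin (T : Type) (F : set_system T) {FF : Filter F} (u v : T -> R[i])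
    (x y c c' : R[i]) : u @ F --> x -> v @ F --> y ->
  (fun t => c * u t + c' * v t) @ F --> c * x + c' * y.
Proof.
move=> ux vy; have h := @cvgMl_tmp _ _ F FF u c x ux.
have h' := @cvgMl_tmp _ _ F FF v c' y vy; exact: cvgD h h'.
Qed.

Lemma cvgC_unique (T : Type) (F : set_system T) {FF : ProperFilter F}
    (u : T -> R[i]) (x y : R[i]) : u @ F --> x -> u @ F --> y -> x = y.
Proof. by move=> ux uy; rewrite -(cvg_lim _ ux)// -(cvg_lim _ uy). Qed.

Definition csummable {I : choiceType} (g : I -> R[i]) : bool :=
  nsummable (fun k => Normc.normc (g k)).

Section OneIndex.
Context {I : choiceType}.
Implicit Types (a b g h : I -> R[i]).

Lemma conjc_Re (z : R[i]) : complex.Re z^* = complex.Re z.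
Proof. by case: z. Qed.

Lemma conjc_Im (z : R[i]) : complex.Im z^* = - complex.Im z.
Proof. by case: z. Qed.

(** A real family [f] dominated by |g| is |f| - (|f| - f), a difference of summable nonnegative
    families; this applies to the real and imaginary parts of [g]. *)
Lemma csummable_cvg g : csummable g ->
  partial_sum g @ totally --> summability.sum g.
Proof.
move=> gs.
pose re := fun k => complex.Re (g k); pose im := fun k => complex.Im (g k).
have Rec (f : I -> R) : (forall k, `|f k| <= Normc.normc (g k)) ->
    exists l : R, partial_sum f @ totally --> l.
  move=> fg.
  have n0 k : 0 <= `|f k| by [].
  have no : nsummable (fun k => `|f k|) by apply: le_lt_trans gs; exact: le_nsum.
  have p0 k : 0 <= `|f k| - f k by rewrite subr_ge0 ler_norm.
  have po : nsummable (fun k => `|f k| - f k).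
    have := @nsum_lin _ _ _ _ 2 0 n0 n0 (ler0n _ _) (lexx _) no no.
    apply: le_lt_trans; apply: le_nsum => k; rewrite mul0r addr0 mulr2n mulrDl mul1r.
    by rewrite lerD2l (le_trans (ler_norm _))// normrN.
  exists (1 * rsum (fun k => `|f k|) + (-1) * rsum (fun k => `|f k| - f k)).
  rewrite [partial_sum f](_ : _ = partial_sum (fun k => 1 * `|f k| +
      (-1) * (`|f k| - f k))); last by congr partial_sum; apply/funext => k; ring.
  by apply: cvg_partial_sum_lin; exact: rsum_cvg.
have [x hx] : exists l : R, partial_sum re @ totally --> l.
  apply: Rec => k; rewrite /re; case: (g k) => p q /=.
  by rewrite -sqrtr_sqr ler_sqrt ?addr_ge0 ?sqr_ge0// lerDl sqr_ge0.
have [y hy] : exists l : R, partial_sum im @ totally --> l.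
  apply: Rec => k; rewrite /im; case: (g k) => p q /=.
  by rewrite -sqrtr_sqr ler_sqrt ?addr_ge0 ?sqr_ge0// lerDr sqr_ge0.
suff gxy : partial_sum g @ totally --> (x +i* y : R[i]).
  by rewrite /summability.sum (cvg_lim _ gxy).
apply: cvgC.
- by under eq_fun do rewrite /partial_sum raddf_sum.
- by under eq_fun do rewrite /partial_sum raddf_sum.
Qed.

Lemma normsqE a : normsq a = nsum (fun k => nsq (a k)).
Proof. by apply: eq_esum => k _; rewrite normc_sqr. Qed.


Definition N2 a : R := rsum (fun k => nsq (a k)).

Lemma ell2E a : ell2 a <-> nsummable (fun k => nsq (a k)).
Proof. by rewrite /ell2 /= normsqE. Qed.

Lemma normsq_N2 a : ell2 a -> normsq a = (N2 a)%:E.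
Proof.
by move=> /ell2E a2; rewrite normsqE nsum_rsum// => k; exact: nsq_ge0.
Qed.

Lemma N2_ge0 a : 0 <= N2 a.
Proof. by apply: rsum_ge0 => k; exact: nsq_ge0. Qed.

Lemma ell2_le a (c : R) :
  (forall s, uniq s -> \sum_(k <- s) nsq (a k) <= c) -> ell2 a /\ N2 a <= c.
Proof.
move=> h; have p k := nsq_ge0 (a k).
split; last exact: rsum_le.
by apply/ell2E; exact: nsum_lt h.
Qed.

Lemma N2_ge a s : ell2 a -> uniq s -> \sum_(k <- s) nsq (a k) <= N2 a.
Proof. by move=> /ell2E a2 us; apply: rsum_ge => // k; exact: nsq_ge0. Qed.

Lemma N2_ge1 a k : ell2 a -> nsq (a k) <= N2 a.
Proof. by move=> a2; have := @N2_ge a [:: k] a2 isT; rewrite big_seq1. Qed.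

Lemma N2_eq0 a : ell2 a -> N2 a = 0 -> a = 0.
Proof.
move=> a2 a0; apply/funext => k; apply: nsq_eq0; apply/eqP.
by rewrite eq_le nsq_ge0 -a0 N2_ge1.
Qed.

Lemma ell20 : ell2 (0 : I -> R[i]) /\ N2 (0 : I -> R[i]) = 0.
Proof.
have [|p q] := @ell2_le 0 0.
  by move=> s _; rewrite big1// => k _; rewrite nsq0.
by split=> //; apply/eqP; rewrite eq_le q N2_ge0.
Qed.

Lemma ell2Z c a : ell2 a -> ell2 (fun k => c * a k) /\
  N2 (fun k => c * a k) = nsq c * N2 a.
Proof.
move=> /ell2E a2.
have p k : 0 <= nsq (a k) by exact: nsq_ge0.
have [] := @rsum_lin _ _ _ _ (nsq c) 0 p p _ a2 a2.
  by move=> k; rewrite mul0r addr0 mulr_ge0// nsq_ge0.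
rewrite mul0r addr0 => h1 h2; rewrite ell2E /N2.
have -> : (fun k => nsq (c * a k)) = (fun k => nsq c * nsq (a k) + 0 * nsq (a k)).
  by apply/funext => k; rewrite mul0r addr0 nsqM.
by [].
Qed.

Lemma ell2D a b : ell2 a -> ell2 b -> ell2 (fun k => a k + b k) /\
  N2 (fun k => a k + b k) <= 2 * N2 a + 2 * N2 b.
Proof.
move=> a2 b2; apply: ell2_le => s us.
apply: (@le_trans _ _ (\sum_(k <- s) (2 * nsq (a k) + 2 * nsq (b k)))).
  by apply: ler_sum => k _; exact: nsq_add.
by rewrite big_split/= -!mulr_sumr lerD// ler_wpM2l// N2_ge.
Qed.

Lemma N2_lin (t : R) a b : ell2 a -> ell2 b ->
  N2 (fun k => a k + t%:C * b k) =
  (1 - t) * N2 a + t * N2 (fun k => a k + b k) + (t ^+ 2 - t) * N2 b.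
Proof.
move=> a2 b2.
have [tb _] := ell2Z t%:C b2; have [/ell2E l2 _] := ell2D a2 tb.
have [/ell2E ab _] := ell2D a2 b2.
have p (c : I -> R[i]) k : 0 <= nsq (c k) by exact: nsq_ge0.
apply: rsum_unique => //; first exact: p.
have -> : (fun k => nsq (a k + t%:C * b k)) = (fun k => 1 *
    ((1 - t) * nsq (a k) + t * nsq (a k + b k)) + (t ^+ 2 - t) * nsq (b k)).
  by apply/funext => k; rewrite mul1r nsq_lin.
rewrite -[(1 - t) * _ + _ * _]mul1r.
move/ell2E: a2 => a2; move/ell2E: b2 => b2.
apply: cvg_partial_sum_lin; last exact: rsum_cvg (p b) b2.
by apply: cvg_partial_sum_lin; apply: rsum_cvg => // k; exact: nsq_ge0.
Qed.

Lemma ell2J a : ell2 a -> ell2 (fun k => (a k)^*) /\ N2 (fun k => (a k)^*) = N2 a.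
Proof.
rewrite !ell2E /N2; have -> // : (fun k => nsq (a k)^*) = (fun k => nsq (a k)).
by apply/funext => k; rewrite nsqJ.
Qed.

Lemma ell2_sum (J : Type) (s : seq J) (P : pred J) (f : J -> I -> R[i]) :
  (forall j, P j -> ell2 (f j)) -> ell2 (fun k => \sum_(j <- s | P j) f j k).
Proof.
move=> f2; elim: s => [|j s IH].
  by under eq_fun do rewrite big_nil; exact: ell20.1.
case Pj : (P j); last by under eq_fun do rewrite big_cons Pj.
under eq_fun do rewrite big_cons Pj.
by apply: (proj1 (ell2D _ _)) => //; exact: f2.
Qed.

Lemma csummable_mul a b : ell2 a -> ell2 b -> csummable (fun k => a k * b k).
Proof.
move=> a2 b2; apply: (@nsum_lt _ _ _ (N2 a + N2 b)).
  by move=> k; case: (a k * b k) => x y; rewrite /= sqrtr_ge0.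
move=> s us.
apply: (@le_trans _ _ (\sum_(k <- s) (nsq (a k) + nsq (b k)))).
  apply: ler_sum => k _; rewrite Normc.normcM.
  rewrite -!normc_sqr.
  have := sqr_ge0 (Normc.normc (a k) - Normc.normc (b k)).
  have : 0 <= Normc.normc (a k) by case: (a k) => ? ? /=; exact: sqrtr_ge0.
  have : 0 <= Normc.normc (b k) by case: (b k) => ? ? /=; exact: sqrtr_ge0.
  by move: (Normc.normc _) (Normc.normc _) => p q; nra.
by rewrite big_split/= lerD// N2_ge.
Qed.

(** Bilinear, unlike [inner]: tr (A f(X)) then depends linearly on both f and A, and conjugates are
    needed only to speak of model spaces. *)
Definition pair a b : R[i] := summability.sum (fun k => a k * b k).

Lemma pair_cvg a b : ell2 a -> ell2 b ->
  partial_sum (fun k => a k * b k) @ totally --> pair a b.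
Proof. by move=> a2 b2; apply: csummable_cvg; exact: csummable_mul. Qed.

Lemma sum_unique g (l : R[i]) : partial_sum g @ totally --> l ->
  summability.sum g = l.
Proof. by move=> gl; rewrite /summability.sum (cvg_lim _ gl). Qed.

Lemma innerE a b : inner a b = pair a (fun k => (b k)^*).
Proof. by []. Qed.

Lemma pairC a b : pair a b = pair b a.
Proof. by congr (summability.sum _); apply/funext => k; rewrite mulrC. Qed.

Lemma pair_linl (c : R[i]) a b g : ell2 a -> ell2 b -> ell2 g ->
  pair (fun k => a k + c * b k) g = pair a g + c * pair b g.
Proof.
move=> a2 b2 g2; apply: sum_unique.
rewrite (_ : partial_sum _ = fun F => partial_sum (fun k => a k * g k) F +
    c * partial_sum (fun k => b k * g k) F).
  by apply: cvgD; [|apply: cvgMl_tmp]; exact: pair_cvg.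
apply/funext => F; rewrite /partial_sum mulr_sumr -big_split/=.
by apply: eq_bigr => k _; rewrite mulrDl mulrA.
Qed.

Lemma pairZl (c : R[i]) b g : ell2 b -> ell2 g ->
  pair (fun k => c * b k) g = c * pair b g.
Proof.
move=> b2 g2; apply: sum_unique.
rewrite (_ : partial_sum _ = fun F => c * partial_sum (fun k => b k * g k) F).
  by apply: cvgMl_tmp; exact: pair_cvg.
by apply/funext => F; rewrite /partial_sum mulr_sumr; apply: eq_bigr => k _; rewrite mulrA.
Qed.

Lemma pair_suml (J : Type) (s : seq J) (P : pred J) (f : J -> I -> R[i]) g :
  (forall j, P j -> ell2 (f j)) -> ell2 g ->
  pair (fun k => \sum_(j <- s | P j) f j k) g = \sum_(j <- s | P j) pair (f j) g.
Proof.
move=> f2 g2; elim: s => [|j s IH].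
  rewrite big_nil; apply: sum_unique.
  rewrite (_ : partial_sum _ = fun=> 0); first exact: cvg_cst.
  by apply/funext => F; rewrite /partial_sum big1// => k _; rewrite big_nil mul0r.
rewrite [RHS]big_cons; case Pj : (P j); last first.
  by under [X in pair X]eq_fun do rewrite big_cons Pj.
under [X in pair X]eq_fun do rewrite big_cons Pj.
rewrite -IH -[pair (fun _ => bigop _ _ _) g]mul1r -pair_linl//; last 2 first.
  exact: f2.
  exact: ell2_sum.
by congr pair; apply/funext => k; rewrite mul1r.
Qed.

Lemma pairJ a : ell2 a -> pair a (fun k => (a k)^*) = (N2 a)%:C.
Proof.
move=> a2; apply: sum_unique; apply: cvgC.
- rewrite (_ : (fun F => _) = partial_sum (fun k => nsq (a k))).
    by apply: rsum_cvg; [move=> k; exact: nsq_ge0|exact/ell2E].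
  apply/funext => F; rewrite /partial_sum raddf_sum.
  by apply: eq_bigr => k _; rewrite mulCJ.
- rewrite (_ : (fun F => _) = fun=> 0); first exact: cvg_cst.
  apply/funext => F; rewrite /partial_sum raddf_sum big1// => k _.
  by rewrite mulCJ.
Qed.

Lemma conj_pair a b : ell2 a -> ell2 b ->
  (pair a b)^* = pair (fun k => (a k)^*) (fun k => (b k)^*).
Proof.
move=> a2 b2; apply/esym/sum_unique.
have [h1 h2] := cvgC_Re (pair_cvg a2 b2).
have -> : (pair a b)^* = complex.Re (pair a b) +i* (- complex.Im (pair a b)).
  by case: (pair a b).
apply: cvgC.
- rewrite (_ : (fun F => _) = (fun F => complex.Re (partial_sum (fun k => a k * b k) F)))//.
  apply/funext => F; rewrite /partial_sum -[RHS]conjc_Re; congr complex.Re.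
  by rewrite rmorph_sum; apply: eq_bigr => k _; rewrite rmorphM.
- rewrite (_ : (fun F => _) = (fun F => - complex.Im (partial_sum (fun k => a k * b k) F))).
    exact: cvgN.
  apply/funext => F; rewrite /partial_sum -conjc_Im; congr complex.Im.
  by rewrite rmorph_sum; apply: eq_bigr => k _; rewrite rmorphM.
Qed.

Lemma pair_sumr (J : Type) (s : seq J) (P : pred J) (c : J -> R[i])
    (f : J -> I -> R[i]) g :
  (forall j, P j -> ell2 (f j)) -> ell2 g ->
  pair g (fun k => (\sum_(j <- s | P j) c j * f j k)^* ) =
  \sum_(j <- s | P j) (c j)^* * pair g (fun k => (f j k)^*).
Proof.
move=> f2 g2; rewrite pairC.
under [X in pair X]eq_fun do rewrite rmorph_sum.
rewrite pair_suml//; last by move=> j Pj; apply: (ell2J _).1; exact: (ell2Z _ (f2 _ Pj)).1.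
apply: eq_bigr => j Pj.
under [X in pair X]eq_fun do rewrite rmorphM.
by rewrite pairZl 1?pairC//; exact: (ell2J (f2 _ Pj)).1.
Qed.

(** Gram-Schmidt along the list of indices, without completeness. The induction keeps the
    coefficients zero outside the indices already treated. *)
Lemma ell2_projection (J : finType) (f : J -> I -> R[i]) h :
  (forall j, ell2 (f j)) -> ell2 h ->
  exists c : J -> R[i], forall j,
    pair (fun k => h k - \sum_i c i * f i k) (fun k => (f j k)^*) = 0.
Proof.
move=> f2 h2.
have comb2 (c : J -> R[i]) : ell2 (fun k => \sum_i c i * f i k).
  by apply: ell2_sum => j _; exact: (ell2Z _ (f2 _)).1.
have sub2 (a b : I -> R[i]) : ell2 a -> ell2 b -> ell2 (fun k => a k - b k).
  move=> a2 b2; under eq_fun do rewrite -mulN1r.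
  by apply: (ell2D _ _).1 => //; exact: (ell2Z _ _).1.
suff [c [_ hc]] : exists c : J -> R[i], (forall i, i \notin enum J -> c i = 0) /\
    forall j, j \in enum J ->
      pair (fun k => h k - \sum_i c i * f i k) (fun k => (f j k)^*) = 0.
  by exists c => j; apply: hc; rewrite mem_enum.
elim: (enum J) h h2 => [|j0 s IH] h h2; first by exists (fun=> 0).
have [c [c0 hc]] := IH h h2; have [d [d0 hd]] := IH _ (f2 j0).
set h' := fun k => h k - _ in hc; set g := fun k => _ in hd.
have h'2 : ell2 h' by exact: sub2.
have g2 : ell2 g by exact: sub2.
(* [f j0] and its remainder [g] differ by a combination of the earlier vectors, which a vector [e]
   orthogonal to those does not see. *)
have gf (e : I -> R[i]) : ell2 e -> (forall j, j \in s -> pair e (fun k => (f j k)^*) = 0) ->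
    pair e (fun k => (f j0 k)^*) = pair e (fun k => (g k)^*).
  move=> e2 es.
  have -> : (fun k => (f j0 k)^*) =
      (fun k => (g k)^* + 1 * (\sum_i d i * f i k)^*).
    by apply/funext => k; rewrite mul1r -rmorphD /= /g subrK.
  rewrite pairC pair_linl//; last 2 first.
    exact: (ell2J g2).1.
    exact: (ell2J (comb2 d)).1.
  rewrite mul1r pairC [X in _ + X]pairC pair_sumr// big1 ?addr0// => j _.
  have [/es ->|/d0 ->] := boolP (j \in s); first by rewrite mulr0.
  by rewrite rmorph0 mul0r.
pose l := pair h' (fun k => (f j0 k)^*) / (N2 g)%:C.
exists (fun i => c i + l * ((i == j0)%:R - d i)); split.
  move=> i; rewrite inE negb_or => /andP[ij is_].
  by rewrite c0// d0// (negbTE ij) subrr mulr0 addr0.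
move=> j.
have -> : (fun k => h k - \sum_i (c i + l * ((i == j0)%:R - d i)) * f i k) =
    (fun k => h' k + (- l) * g k).
  apply/funext => k; rewrite /h' /g.
  under eq_bigr do rewrite mulrDl -mulrA mulrBl.
  rewrite big_split/= -mulr_sumr sumrB.
  have -> : \sum_i (i == j0)%:R * f i k = f j0 k.
    rewrite (bigD1 j0)//= eqxx mul1r big1 ?addr0// => i /negbTE ->.
    by rewrite mul0r.
  by rewrite opprD addrA mulNr.
have fJ2 i : ell2 (fun k => (f i k)^*) by exact: (ell2J (f2 i)).1.
rewrite pair_linl//.
rewrite inE => /orP[/eqP ->|js]; last by rewrite hc// hd// mulr0 addr0.
rewrite [X in _ + _ * X]gf// pairJ// /l mulNr.
(* If [g] vanishes, [f j0] lies in the span of the earlier vectors and orthogonality to it already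
   holds. *)
have [g0|g0] := eqVneq (N2 g) 0; last by rewrite divfK ?subrr// eq_complex /= (negbTE g0).
rewrite g0 mulr0 subr0 gf//.
have -> : (fun k => (g k)^*) = (fun k => 0 * (h' k)).
  by apply/funext => k; rewrite (N2_eq0 g2 g0) mul0r; exact: conjc0.
by rewrite pairC pairZl// mul0r.
Qed.

End OneIndex.
End ComplexSums.

(** * Matrices and the row ball *)

Section WordSums.
Context {R : realType} {T : choiceType}.

(** [e] enumerates the nonempty words, by the last letter in [nsum_rcons] and by the first in
    [nsum_cons]: backward shifts act at the end of a word, recursions on monomials at its
    beginning. *)
Lemma nsum_split (J : choiceType) (e : J -> seq T) (a : seq T -> R) :
  (forall w, 0 <= a w) -> injective e ->
  (forall w, w <> [::] <-> exists j, e j = w) ->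
  nsum a = ((a [::])%:E + nsum (fun j => a (e j)))%E.
Proof.
move=> a0 einj eim; rewrite /nsum (esumID [set [::]]); last first.
  by move=> w _; rewrite lee_fin.
rewrite !setTI esum_set1 ?lee_fin//; congr (_ + _)%E.
apply: reindex_esum; split.
- by move=> j _ /=; apply: (proj2 (eim _)); exists j.
- by move=> i j _ _; exact: einj.
- by move=> w /= /(proj1 (eim w)) [j <-]; exists j.
Qed.

Lemma nsum_rcons (a : seq T -> R) : (forall w, 0 <= a w) ->
  nsum a = ((a [::])%:E + nsum (fun p : T * seq T => a (rcons p.2 p.1)))%E.
Proof.
move=> a0; apply: nsum_split => //.
  by move=> [i v] [j w] /= /rcons_inj[-> ->].
move=> w; split; last by case=> -[i v] /= <-; case: v.
by case/lastP: w => // w i _; exists (i, w).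
Qed.

Lemma nsum_cons (a : seq T -> R) : (forall w, 0 <= a w) ->
  nsum a = ((a [::])%:E + nsum (fun p : T * seq T => a (p.1 :: p.2)))%E.
Proof.
move=> a0; apply: nsum_split => //.
  by move=> [i v] [j w] /= [-> ->].
move=> w; split; last by case=> -[i v] /= <-.
by case: w => // i w _; exists (i, w).
Qed.

Lemma nsum_pair (I J : choiceType) (a : I * J -> R) : (forall p, 0 <= a p) ->
  nsum a = \esum_(i in [set: I]) nsum (fun j => a (i, j)).
Proof.
move=> a0; rewrite /nsum esum_esum; last by move=> i j _ _; rewrite lee_fin.
rewrite (_ : _ `*`` _ = setT); last by apply/seteqP.
by apply: eq_esum => -[].
Qed.

End WordSums.

Section Matrices.
Context {R : realType}.
Local Notation C := R[i].

(** The squared Frobenius norm, which on rows and columns is the squared Euclidean norm. *)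
Definition fro m n (A : 'M[C]_(m, n)) : R := \sum_i \sum_j nsq (A i j).

Lemma fro_ge0 m n (A : 'M[C]_(m, n)) : 0 <= fro A.
Proof. by apply: sumr_ge0 => i _; apply: sumr_ge0 => j _; exact: nsq_ge0. Qed.

Lemma fro0 m n : fro (0 : 'M[C]_(m, n)) = 0.
Proof. by rewrite /fro big1// => i _; rewrite big1// => j _; rewrite mxE nsq0. Qed.

Lemma fro_eq0 m n (A : 'M[C]_(m, n)) : fro A = 0 -> A = 0.
Proof.
move=> /eqP; rewrite psumr_eq0; last first.
  by move=> i _; apply: sumr_ge0 => j _; exact: nsq_ge0.
move=> /allP A0; apply/matrixP => i j.
have := A0 i (mem_index_enum _) => /=.
rewrite psumr_eq0; last by move=> k _; exact: nsq_ge0.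
move=> /allP /(_ j (mem_index_enum _)) /= /eqP /nsq_eq0 ->.
by rewrite mxE.
Qed.

Lemma fro_tr m n (A : 'M[C]_(m, n)) : fro A^T = fro A.
Proof.
by rewrite /fro exchange_big; apply: eq_bigr => i _; apply: eq_bigr => j _; rewrite mxE.
Qed.

Lemma fro_adj m n (A : 'M[C]_(m, n)) : fro (adjmx A) = fro A.
Proof.
rewrite -fro_tr /fro; apply: eq_bigr => i _; apply: eq_bigr => j _.
by rewrite !mxE nsqJ.
Qed.

Lemma froZ m n (c : C) (A : 'M[C]_(m, n)) : fro (c *: A) = nsq c * fro A.
Proof.
rewrite /fro mulr_sumr; apply: eq_bigr => i _; rewrite mulr_sumr.
by apply: eq_bigr => j _; rewrite mxE nsqM.
Qed.

Lemma fro_young (e : R) m n (A B : 'M[C]_(m, n)) : 0 < e ->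
  fro (A + B) <= (1 + e) * fro A + (1 + e^-1) * fro B.
Proof.
move=> e0; rewrite /fro !mulr_sumr -big_split/=; apply: ler_sum => i _.
rewrite !mulr_sumr -big_split/=; apply: ler_sum => j _.
by rewrite mxE; exact: nsq_young.
Qed.

Lemma fro_mul m n p (A : 'M[C]_(m, n)) (B : 'M[C]_(n, p)) :
  fro (A *m B) <= fro A * fro B.
Proof.
rewrite /fro mulr_suml; apply: ler_sum => i _.
rewrite [X in _ <= _ * X]exchange_big mulr_sumr/=; apply: ler_sum => j _.
by rewrite mxE; exact: nsq_sum_mul.
Qed.

Lemma fro_row_mx m n p (A : 'M[C]_(m, n)) (B : 'M[C]_(m, p)) :
  fro (row_mx A B) = fro A + fro B.
Proof.
rewrite /fro -big_split/=; apply: eq_bigr => i _; rewrite big_split_ord/=.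
by congr (_ + _); apply: eq_bigr => j _; rewrite ?row_mxEl ?row_mxEr.
Qed.

Lemma fro_rV n (y : 'rV[C]_n) : fro y = \sum_j nsq (y 0 j).
Proof. by rewrite /fro big_ord1. Qed.

Lemma fro_cV n (y : 'cV[C]_n) : fro y = \sum_j nsq (y j 0).
Proof. by apply: eq_bigr => i _; rewrite big_ord1. Qed.

Lemma fro_11 (y : 'M[C]_1) : fro y = nsq (y 0 0).
Proof. by rewrite fro_rV big_ord1. Qed.

Lemma fro_rows m n (A : 'M[C]_(m, n)) : fro A = \sum_i fro (row i A).
Proof.
by apply: eq_bigr => i _; rewrite fro_rV; apply: eq_bigr => j _; rewrite mxE.
Qed.

Lemma adjmxM m n p (A : 'M[C]_(m, n)) (B : 'M[C]_(n, p)) :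
  adjmx (A *m B) = adjmx B *m adjmx A.
Proof. by rewrite /adjmx trmx_mul map_mxM. Qed.

Lemma adjmxK m n (A : 'M[C]_(m, n)) : adjmx (adjmx A) = A.
Proof. by apply/matrixP => i j; rewrite !mxE conjcK. Qed.

Lemma adjmxD m n (A B : 'M[C]_(m, n)) : adjmx (A + B) = adjmx A + adjmx B.
Proof. by apply/matrixP => i j; rewrite !mxE rmorphD. Qed.

Lemma mul_adj_fro n (y : 'rV[C]_n) : (y *m adjmx y) 0 0 = (fro y)%:C.
Proof.
rewrite mxE fro_rV rmorph_sum; apply: eq_bigr => j _.
by rewrite !mxE mulCJ.
Qed.

Lemma fro_sum_le (J : Type) (s : seq J) m n (f : J -> 'M[C]_(m, n)) :
  fro (\sum_(k <- s) f k) <= (size s)%:R * \sum_(k <- s) fro (f k).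
Proof.
rewrite /fro [X in _ * X]exchange_big mulr_sumr/=; apply: ler_sum => i _.
rewrite [X in _ * X]exchange_big mulr_sumr/=; apply: ler_sum => j _.
by rewrite summxE; exact: nsq_sum_le.
Qed.

Lemma vnorm_fro n (v : 'cV[C]_n) : vnorm v = Num.sqrt (fro v).
Proof. by rewrite fro_cV; congr Num.sqrt; apply: eq_bigr => k _; rewrite normc_sqr. Qed.

Lemma opnorm_le m (A : 'M[C]_m) (c : R) : 0 <= c ->
  (forall v : 'cV_m, fro (A *m v) <= c ^+ 2 * fro v) -> opnorm A <= c.
Proof.
move=> c0 h; apply: sup_le_ub => /=.
  by exists (vnorm (A *m 0)), 0 => //=; rewrite vnorm_fro fro0 sqrtr0.
move=> _ [v v1 <-]; rewrite vnorm_fro.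
move: v1; rewrite /= vnorm_fro => v1.
have f1 : fro v <= 1.
  by rewrite -[fro v]sqr_sqrtr ?fro_ge0// expr_le1// sqrtr_ge0.
rewrite -(ger0_norm c0) -sqrtr_sqr ler_sqrt ?sqr_ge0//.
by apply: le_trans (h v) _; rewrite ler_piMr// sqr_ge0.
Qed.

Lemma opnorm_has_sup m (A : 'M[C]_m) :
  has_sup [set vnorm (A *m v) | v in [set v : 'cV[C]_m | vnorm v <= 1]].
Proof.
split.
  by exists (vnorm (A *m 0)), 0 => //=; rewrite vnorm_fro fro0 sqrtr0.
exists (Num.sqrt (fro A)) => _ [v v1 <-]; move: v1; rewrite /= !vnorm_fro => v1.
have f1 : fro v <= 1.
  by rewrite -[fro v]sqr_sqrtr ?fro_ge0// expr_le1// sqrtr_ge0.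
rewrite ler_sqrt ?fro_ge0//; apply: le_trans (fro_mul _ _) _.
by rewrite ler_piMr// fro_ge0.
Qed.

Lemma opnorm_ge0 m (A : 'M[C]_m) : 0 <= opnorm A.
Proof.
apply: le_trans (ub_le_sup (opnorm_has_sup A).2 (ex_intro2 _ _ 0 _ erefl)) => /=.
  by rewrite vnorm_fro sqrtr_ge0.
by rewrite vnorm_fro fro0 sqrtr0.
Qed.

Lemma opnorm_mulc m (A : 'M[C]_m) (c : R) (v : 'cV_m) : opnorm A <= c ->
  fro (A *m v) <= c ^+ 2 * fro v.
Proof.
move=> Ac; have c0 : 0 <= c by exact: le_trans (opnorm_ge0 A) Ac.
have [v0|v0] := eqVneq (fro v) 0.
  by rewrite (fro_eq0 v0) mulmx0 !fro0 mulr0.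
have vp : 0 < fro v by rewrite lt_def v0 fro_ge0.
pose u := (Num.sqrt (fro v))^-1%:C *: v.
have nu : nsq ((Num.sqrt (fro v))^-1%:C : C) = (fro v)^-1.
  by rewrite nsqR exprVn sqr_sqrtr ?fro_ge0.
have u1 : vnorm u <= 1.
  by rewrite vnorm_fro /u froZ nu mulVf// sqrtr1.
have : vnorm (A *m u) <= c.
  by apply: le_trans Ac; apply: (ub_le_sup (opnorm_has_sup A).2); exists u.
have cE : c = Num.sqrt (c ^+ 2) by rewrite sqrtr_sqr ger0_norm.
rewrite vnorm_fro -scalemxAr froZ nu [X in _ <= X -> _]cE ler_sqrt ?sqr_ge0//.
by rewrite mulrC ler_pdivrMr.
Qed.

(** With z = y A, the number |z|^2 is y applied to A z^*, so |z|^4 <= |y|^2 c^2 |z|^2: passing from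
    columns to rows does not change the norm. *)
Lemma opnorm_mulr m (A : 'M[C]_m) (c : R) (y : 'rV_m) : opnorm A <= c ->
  fro (y *m A) <= c ^+ 2 * fro y.
Proof.
move=> Ac; set z := y *m A.
have [z0|z0] := eqVneq (fro z) 0; first by rewrite z0 mulr_ge0 ?sqr_ge0 ?fro_ge0.
have zp : 0 < fro z by rewrite lt_def z0 fro_ge0.
have : fro z ^+ 2 <= fro y * (c ^+ 2 * fro z).
  rewrite -nsqR -mul_adj_fro -fro_11 {1}/z -mulmxA.
  apply: le_trans (fro_mul _ _) _; rewrite ler_wpM2l ?fro_ge0//.
  by apply: le_trans (opnorm_mulc _ Ac) _; rewrite fro_adj.
by rewrite expr2 mulrA ler_pM2r// mulrC.
Qed.

Lemma opnorm_le_row m (A : 'M[C]_m) (c : R) : 0 <= c ->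
  (forall y : 'rV_m, fro (y *m A) <= c ^+ 2 * fro y) -> opnorm A <= c.
Proof.
move=> c0 h; apply: opnorm_le => // v; set z := A *m v.
have [z0|z0] := eqVneq (fro z) 0; first by rewrite z0 mulr_ge0 ?sqr_ge0 ?fro_ge0.
have zp : 0 < fro z by rewrite lt_def z0 fro_ge0.
have : fro z ^+ 2 <= (c ^+ 2 * fro z) * fro v.
  rewrite -[X in X ^+ 2]fro_adj -nsqR -mul_adj_fro adjmxK -fro_11 {2}/z mulmxA.
  apply: le_trans (fro_mul _ _) _; rewrite ler_wpM2r ?fro_ge0//.
  by apply: le_trans (h _) _; rewrite fro_adj.
by rewrite expr2 mulrAC ler_pM2r.
Qed.

Lemma cvg_mx (T : Type) (F : set_system T) {FF : Filter F} m n
    (u : T -> 'M[C]_(m, n)) (A : 'M[C]_(m, n)) :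
  (forall i j, (fun t => u t i j) @ F --> A i j) -> u @ F --> A.
Proof.
move=> uA; rewrite (matrix_sum_delta A).
rewrite (_ : u = fun t => \sum_i \sum_j u t i j *: delta_mx i j); last first.
  by apply/funext => t; rewrite -matrix_sum_delta.
apply: cvg_big => [|i _]; first exact: add_continuous.
apply: cvg_big => [|j _]; first exact: add_continuous.
by apply: cvgZr_tmp; exact: uA.
Qed.

Lemma cvg_mx_entry (T : Type) (F : set_system T) {FF : Filter F} m n
    (u : T -> 'M[C]_(m, n)) (A : 'M[C]_(m, n)) i j :
  u @ F --> A -> (fun t => u t i j) @ F --> A i j.
Proof.
move=> uA.
apply: (@cvg_comp _ _ _ u (fun M : 'M[C]_(m, n) => M i j) F (nbhs A) _ uA).
exact: (@coord_continuous C m n i j A).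
Qed.

Lemma cvg_mulmx (T : Type) (F : set_system T) {FF : Filter F} m n p q
    (u : T -> 'M[C]_(m, n)) (A : 'M[C]_(m, n)) (B : 'M[C]_(p, m)) (D : 'M[C]_(n, q)) :
  u @ F --> A -> (fun t => B *m u t *m D) @ F --> B *m A *m D.
Proof.
move=> uA; apply: cvg_mx => i j; rewrite mxE.
under eq_fun do rewrite mxE.
apply: cvg_big => [|k _]; first exact: add_continuous.
apply: cvgMr_tmp; rewrite mxE.
under eq_fun do rewrite mxE.
apply: cvg_big => [|l _]; first exact: add_continuous.
by apply: cvgMl_tmp; exact: cvg_mx_entry.
Qed.

End Matrices.
Arguments cvg_mulmx {R T F FF m n p q u A} B D _.
Arguments cvg_mx_entry {R T F FF m n u A} i j _.

Section Ball.
Context {R : realType} {d : option nat}.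
Local Notation C := R[i].
Local Notation L := (letter d).

Lemma monomial_nil m (X : mtuple R d m) : monomial X [::] = 1%:M.
Proof. by rewrite /monomial big_nil. Qed.

Lemma monomial_cons m (X : mtuple R d m) i w :
  monomial X (i :: w) = X i *m monomial X w.
Proof. by rewrite /monomial big_cons. Qed.

Lemma monomial_cat m (X : mtuple R d m) v w :
  monomial X (v ++ w) = monomial X v *m monomial X w.
Proof.
elim: v => [|i v IH]; first by rewrite monomial_nil mul1mx.
by rewrite cat_cons !monomial_cons IH mulmxA.
Qed.

(** The inequality between forms [sum_i X_i X_i^* <= t], tested on finitely many letters so that no
    convergence is presupposed when d is infinite. *)
Definition row_bounded m (t : R) (X : mtuple R d m) : Prop :=
  forall (s : seq L) (y : 'rV[C]_m), uniq s ->
    \sum_(i <- s) fro (y *m X i) <= t * fro y.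

Lemma gram_form m (X : mtuple R d m) i (y z : 'rV[C]_m) :
  y *m gram X i *m adjmx z = (y *m X i) *m adjmx (z *m X i).
Proof. by rewrite /gram adjmxM !mulmxA. Qed.

Lemma form_sum m (X : mtuple R d m) (F : {fset L}) (y : 'rV[C]_m) :
  (y *m partial_sum (gram X) F *m adjmx y) 0 0 =
  (partial_sum (fun i => fro (y *m X i)) F)%:C.
Proof.
rewrite !partial_sumE mulmx_sumr mulmx_suml summxE rmorph_sum.
by apply: eq_bigr => i _; rewrite gram_form mul_adj_fro.
Qed.

(** The (j, k) entry of [gram X i] is the inner product of rows j and k of [X i], so it is dominated
    by the sum of their squared norms, and these are summable over i by [row_bounded] at basis
    vectors. *)
Lemma row_bounded_gram m (X : mtuple R d m) (c : R) :
  row_bounded c X ->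
  partial_sum (gram X) @ totally --> summability.sum (gram X).
Proof.
move=> Xc.
suff [G hG] : exists G : 'M[C]_m, partial_sum (gram X) @ totally --> G.
  by rewrite /summability.sum (cvg_lim _ hG).
exists (\matrix_(j, k) summability.sum (fun i => gram X i j k)).
apply: cvg_mx => j k; rewrite mxE.
rewrite (_ : (fun F => _) = partial_sum (fun i => gram X i j k)); last first.
  by apply/funext => F; rewrite /partial_sum summxE.
apply: csummable_cvg.
apply: (@nsum_lt _ _ _ (c * fro (delta_mx 0 j : 'rV[C]_m) +
    c * fro (delta_mx 0 k : 'rV[C]_m))).
  by move=> i; case: (gram X i j k) => p q; exact: sqrtr_ge0.
move=> s us; apply: le_trans (lerD (Xc s _ us) (Xc s _ us)).
rewrite -big_split/=; apply: ler_sum => i _.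
rewrite -!rowE.
have : nsq (gram X i j k) <= fro (row j (X i)) * fro (row k (X i)).
  rewrite mxE; apply: le_trans (nsq_sum_mul _ _ _ _) _.
  rewrite !fro_rV le_eqVlt; apply/orP; left; apply/eqP; congr (_ * _).
    by apply: eq_bigr => l _; rewrite mxE.
  by apply: eq_bigr => l _; rewrite !mxE nsqJ.
rewrite -normc_sqr.
have : 0 <= Normc.normc (gram X i j k) by case: (gram _ _ _ _) => ? ? /=; exact: sqrtr_ge0.
have := fro_ge0 (row j (X i)); have := fro_ge0 (row k (X i)).
move: (fro _) (fro _) (Normc.normc _) => q p z q0 p0 z0 zpq.
by rewrite -(ler_pXn2r (n:=2))// ?nnegrE ?addr_ge0//; nra.
Qed.

Lemma row_bounded_form m (X : mtuple R d m) (c : R) (y : 'rV[C]_m) :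
  row_bounded c X ->
  nsummable (fun i => fro (y *m X i)) /\
  (y *m summability.sum (gram X) *m adjmx y) 0 0 =
  (rsum (fun i => fro (y *m X i)))%:C.
Proof.
move=> Xc.
have p0 i : 0 <= fro (y *m X i) by exact: fro_ge0.
have no : nsummable (fun i => fro (y *m X i)).
  by apply: (nsum_lt p0) => s us; exact: Xc.
split=> //.
have h := cvg_mx_entry 0 0 (cvg_mulmx y (adjmx y) (row_bounded_gram Xc)).
have FT : Filter (@totally L) by exact: _.
have {}h := h FT FT; apply: (cvgC_unique h).
under eq_fun do rewrite form_sum.
apply: (@cvgC _ _ _ FT _ (rsum (fun i => fro (y *m X i))) 0) => /=; last exact: cvg_cst.
exact: rsum_cvg.
Qed.

(** Cauchy-Schwarz for the positive form of a partial Gram sum, applied to [v] and to its image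
    [u]. *)
Lemma row_bounded_mul m (X : mtuple R d m) (c : R) (F : {fset L}) (v : 'cV[C]_m) :
  0 <= c -> row_bounded c X ->
  fro (partial_sum (gram X) F *m v) <= c ^+ 2 * fro v.
Proof.
move=> c0 Xc; set u := _ *m v.
have [z0|z0] := eqVneq (fro u) 0; first by rewrite z0 mulr_ge0 ?sqr_ge0 ?fro_ge0.
have zp : 0 < fro u by rewrite lt_def z0 fro_ge0.
pose y := adjmx u; pose x := adjmx v.
have : fro u ^+ 2 <= (c * fro y) * (c * fro x).
  rewrite -[X in X ^+ 2]fro_adj -nsqR -mul_adj_fro adjmxK {2}/u.
  rewrite partial_sumE mulmx_suml mulmx_sumr summxE.
  apply: (@le_trans _ _ ((\sum_(i <- F) fro (y *m X i)) * (\sum_(i <- F) fro (x *m X i)))).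
    apply: nsq_sum_bound => i; rewrite ?fro_ge0//.
    have -> : adjmx u *m (gram X i *m v) = (y *m X i) *m adjmx (x *m X i).
      by rewrite -gram_form /x adjmxK mulmxA.
    rewrite -fro_11; apply: le_trans (fro_mul _ _) _.
    by rewrite fro_adj.
  by apply: ler_pM; rewrite ?sumr_ge0 ?Xc ?fset_uniq// => i _; exact: fro_ge0.
rewrite /x /y !fro_adj (_ : _ * _ = (c ^+ 2 * fro v) * fro u); last by ring.
by rewrite expr2 ler_pM2r.
Qed.

Lemma nc_ball_row_bounded m (X : mtuple R d m) : nc_ball X ->
  (0 < m)%N /\ exists2 t : R, 0 <= t < 1 & row_bounded t X.
Proof.
move=> [[m0 [c hc]] X1]; split=> //; exists (row_normsq X).
  by rewrite opnorm_ge0.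
have c0 : 0 <= c by apply: le_trans (hc fset0); exact: opnorm_ge0.
have form_le (A : 'M[C]_m) (e k : R) (y : 'rV[C]_m) : 0 <= k -> opnorm A <= k ->
    (y *m A *m adjmx y) 0 0 = e%:C -> e <= k * fro y.
  move=> k0 Ak E.
  have [/ltW e0|e0] := ltP e 0; first by apply: le_trans e0 _; rewrite mulr_ge0// fro_ge0.
  rewrite -(ler_pXn2r (n:=2))// ?nnegrE ?mulr_ge0 ?fro_ge0//.
  rewrite -nsqR -E -fro_11; apply: le_trans (fro_mul _ _) _.
  rewrite fro_adj exprMn [fro y ^+ 2]expr2 mulrA ler_wpM2r ?fro_ge0//.
  exact: opnorm_mulr.
(* The crude constant of [nc_space] comes first: it makes the Gram sum converge, and only then does
   the norm of the limit give the sharp constant. *)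
have Xc : row_bounded c X.
  move=> s y us; have := form_sum X [fset i in s]%fset y.
  move=> /(form_le _ _ _ _ c0 (hc _)); apply: le_trans.
  rewrite partial_sumE le_eqVlt; apply/orP; left; apply/eqP; apply: perm_big.
  by apply: uniq_perm; rewrite ?fset_uniq// => i; rewrite inE.
move=> s y us; have [no E] := row_bounded_form y Xc.
have := form_le _ _ _ _ (opnorm_ge0 _) (lexx _) E; apply: le_trans.
by apply: rsum_ge => // i; exact: fro_ge0.
Qed.

Lemma row_bounded_nc_ball m (X : mtuple R d m) (t : R) :
  (0 < m)%N -> 0 <= t < 1 -> row_bounded t X -> nc_ball X.
Proof.
move=> m0 /andP[t0 t1] Xt; split.
  split=> //; exists t => F; apply: opnorm_le => // v.
  exact: row_bounded_mul.
apply: le_lt_trans t1; apply: opnorm_le => // v.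
have /(cvg_mulmx (1%:M) v) := row_bounded_gram Xt; rewrite mul1mx.
under eq_fun do rewrite mul1mx.
move=> h.
have hf : (fun F => fro (partial_sum (gram X) F *m v)) @ totally -->
    fro (summability.sum (gram X) *m v).
  under eq_fun do rewrite fro_cV.
  rewrite fro_cV; apply: cvg_big => [|k _]; first exact: add_continuous.
  have [hr hi] := cvgC_Re (cvg_mx_entry k 0 h).
  by apply: cvgD; under eq_fun do rewrite expr2; apply: cvgM.
apply: (cvgr_to_le hf); near=> F; exact: row_bounded_mul.
Unshelve. all: by end_near. Qed.

End Ball.

(** * Kernels and evaluation *)

Section WordSeries.
Context {R : realType} {T : choiceType}.

Lemma nsum_size (f : seq T -> R) : (forall w, 0 <= f w) ->
  nsum f = (\sum_(0 <= n <oo) nsum (fun t : n.-tuple T => f t))%E.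
Proof.
move=> f0; rewrite /nsum.
have -> : [set: seq T] = \bigcup_n [set w | size w = n].
  by apply/seteqP; split => // w _; exists (size w).
rewrite nneseries_sum_bigcup.
- apply: eq_eseriesr => n _; apply: reindex_esum; split.
  + by move=> t _ /=; rewrite size_tuple.
  + by move=> s t _ _; exact: val_inj.
  + by move=> w /= sw; exists (tcast sw (in_tuple w)) => //; rewrite val_tcast.
- by move=> i j _ _ [w [/= <- <-]].
- by move=> w; rewrite lee_fin.
Qed.

(** [nc_eval] sums by homogeneous degree while [pair] sums unconditionally; this records that both
    summations exist and have the same value. *)
Definition size_summable (g : seq T -> R[i]) (h : nat -> R[i]) (l : R[i]) : Prop :=
  [/\ forall n, partial_sum (fun t : n.-tuple T => g t) @ totally --> h n,
      series h @ \oo --> l & partial_sum g @ totally --> l].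

Lemma size_summable_lin g g' h h' l l' (c c' : R[i]) :
  size_summable g h l -> size_summable g' h' l' ->
  size_summable (fun w => c * g w + c' * g' w) (fun n => c * h n + c' * h' n)
    (c * l + c' * l').
Proof.
have E (I : choiceType) (a b : I -> R[i]) (x y : R[i]) :
    partial_sum a @ totally --> x -> partial_sum b @ totally --> y ->
    partial_sum (fun k => c * a k + c' * b k) @ totally --> c * x + c' * y.
  move=> ax biy; rewrite (_ : partial_sum _ =
    (fun F => c * partial_sum a F + c' * partial_sum b F)).
    exact: (@cvgC_lin _ _ _ _ (partial_sum a) (partial_sum b) x y c c' ax biy).
  by apply/funext => F; rewrite /partial_sum big_split/= -!mulr_sumr.
move=> [h1 h2 h3] [h1' h2' h3']; split.
- by move=> n; exact: (E _ (fun t : n.-tuple T => g t) (fun t : n.-tuple T => g' t) _ _ (h1 n) (h1' n)).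
- rewrite (_ : series _ = fun n => c * series h n + c' * series h' n); last first.
    by apply/funext => n; rewrite /series/= big_split/= -!mulr_sumr.
  exact: (@cvgC_lin _ _ _ _ (series h) (series h') l l' c c' h2 h2').
- exact: (E _ g g' l l' h3 h3').
Qed.

Lemma cvg_realC (J : Type) (F : set_system J) {FF : Filter F} (u : J -> R) (l : R) :
  u @ F --> l -> (fun t => (u t)%:C) @ F --> (l%:C : R[i]).
Proof. by move=> ul; apply: (@cvgC _ _ _ FF _ l 0) => //=; exact: cvg_cst. Qed.

Lemma size_summable_ge0 (f : seq T -> R) : (forall w, 0 <= f w) -> nsummable f ->
  exists h l, size_summable (fun w => (f w)%:C) h l.
Proof.
move=> f0 fs.
have fn0 n : (0 <= nsum (fun t : n.-tuple T => f t))%E by apply: nsum_ge0.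
have fns n : nsummable (fun t : n.-tuple T => f t).
  apply: (@nsum_lt _ _ _ (rsum f)) => // s us.
  have -> : \sum_(t <- s) f t = \sum_(w <- map val s) f w by rewrite big_map.
  by apply: rsum_ge => //; rewrite map_inj_uniq//; exact: val_inj.
exists (fun n => (rsum (fun t : n.-tuple T => f t))%:C), (rsum f)%:C.
have E (I : choiceType) (a : I -> R) (x : R) : partial_sum a @ totally --> x ->
    partial_sum (fun k => (a k)%:C) @ totally --> (x%:C : R[i]).
  move=> ax; rewrite (_ : partial_sum _ = fun F => (partial_sum a F)%:C).
    exact: cvg_realC.
  by apply/funext => F; rewrite /partial_sum rmorph_sum.
split.
- by move=> n; exact: (E _ (fun t : n.-tuple T => f t) _ (rsum_cvg (fun t => f0 _) (fns n))).
- rewrite (_ : series _ = fun n => (series (fun n => rsum (fun t : n.-tuple T => f t)) n)%:C).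
    apply: cvg_realC.
    have := @is_cvg_nneseries R (fun n => nsum (fun t : n.-tuple T => f t)) xpredT 0 (fun n _ _ => fn0 n).
    move=> /cvg_ex[l hl].
    have El : l = (rsum f)%:E.
      by rewrite -nsum_rsum// nsum_size//; apply/esym/cvg_lim.
    move: hl; rewrite El => /fine_cvg.
    rewrite (_ : fine \o _ = series (fun n => rsum (fun t : n.-tuple T => f t)))//.
    apply/funext => n; rewrite /series /=.
    have -> : (\sum_(0 <= i < n) nsum (fun t : i.-tuple T => f t))%E =
        (\sum_(0 <= i < n) (rsum (fun t : i.-tuple T => f t))%:E)%E.
      by apply: eq_bigr => k _; rewrite nsum_rsum.
    by rewrite sumEFin.
  by apply/funext => n; rewrite /series/= rmorph_sum.
- exact: (E _ f _ (rsum_cvg f0 fs)).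
Qed.

Lemma csummable_size (g : seq T -> R[i]) : csummable g ->
  exists h l, size_summable g h l.
Proof.
move=> gs.
have Rec (f : seq T -> R) : (forall k, `|f k| <= Normc.normc (g k)) ->
    exists h l, size_summable (fun w => (f w)%:C) h l.
  move=> fg.
  have n0 k : 0 <= `|f k| by [].
  have no : nsummable (fun k => `|f k|) by apply: le_lt_trans gs; exact: le_nsum.
  have p0 k : 0 <= `|f k| - f k by rewrite subr_ge0 ler_norm.
  have po : nsummable (fun k => `|f k| - f k).
    have := @nsum_lin _ _ _ _ 2 0 n0 n0 (ler0n _ _) (lexx _) no no.
    apply: le_lt_trans; apply: le_nsum => k; rewrite mul0r addr0 mulr2n mulrDl mul1r.
    by rewrite lerD2l (le_trans (ler_norm _))// normrN.
  have [h [l H]] := size_summable_ge0 n0 no.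
  have [h' [l' H']] := size_summable_ge0 p0 po.
  have := size_summable_lin 1 (-1) H H'.
  set G := (fun w => _) => HH.
  exists (fun n => 1 * h n + -1 * h' n), (1 * l + -1 * l').
  rewrite (_ : (fun w => _) = G)//; apply/funext => w.
  by rewrite /G mul1r mulN1r -rmorphB opprB addrC subrK.
have [w|h [l H]] := Rec (fun w => complex.Re (g w)).
  case: (g w) => p q /=.
  by rewrite -sqrtr_sqr ler_sqrt ?addr_ge0 ?sqr_ge0// lerDl sqr_ge0.
have [w|h' [l' H']] := Rec (fun w => complex.Im (g w)).
  case: (g w) => p q /=.
  by rewrite -sqrtr_sqr ler_sqrt ?addr_ge0 ?sqr_ge0// lerDr sqr_ge0.
have := size_summable_lin 1 'i%C H H'.
set G := (fun w => _) => HH.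
exists (fun n => 1 * h n + 'i%C * h' n), (1 * l + 'i%C * l').
rewrite (_ : g = G)//; apply/funext => w.
by rewrite /G mul1r -complexE.
Qed.

End WordSeries.

(** * Recursion over words, kernels, and evaluation as a pairing *)

Section Kernels.
Context {R : realType} {d : option nat}.
Local Notation C := R[i].
Local Notation L := (letter d).
Local Notation W := (word d).

Definition below (n : nat) (f : W -> R) : W -> R :=
  fun w => if (size w < n)%N then f w else 0.

Lemma below_ge0 n f : (forall w, 0 <= f w) -> forall w, 0 <= below n f w.
Proof. by move=> f0 w; rewrite /below; case: ifP. Qed.

Lemma nsum_below (f : W -> R) (c : R) : (forall w, 0 <= f w) ->
  (forall n, (nsum (below n f) <= c%:E)%E) -> (nsum f <= c%:E)%E.
Proof.
move=> f0 h; apply/nsum_leP => // s us.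
have := h (\max_(w <- s) size w).+1; move/(nsum_leP _ (below_ge0 _ f0)) => /(_ s us).
apply: le_trans; rewrite le_eqVlt; apply/orP; left; apply/eqP.
rewrite big_seq [RHS]big_seq; apply: eq_bigr => w ws.
by rewrite /below ltnS leq_bigmax_seq.
Qed.

Lemma below_recurrence m (X : mtuple R d m) (f : 'rV[C]_m -> R) n (y : 'rV[C]_m) :
  (forall y, 0 <= f y) ->
  nsum (below n.+1 (fun w => f (y *m monomial X w))) =
  ((f y)%:E + \esum_(i in [set: L])
     nsum (below n (fun w => f ((y *m X i) *m monomial X w))))%E.
Proof.
move=> f0; rewrite nsum_cons; last by apply: below_ge0.
rewrite nsum_pair; last by move=> p; exact: below_ge0.
rewrite {1}/below /= monomial_nil mulmx1; congr (_ + _)%E.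
apply: eq_esum => i _; rewrite /nsum; apply: eq_esum => w _.
by rewrite /below /= ltnS monomial_cons mulmxA.
Qed.

Lemma nsum_below0 (f : W -> R) : nsum (below 0 f) = 0%E.
Proof. by rewrite /nsum esum1. Qed.

(** [c] is a supersolution of the recursion that splits off the first letter, so it bounds the sum
    over words shorter than [n] by induction on [n], for all [y] at once. *)
Lemma word_sum_le m (X : mtuple R d m) (f c : 'rV[C]_m -> R) :
  (forall y, 0 <= f y) -> (forall y, 0 <= c y) ->
  (forall y, ((f y)%:E + nsum (fun i : L => c (y *m X i)) <= (c y)%:E)%E) ->
  forall y, (nsum (fun w => f (y *m monomial X w)) <= (c y)%:E)%E.
Proof.
move=> f0 c0 h y; apply: nsum_below => // n.
elim: n y => [|n IH] y; first by rewrite nsum_below0 lee_fin.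
rewrite below_recurrence//; apply: le_trans (h y); rewrite leeD2l//.
by apply: le_esum => i _; exact: IH.
Qed.

Lemma nsum_fro_bounded m (X : mtuple R d m) (t : R) (y : 'rV[C]_m) :
  row_bounded t X -> (nsum (fun i : L => fro (y *m X i)) <= (t * fro y)%:E)%E.
Proof.
by move=> Xt; apply/nsum_leP => [i|s us]; [exact: fro_ge0|exact: Xt].
Qed.

Lemma nsumZ (I : choiceType) (k : R) (f : I -> R) : 0 <= k -> (forall i, 0 <= f i) ->
  nsummable f -> nsum (fun i => k * f i) = (k%:E * nsum f)%E.
Proof.
move=> k0 f0 fs.
have [|h1 h2] := @rsum_lin _ _ f f k 0 f0 f0 _ fs fs.
  by move=> i; rewrite mul0r addr0 mulr_ge0.
move: h1 h2; rewrite mul0r addr0.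
rewrite (_ : (fun i => k * f i + 0 * f i) = (fun i => k * f i)) => [h1 h2|]; last first.
  by apply/funext => i; rewrite mul0r addr0.
by rewrite (nsum_rsum f0 fs) nsum_rsum ?h2// => i; rewrite mulr_ge0.
Qed.

(** The geometric series: the supersolution is |y|^2 / (1 - t), which solves |y|^2 + t c = c. *)
Lemma word_sum_fro m (X : mtuple R d m) (t : R) (y : 'rV[C]_m) :
  0 <= t < 1 -> row_bounded t X ->
  (nsum (fun w => fro (y *m monomial X w)) <= (fro y / (1 - t))%:E)%E.
Proof.
move=> /andP[t0 t1] Xt.
have p0 : 0 < 1 - t by rewrite subr_gt0.
apply: (@word_sum_le _ X (@fro _ _ _) (fun y => fro y / (1 - t))) => [z|z|{}y].
- exact: fro_ge0.
- by rewrite divr_ge0 ?fro_ge0// ltW.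
- have no : nsummable (fun i : L => fro (y *m X i)).
    by apply: le_lt_trans (nsum_fro_bounded y Xt) _; rewrite ltry.
  have -> : (fun i => fro (y *m X i) / (1 - t)) =
      (fun i => (1 - t)^-1 * fro (y *m X i)).
    by apply/funext => i; rewrite mulrC.
  have i0 : 0 <= (1 - t)^-1 by rewrite invr_ge0 ltW.
  rewrite (nsumZ i0 _ no); last by move=> i; exact: fro_ge0.
  apply: (@le_trans _ _ ((fro y)%:E + (1 - t)^-1%:E * (t * fro y)%:E)%E).
    by rewrite leeD2l// lee_wpmul2l ?lee_fin//; exact: nsum_fro_bounded.
  rewrite -EFinM -EFinD lee_fin le_eqVlt; apply/orP; left; apply/eqP.
  by field; rewrite gt_eqF.
Qed.

Lemma fro_monomial_summable m (X : mtuple R d m) : nc_ball X ->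
  nsummable (fun w => fro (monomial X w)).
Proof.
move=> /nc_ball_row_bounded [_ [t t01 Xt]].
apply: (@nsum_lt _ _ _ (\sum_(j < m) fro (delta_mx 0 j : 'rV[C]_m) / (1 - t))).
  by move=> w; exact: fro_ge0.
move=> s us.
have -> : \sum_(w <- s) fro (monomial X w) =
    \sum_(j < m) \sum_(w <- s) fro ((delta_mx 0 j : 'rV[C]_m) *m monomial X w).
  rewrite [RHS]exchange_big; apply: eq_bigr => w _; rewrite [LHS]fro_rows.
  by apply: eq_bigr => j _; rewrite rowE.
apply: ler_sum => j _.
have := word_sum_fro (delta_mx 0 j) t01 Xt.
by move/nsum_leP; apply => // w; exact: fro_ge0.
Qed.

Definition kernel_fun m (A : 'M[C]_m) (X : mtuple R d m) : W -> C :=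
  fun w => \tr (A *m monomial X w).

Lemma nsq_mxtrace m (A B : 'M[C]_m) : nsq (\tr (A *m B)) <= fro A * fro B.
Proof.
rewrite /mxtrace -[fro B]fro_tr !fro_rows.
apply: nsq_sum_bound => i; rewrite ?fro_ge0//.
rewrite mxE; apply: le_trans (nsq_sum_mul _ _ _ _) _.
rewrite le_eqVlt; apply/orP; left; apply/eqP.
by rewrite !fro_rV; congr (_ * _); apply: eq_bigr => j _; rewrite !mxE.
Qed.

Lemma ell2_kernel m (A : 'M[C]_m) (X : mtuple R d m) :
  nc_ball X -> ell2 (kernel_fun A X).
Proof.
move=> /fro_monomial_summable Xs.
have p0 w : 0 <= fro (monomial X w) by exact: fro_ge0.
apply: (ell2_le (c := fro A * rsum (fun w => fro (monomial X w))) _).1 => s us.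
apply: (@le_trans _ _ (\sum_(w <- s) fro A * fro (monomial X w))).
  by apply: ler_sum => w _; exact: nsq_mxtrace.
by rewrite -mulr_sumr ler_wpM2l ?fro_ge0// rsum_ge.
Qed.

Lemma mxtrace_delta m (B : 'M[C]_m) j k : \tr (delta_mx j k *m B) = B k j.
Proof.
rewrite /mxtrace (bigD1 j)//= mxE (bigD1 k)//= mxE !eqxx mul1r.
rewrite !big1 ?addr0//.
  move=> i ij; rewrite mxE big1// => l _.
  by rewrite mxE (negbTE ij) mul0r.
by move=> i ik; rewrite mxE (negbTE ik) andbF mul0r.
Qed.

Lemma kernel_delta m (X : mtuple R d m) j k w :
  kernel_fun (delta_mx j k) X w = monomial X w k j.
Proof. exact: mxtrace_delta. Qed.

Lemma ell2_monomial m (X : mtuple R d m) j k :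
  nc_ball X -> ell2 (fun w => monomial X w j k).
Proof.
move=> Xb; under eq_fun do rewrite -kernel_delta.
exact: ell2_kernel.
Qed.

Lemma nc_eval_cvg (a : W -> C) m (X : mtuple R d m) : ell2 a -> nc_ball X ->
  partial_sum (fun w => a w *: monomial X w) @ totally --> nc_eval a X.
Proof.
move=> a2 Xb.
have H j k := csummable_size (csummable_mul a2 (ell2_monomial j k Xb)).
have {H} [h H] : exists h : 'I_m -> 'I_m -> nat -> C, forall j k, exists l,
    size_summable (fun w => a w * monomial X w j k) (h j k) l.
  have H1 j : exists h : 'I_m -> nat -> C, forall k, exists l,
    size_summable (fun w => a w * monomial X w j k) (h k) l by have [f Hf] := choice (H j); exists f.
  by have [f Hf] := choice H1; exists f.
have {H} [l H] : exists l : 'I_m -> 'I_m -> C, forall j k,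
    size_summable (fun w => a w * monomial X w j k) (h j k) (l j k).
  have H1 j : exists l : 'I_m -> C, forall k,
    size_summable (fun w => a w * monomial X w j k) (h j k) (l k) by have [f Hf] := choice (H j); exists f.
  by have [f Hf] := choice H1; exists f.
have homE n : hom_part a n X = \matrix_(j, k) h j k n.
  apply: cvg_lim => //; apply: cvg_mx => j k; rewrite mxE.
  have [/(_ n) hh _ _] := H j k.
  rewrite (_ : (fun F => _) = partial_sum (fun t : n.-tuple L => a t * monomial X t j k))//.
  by apply/funext => F; rewrite /partial_sum summxE; apply: eq_bigr => i _; rewrite mxE.
have -> : nc_eval a X = \matrix_(j, k) l j k.
  apply: cvg_lim => //; apply: cvg_mx => j k; rewrite mxE.
  have [_ hh _] := H j k.
  rewrite (_ : (fun N => _) = series (h j k))//.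
  by apply/funext => N; rewrite /series/= summxE; apply: eq_bigr => i _; rewrite homE mxE.
apply: cvg_mx => j k; rewrite mxE; have [_ _ hh] := H j k.
rewrite (_ : (fun F => _) = partial_sum (fun w => a w * monomial X w j k))//.
by apply/funext => F; rewrite /partial_sum summxE; apply: eq_bigr => i _; rewrite mxE.
Qed.

Lemma mxtrace_nc_eval (a : W -> C) m (X : mtuple R d m) (A : 'M[C]_m) :
  ell2 a -> nc_ball X -> \tr (A *m nc_eval a X) = pair a (kernel_fun A X).
Proof.
move=> a2 Xb; apply/esym/sum_unique.
have FT : Filter (@totally W) by exact: _.
have := @cvg_mulmx _ _ _ FT _ _ _ _ _ _ A 1%:M (nc_eval_cvg a2 Xb).
rewrite mulmx1 => hA.
rewrite (_ : partial_sum _ = fun F => \sum_j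
    (A *m partial_sum (fun w => a w *: monomial X w) F *m 1%:M) j j).
  apply: cvg_big => [|j _]; first exact: add_continuous.
  exact: cvg_mx_entry.
apply/funext => F; rewrite mulmx1 /partial_sum mulmx_sumr -/(mxtrace _) raddf_sum.
by apply: eq_bigr => w _ /=; rewrite -scalemxAr mxtraceZ.
Qed.

End Kernels.

(** * Von Neumann's inequality and multipliers *)

Section Tails.
Context {R : realType} {I : choiceType}.

Lemma nsummable_tail (g : I -> R) (e : R) : (forall k, 0 <= g k) -> nsummable g ->
  0 < e -> exists2 s : seq I, uniq s & forall s', uniq s' ->
    {in s', forall k, k \notin s} -> \sum_(k <- s') g k <= e.
Proof.
move=> g0 gs e0; have /cvgrPdist_lt /(_ e e0) [F _ HF] := rsum_cvg g0 gs.
exists (enum_fset F) => [|s' us' dis]; first exact: fset_uniq.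
have := HF F (fsubset_refl F); rewrite /= partial_sumE => h.
have : \sum_(k <- F) g k + \sum_(k <- s') g k <= rsum g.
  rewrite -big_cat/=; apply: rsum_ge => //.
  rewrite cat_uniq fset_uniq us' /= andbT; apply/hasPn => k ks.
  exact: dis ks.
move: h; rewrite ltr_norml => /andP[_]; lra.
Qed.

Definition restrict (s : seq I) (f : I -> R[i]) : I -> R[i] :=
  fun k => if k \in s then f k else 0.

Lemma ell2_restrict (s : seq I) (f : I -> R[i]) : ell2 f ->
  ell2 (restrict s f) /\ N2 (restrict s f) <= N2 f.
Proof.
move=> f2; apply: ell2_le => t ut; apply: le_trans (N2_ge f2 ut).
by apply: ler_sum => k _; rewrite /restrict; case: ifP; rewrite // nsq0 nsq_ge0.
Qed.

Lemma ell2_tail (f : I -> R[i]) (e : R) : ell2 f -> 0 < e ->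
  exists2 s : seq I, uniq s &
    ell2 (fun k => f k - restrict s f k) /\ N2 (fun k => f k - restrict s f k) <= e.
Proof.
move=> f2 e0.
have p0 k : 0 <= nsq (f k) by exact: nsq_ge0.
have [s us hs] := nsummable_tail p0 ((ell2E f).1 f2) e0.
exists s => //; apply: ell2_le => t ut.
have u' : uniq [seq k <- t | k \notin s] by exact: filter_uniq.
apply: le_trans (hs _ u' _); last by move=> k; rewrite mem_filter => /andP[].
rewrite big_filter [leLHS](bigID (mem s))/= big1 ?add0r; last first.
  by move=> k ks; rewrite /restrict ks subrr nsq0.
rewrite le_eqVlt; apply/orP; left; apply/eqP; apply: eq_bigr => k /negbTE ks.
by rewrite /restrict ks subr0.
Qed.

Lemma pair_restrict (s : seq I) (a f : I -> R[i]) : uniq s ->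
  (forall k, k \notin s -> f k = 0) -> pair a f = \sum_(k <- s) a k * f k.
Proof.
move=> us f0; apply: sum_unique; apply: cvg_near_cst.
exists [fset k in s]%fset => // F sF; rewrite partial_sumE /=.
rewrite (bigID (mem s))/= [X in _ + X]big1 ?addr0; last first.
  by move=> k ks; rewrite f0// mulr0.
rewrite -big_filter; apply: perm_big; apply: uniq_perm => //.
  by rewrite filter_uniq// fset_uniq.
move=> k; rewrite mem_filter; apply: andb_idr => ks.
by apply: (fsubsetP sF); rewrite inE.
Qed.

Lemma nsq_pair (a b : I -> R[i]) : ell2 a -> ell2 b -> nsq (pair a b) <= N2 a * N2 b.
Proof.
move=> a2 b2; have [hr hi] := cvgC_Re (pair_cvg a2 b2).
have hf : (fun F => nsq (partial_sum (fun k => a k * b k) F)) @ totally -->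
    nsq (pair a b).
  by apply: cvgD; under eq_fun do rewrite expr2; apply: cvgM.
apply: (cvgr_to_le hf); near=> F; rewrite partial_sumE.
apply: le_trans (nsq_sum_mul _ _ _ _) _.
by apply: ler_pM; rewrite ?sumr_ge0 ?N2_ge// => k _; exact: nsq_ge0.
Unshelve. all: by end_near. Qed.

End Tails.

(** * The defect of a strict row contraction *)

Section VonNeumann.
Context {R : realType} {d : option nat}.
Local Notation C := R[i].
Local Notation L := (letter d).
Local Notation W := (word d).

(** By the spectral theorem D = P^* S^2 P with S diagonal and nonnegative; then B = P^* S. *)
Lemma psd_factor m (D : 'M[C]_m) : adjmx D = D ->
  (forall y : 'rV[C]_m, exists2 r : R, 0 <= r & (y *m D *m adjmx y) 0 0 = r%:C) ->
  exists B : 'M[C]_m, D = B *m adjmx B.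
Proof.
move=> Dh Dpos.
have Dn : D \is normalmx by apply/normalmxP; rewrite -/(adjmx D) Dh.
have /orthomx_spectralP := Dn; set P := spectralmx D; set sp := spectral_diag D => E.
have Pu : P \is unitarymx by exact: spectral_unitarymx.
have PP : P *m adjmx P = 1%:M by exact/unitarymxP.
rewrite (invmx_unitary Pu) -/(adjmx P) in E.
have sp_pos i : exists2 r : R, 0 <= r & sp 0 i = r%:C.
  (* The form of [D] at the i-th row of [P], a unit eigenvector, is the i-th eigenvalue. *)
  have [r r0 hr] := Dpos (delta_mx 0 i *m P); exists r => //.
  rewrite -hr {1}E adjmxM !mulmxA -[_ *m P *m adjmx P]mulmxA PP mulmx1.
  rewrite -[_ *m P *m adjmx P]mulmxA PP mulmx1 -rowE.
  have -> : adjmx (delta_mx 0 i : 'rV[C]_m) = delta_mx i 0.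
    apply/matrixP => a b; rewrite !mxE andbC; case: (_ && _) => //=.
      exact: conjc1.
    exact: conjc0.
  by rewrite -colE !mxE eqxx mulr1n.
pose q i := Num.sqrt (complex.Re (sp 0 i)).
pose S : 'M[C]_m := diag_mx (\row_i (q i)%:C).
exists (adjmx P *m S); rewrite adjmxM adjmxK mulmxA.
rewrite E; congr (_ *m _); rewrite -mulmxA; congr (_ *m _).
apply/matrixP => i j; rewrite [RHS]mxE (bigD1 i)//= big1 ?addr0; last first.
  by move=> k ki; rewrite !mxE eq_sym (negbTE ki) mulr0n mul0r.
rewrite !mxE eqxx mulr1n; have [->|ij] := eqVneq i j; last first.
  by rewrite !mulr0n; rewrite conjc0 mulr0.
have [r r0 hr] := sp_pos j.
rewrite !mulr1n conjc_real -rmorphM -expr2 /q hr/= sqr_sqrtr//.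
Qed.

Lemma cvg_adjmx (T : Type) (F : set_system T) {FF : ProperFilter F} m
    (u : T -> 'M[C]_m) (A : 'M[C]_m) :
  u @ F --> A -> (forall t, adjmx (u t) = u t) -> adjmx A = A.
Proof.
move=> uA uh; apply/matrixP => j k; rewrite !mxE.
have hj : (fun t => u t k j) @ F --> A k j by exact: cvg_mx_entry.
have hk : (fun t => u t j k) @ F --> A j k by exact: cvg_mx_entry.
have [hr hi] := cvgC_Re hj.
have E t : u t j k = (u t k j)^* by rewrite -{1}uh !mxE.
have hk' : (fun t => u t j k) @ F --> (complex.Re (A k j) +i* (- complex.Im (A k j)) : C).
  apply: cvgC.
  - by under eq_fun do rewrite E conjc_Re.
  - by under eq_fun do rewrite E conjc_Im; apply: cvgN.
by rewrite (cvgC_unique hk hk'); case: (A k j).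
Qed.

(** [B] factors the defect 1 - sum_i X_i X_i^*, which is positive on the ball. It makes y |-> (y X^w
    B)_w an isometry, the Poisson kernel of [X]; [word_sum_le] and [word_sum_ge] give the two
    inequalities. *)
Lemma defect_factor m (X : mtuple R d m) : nc_ball X ->
  exists B : 'M[C]_m, forall y : 'rV[C]_m,
    ((fro (y *m B))%:E + nsum (fun i : L => fro (y *m X i)) = (fro y)%:E)%E.
Proof.
move=> /nc_ball_row_bounded [_ [t /andP[t0 t1] Xt]].
pose G := summability.sum (gram X).
have form y := row_bounded_form y Xt.
have FT : Filter (@totally L) by exact: _.
have Gh : adjmx G = G.
  have PF : ProperFilter (@totally L) by exact: _.
  apply: (@cvg_adjmx _ _ PF _ _ _ (row_bounded_gram Xt)) => F.
  rewrite partial_sumE; elim: (enum_fset F) => [|i s IH].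
    by rewrite big_nil; apply/matrixP => j k; rewrite !mxE; exact: conjc0.
  by rewrite big_cons adjmxD IH /gram adjmxM adjmxK.
have E (y : 'rV[C]_m) : (y *m (1%:M - G) *m adjmx y) 0 0 =
    (fro y - rsum (fun i : L => fro (y *m X i)))%:C.
  have sub00 (A B : 'M[C]_1) : (A - B) 0 0 = A 0 0 - B 0 0 by rewrite !mxE.
  by rewrite mulmxBr mulmx1 mulmxBl sub00 mul_adj_fro (form y).2 rmorphB.
have [|y|B hB] := @psd_factor m (1%:M - G).
- apply/matrixP => j k; have /matrixP /(_ j k) := Gh.
  rewrite !mxE rmorphB /= => ->; rewrite eq_sym; congr (_ - _).
  by case: (_ == _); [exact: conjc1|exact: conjc0].
- exists (fro y - rsum (fun i : L => fro (y *m X i))); last exact: E.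
  rewrite subr_ge0; apply: rsum_le => [i|s us]; first exact: fro_ge0.
  by apply: le_trans (Xt s y us) _; rewrite ler_piMl ?fro_ge0// ltW.
exists B => y.
rewrite (nsum_rsum _ (form y).1); last by move=> i; exact: fro_ge0.
have := E y; rewrite hB mulmxA -mulmxA -adjmxM mul_adj_fro => -[->].
by rewrite -EFinD subrK.
Qed.

(** Iterating the identity [n] times leaves the sum of |y X^w|^2 over words of length [n], which is
    at most t^n |y|^2 and tends to 0. *)
Lemma word_sum_ge m (X : mtuple R d m) (f : 'rV[C]_m -> R) (t : R) (y : 'rV[C]_m) :
  0 <= t < 1 -> row_bounded t X -> (forall y, 0 <= f y) ->
  (forall y, ((f y)%:E + nsum (fun i : L => fro (y *m X i)) = (fro y)%:E)%E) ->
  ((fro y)%:E <= nsum (fun w => f (y *m monomial X w)))%E.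
Proof.
move=> /andP[t0 t1] Xt f0 h.
suff H n : forall y, ((fro y)%:E <=
    nsum (below n (fun w => f (y *m monomial X w))) + (t ^+ n * fro y)%:E)%E.
  apply/lee_addgt0Pr => e e0.
  have : (fun n => t ^+ n * fro y) @ \oo --> (0 : R).
    rewrite -[X in _ --> X](mul0r (fro y)); apply: cvgMr_tmp.
    by apply: cvg_expr; rewrite ger0_norm.
  move=> /cvgr_lt /(_ e e0) [N _ /(_ N (leqnn N)) /= hN].
  apply: le_trans (H N y) _; apply: leeD; last by rewrite lee_fin ltW.
  by apply: le_nsum => w; rewrite /below; case: ifP.
elim: n => [|n IH] {}y; first by rewrite expr0 mul1r nsum_below0 add0e.
rewrite below_recurrence// -[X in (X <= _)%E]h -addeA leeD2l//.
have b0 i w : 0 <= below n (fun w => f (y *m X i *m monomial X w)) w.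
  exact: below_ge0.
have ns : nsummable (fun i : L => fro (y *m X i)).
  by apply: le_lt_trans (nsum_fro_bounded y Xt) _; rewrite ltry.
apply: (@le_trans _ _ (\esum_(i in [set: L])
    (nsum (below n (fun w => f (y *m X i *m monomial X w))) +
     (t ^+ n * fro (y *m X i))%:E)%E)).
  by apply: le_esum => i _; exact: IH.
rewrite esumD; last 2 first.
- by move=> i _; exact: nsum_ge0.
- by move=> i _; rewrite lee_fin mulr_ge0 ?exprn_ge0 ?fro_ge0.
rewrite leeD2l// -/(nsum (fun i => t ^+ n * fro (y *m X i))) nsumZ ?exprn_ge0//; last first.
  by move=> i; exact: fro_ge0.
rewrite exprSr -mulrA EFinM lee_wpmul2l ?lee_fin ?exprn_ge0//.
exact: nsum_fro_bounded.
Qed.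

Lemma kernel_shift m (A : 'M[C]_m) (X : mtuple R d m) v w :
  kernel_fun A X (w ++ v) = kernel_fun (monomial X v *m A) X w.
Proof. by rewrite /kernel_fun monomial_cat mulmxA mxtrace_mulC mulmxA. Qed.

(** The transpose of left multiplication by the series [b], which sends the word v to the sum of b_w
    Z^(wv), has norm at most |K|. It is tested on finitely supported [f] and finitely many output
    coefficients, so that [b] need not be known to be square summable. *)
Definition multiplier_bounded (K : R) (b : W -> C) : Prop :=
  forall (s V : seq W) (f : W -> C), uniq V -> (forall w, w \notin s -> f w = 0) ->
    \sum_(v <- V) nsq (pair b (fun w => f (w ++ v))) <= K ^+ 2 * N2 f.

End VonNeumann.

Lemma cat_injr (T : eqType) (v : seq T) : injective (cat^~ v).
Proof.
move=> x y E; have /addIn sxy : (size x + size v = size y + size v)%N.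
  by rewrite -!size_cat E.
by move/eqP: E; rewrite eqseq_cat// => /andP[/eqP].
Qed.

Section Multipliers.
Context {R : realType} {d : option nat}.
Local Notation C := R[i].
Local Notation L := (letter d).
Local Notation W := (word d).

Lemma multiplier_ell2 (K : R) (b : W -> C) : multiplier_bounded K b -> ell2 b.
Proof.
move=> Kb; apply: (ell2_le (c := K ^+ 2) _).1 => s us.
(* Testing the output at the empty word on the conjugate of [b] cut to [s] gives S^2 <= K^2 S, where
   S is the partial sum of |b|^2. *)
pose f := restrict s (fun w => (b w)^*).
have f0 w : w \notin s -> f w = 0 by rewrite /f /restrict => /negbTE ->.
have := Kb s [:: [::]] f isT f0.
rewrite big_seq1 (pair_restrict (s := s))//; last by move=> w; rewrite cats0; exact: f0.
set S := \sum_(k <- s) nsq (b k).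
have S0 : 0 <= S by apply: sumr_ge0 => w _; exact: nsq_ge0.
have -> : \sum_(k <- s) b k * f (k ++ [::]) = S%:C.
  rewrite rmorph_sum big_seq [RHS]big_seq; apply: eq_bigr => w ws.
  by rewrite cats0 /f /restrict ws mulCJ.
have fS : N2 f <= S.
  apply: (ell2_le _).2 => t ut.
  apply: (@le_trans _ _ (\sum_(w <- [seq w <- t | w \in s]) nsq (b w))).
    rewrite big_filter [leLHS](bigID (mem s))/= [X in _ + X]big1 ?addr0.
      rewrite le_eqVlt; apply/orP; left; apply/eqP; apply: eq_bigr => w ws.
      by rewrite /f /restrict ws nsqJ.
    by move=> w /f0 ->; rewrite nsq0.
  apply: ler_sum_subset => //; first by move=> w; exact: nsq_ge0.
    exact: filter_uniq.
  by move=> w; rewrite mem_filter => /andP[].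
rewrite nsqR => h.
have [->|S1] := eqVneq S 0; first exact: sqr_ge0.
have Sp : 0 < S by rewrite lt_def S1.
rewrite -(ler_pM2r Sp) -expr2; apply: le_trans h _.
by rewrite ler_wpM2l// sqr_ge0.
Qed.

Lemma ell2_shift (v : W) (f : W -> C) : ell2 f ->
  ell2 (fun w => f (w ++ v)) /\ N2 (fun w => f (w ++ v)) <= N2 f.
Proof.
move=> f2; apply: ell2_le => s us.
have -> : \sum_(k <- s) nsq (f (k ++ v)) = \sum_(k <- [seq k ++ v | k <- s]) nsq (f k).
  by rewrite big_map.
apply: N2_ge => //; rewrite map_inj_uniq//; exact: cat_injr.
Qed.

(** Since [V] is finite, each of its coefficients may be estimated separately on a small tail of
    [f]; the finitely supported part carries the constant K^2. *)
Lemma multiplier_extend (K : R) (b : W -> C) (f : W -> C) (V : seq W) :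
  multiplier_bounded K b -> ell2 f -> uniq V ->
  \sum_(v <- V) nsq (pair b (fun w => f (w ++ v))) <= K ^+ 2 * N2 f.
Proof.
move=> Kb f2 uV; have b2 := multiplier_ell2 Kb.
have A0 : 0 <= K ^+ 2 * N2 f by rewrite mulr_ge0 ?sqr_ge0 ?N2_ge0.
have main e : 0 < e -> \sum_(v <- V) nsq (pair b (fun w => f (w ++ v))) <=
    (1 + e) * (K ^+ 2 * N2 f) + e.
  (* [D] is what the tail costs per unit of its squared norm, so a tail of squared norm e / (D + 1)
     costs at most [e]. *)
  move=> e0; pose D := (size V)%:R * (1 + e^-1) * N2 b.
  have ei0 : 0 <= 1 + e^-1 by rewrite addr_ge0// invr_ge0 ltW.
  have D0 : 0 <= D by rewrite !mulr_ge0// N2_ge0.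
  have D1 : 0 < D + 1 by rewrite ltr_wpDl.
  have [s us [g2 gN]] := ell2_tail f2 (divr_gt0 e0 D1).
  have [r2 rN] := ell2_restrict s f2.
  set g := fun k => f k - _ in g2 gN; set r := restrict s f in r2 rN.
  have r0 w : w \notin s -> r w = 0 by rewrite /r /restrict => /negbTE ->.
  have fE v : pair b (fun w => f (w ++ v)) =
      pair b (fun w => r (w ++ v)) + pair b (fun w => g (w ++ v)).
    rewrite -[X in _ + X]mul1r pairC [X in X + _]pairC [X in _ + _ * X]pairC.
    rewrite -pair_linl//; last 2 first.
      exact: (ell2_shift v r2).1.
      exact: (ell2_shift v g2).1.
    by congr pair; apply/funext => w; rewrite mul1r /g addrC subrK.
  apply: (@le_trans _ _ (\sum_(v <- V) ((1 + e) * nsq (pair b (fun w => r (w ++ v)))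
      + (1 + e^-1) * (N2 b * (e / (D + 1)))))).
    apply: ler_sum => v _; rewrite fE; apply: le_trans (nsq_young _ _ e0) _.
    rewrite lerD2l ler_wpM2l//.
    have [gv2 gvN] := ell2_shift v g2.
    apply: le_trans (nsq_pair b2 gv2) _; rewrite ler_wpM2l ?N2_ge0//.
    exact: le_trans gvN gN.
  rewrite big_split/= -mulr_sumr; apply: lerD.
    apply: ler_wpM2l; first by rewrite addr_ge0// ltW.
    apply: le_trans (Kb s V r uV r0) _.
    by rewrite ler_wpM2l// sqr_ge0.
  rewrite big_const_seq count_predT iter_addr_0 -mulr_natl.
  rewrite mulrA [_ * (N2 b * _)]mulrA -/D mulrCA.
  apply: ler_piMr; first exact: ltW.
  by rewrite ler_pdivrMr// mul1r lerDl.
apply/ler_addgt0Pr => e e0.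
have p0 : 0 < K ^+ 2 * N2 f + 1 by rewrite ltr_wpDl.
apply: le_trans (main _ (divr_gt0 e0 p0)) _.
rewrite mulrDl mul1r -addrA lerD2l -[X in _ + X]mulr1 -mulrDr.
by rewrite divfK// gt_eqF.
Qed.

(** Von Neumann's inequality through the Poisson kernel: the transposed multiplier takes the kernel
    of u to that of u b(X), and the kernel preserves norms. *)
Lemma multiplier_opnorm (K : R) (b : W -> C) m (X : mtuple R d m) : 0 <= K ->
  multiplier_bounded K b -> nc_ball X -> opnorm (nc_eval b X) <= K.
Proof.
move=> K0 Kb Xb; have b2 := multiplier_ell2 Kb.
apply: opnorm_le_row => // u; set Q := nc_eval b X.
have [B hB] := defect_factor Xb.
have [_ [t t01 Xt]] := nc_ball_row_bounded Xb.
(* With this matrix the kernel at w is the j-th entry of u X^w B; summed over j the kernels form the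
   Poisson kernel of [u]. *)
pose A j := col j B *m u.
have kE j w : kernel_fun (A j) X w = (u *m monomial X w *m B) 0 j.
  rewrite /kernel_fun /A -mulmxA mxtrace_mulC /mxtrace big_ord1.
  by rewrite colE mulmxA -colE mxE.
have kA j : ell2 (kernel_fun (A j) X) by exact: ell2_kernel.
have kP j v : pair b (fun w => kernel_fun (A j) X (w ++ v)) =
    ((u *m Q) *m monomial X v *m B) 0 j.
  under [X in pair _ X]eq_fun do rewrite kernel_shift.
  rewrite -mxtrace_nc_eval// /A !mulmxA -mulmxA mxtrace_mulC /mxtrace big_ord1.
  by rewrite colE !mulmxA -colE mxE.
rewrite -lee_fin.
apply: (le_trans (word_sum_ge (u *m Q) t01 Xt _ hB)); first by move=> y; exact: fro_ge0.
apply/nsum_leP => [w|V uV]; first exact: fro_ge0.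
apply: (@le_trans _ _ (K ^+ 2 * \sum_j N2 (kernel_fun (A j) X))).
  under eq_bigr do rewrite fro_rV.
  rewrite exchange_big mulr_sumr/=; apply: ler_sum => j _.
  under eq_bigr do rewrite -kP.
  exact: multiplier_extend.
rewrite ler_wpM2l ?sqr_ge0//.
rewrite -lee_fin -sumEFin.
have -> : (\sum_j (N2 (kernel_fun (A j) X))%:E)%E =
    nsum (fun w => fro (u *m monomial X w *m B)).
  have -> : (\sum_j (N2 (kernel_fun (A j) X))%:E)%E =
      (\sum_j \esum_(w in [set: W]) (nsq ((u *m monomial X w *m B) 0 j))%:E)%E.
    apply: eq_bigr => j _; rewrite -normsq_N2// normsqE; apply: eq_esum => w _.
    by rewrite kE.
  rewrite -esum_sum; last by move=> w j _ _; rewrite lee_fin nsq_ge0.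
  by apply: eq_esum => w _; rewrite fro_rV sumEFin.
apply: (@word_sum_le _ _ _ X (fun y => fro (y *m B)) (@fro _ _ _)).
- by move=> y; exact: fro_ge0.
- by move=> y; exact: fro_ge0.
- by move=> y; rewrite hB.
Qed.

Lemma monomial_dsum m n (X : mtuple R d m) (Y : mtuple R d n) w :
  monomial (dsum X Y) w = block_mx (monomial X w) 0 0 (monomial Y w).
Proof.
elim: w => [|i w IH]; first by rewrite !monomial_nil scalar_mx_block.
rewrite !monomial_cons IH /dsum mulmx_block !mulmx0 !mul0mx.
by rewrite !addr0 !add0r.
Qed.

Lemma monomial_simil m (P : 'M[C]_m) (X : mtuple R d m) w : P \in unitmx ->
  monomial (simil P X) w = invmx P *m monomial X w *m P.
Proof.
move=> Pu; elim: w => [|i w IH].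
  by rewrite !monomial_nil mulmx1 mulVmx.
rewrite !monomial_cons IH /simil !mulmxA; congr (_ *m _); congr (_ *m _).
by rewrite -!mulmxA mulmxV// mulmx1.
Qed.

Lemma nc_ball_dsum m n (X : mtuple R d m) (Y : mtuple R d n) :
  nc_ball X -> nc_ball Y -> nc_ball (dsum X Y).
Proof.
move=> /nc_ball_row_bounded [m0 [t /andP[t0 t1] Xt]].
move=> /nc_ball_row_bounded [n0 [r /andP[r0 r1] Yr]].
apply: (@row_bounded_nc_ball _ _ _ _ (Num.max t r)).
- by rewrite addn_gt0 m0.
- by rewrite le_max t0 /= gt_max t1.
move=> s y us; rewrite -[y]hsubmxK fro_row_mx.
under eq_bigr do rewrite /dsum mul_row_block !mulmx0 addr0 add0r fro_row_mx.
rewrite big_split/= mulrDr; apply: lerD.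
- by apply: le_trans (Xt s _ us) _; rewrite ler_wpM2r ?fro_ge0// le_max lexx.
- by apply: le_trans (Yr s _ us) _; rewrite ler_wpM2r ?fro_ge0// le_max lexx orbT.
Qed.

Lemma cvg_mx_unique (T : Type) (F : set_system T) {FF : ProperFilter F} m n
    (u : T -> 'M[C]_(m, n)) (A B : 'M[C]_(m, n)) :
  u @ F --> A -> u @ F --> B -> A = B.
Proof.
move=> uA uB; apply/matrixP => j k.
have h : (fun t => u t j k) @ F --> A j k by exact: cvg_mx_entry.
have h' : (fun t => u t j k) @ F --> B j k by exact: cvg_mx_entry.
exact: cvgC_unique h h'.
Qed.

Lemma cvg_block_diag (T : Type) (F : set_system T) {FF : ProperFilter F} m n
    (u : T -> 'M[C]_m) (v : T -> 'M[C]_n) (A : 'M[C]_m) (B : 'M[C]_n) :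
  u @ F --> A -> v @ F --> B ->
  (fun t => block_mx (u t) 0 0 (v t)) @ F --> block_mx A 0 0 B.
Proof.
move=> uA vB; apply: cvg_mx => i j.
have [i' ->|i' ->] := split_ordP i; have [j' ->|j' ->] := split_ordP j.
- by under eq_fun do rewrite block_mxEul; rewrite block_mxEul; exact: cvg_mx_entry.
- by under eq_fun do rewrite block_mxEur mxE; rewrite block_mxEur mxE; exact: cvg_cst.
- by under eq_fun do rewrite block_mxEdl mxE; rewrite block_mxEdl mxE; exact: cvg_cst.
- by under eq_fun do rewrite block_mxEdr; rewrite block_mxEdr; exact: cvg_mx_entry.
Qed.

Lemma nc_eval_unique (b : W -> C) m (X : mtuple R d m) (A : 'M[C]_m) :
  ell2 b -> nc_ball X ->
  partial_sum (fun w => b w *: monomial X w) @ totally --> A -> nc_eval b X = A.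
Proof.
by move=> b2 Xb; apply: cvg_mx_unique; exact: nc_eval_cvg.
Qed.

Lemma nc_function_nc_eval (b : W -> C) : ell2 b -> nc_function (@nc_eval R d b).
Proof.
move=> b2; split=> [m n X Y Xb Yb|m P X Xb Pu Pb].
  apply: nc_eval_unique => //; first exact: nc_ball_dsum.
  rewrite (_ : partial_sum _ = fun F =>
      block_mx (partial_sum (fun w => b w *: monomial X w) F) 0 0
               (partial_sum (fun w => b w *: monomial Y w) F)).
    by apply: cvg_block_diag; exact: nc_eval_cvg.
  apply/funext => F; rewrite !partial_sumE; elim: (enum_fset F) => [|w s IH].
    by rewrite !big_nil block_mx0.
  rewrite !big_cons IH monomial_dsum scale_block_mx !scaler0 add_block_mx.
  by rewrite !addr0.
apply: nc_eval_unique => //.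
rewrite (_ : partial_sum _ = fun F =>
    invmx P *m partial_sum (fun w => b w *: monomial X w) F *m P).
  by apply: cvg_mulmx; exact: nc_eval_cvg.
apply/funext => F; rewrite !partial_sumE mulmx_sumr mulmx_suml.
by apply: eq_bigr => w _; rewrite monomial_simil// -scalemxAr -scalemxAl.
Qed.

Lemma nc_open_space : nc_open (@nc_space R d).
Proof. by move=> m; split=> // X _; exists 1 => // Y. Qed.

Lemma multiplier_hinf (K : R) (b : W -> C) : 0 <= K ->
  multiplier_bounded K b -> hinf (@nc_eval R d b).
Proof.
move=> K0 Kb; split; last first.
  apply: (@le_lt_trans _ _ K%:E); last by rewrite ltry.
  apply: ge_ereal_sup => _ [m [X [Xb ->]]]; rewrite lee_fin.
  exact: multiplier_opnorm.
split; first by apply: nc_function_nc_eval; exact: multiplier_ell2 Kb.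
move=> m X Xb; exists (@nc_space R d); split.
- exact: nc_open_space.
- by case: Xb.
- by exists K => k Y Yb _; exact: multiplier_opnorm.
Qed.

End Multipliers.

(** * Contractivity of bounded NC functions on kernels *)

Section Contraction.
Context {R : realType} {d : option nat}.
Local Notation C := R[i].
Local Notation L := (letter d).
Local Notation W := (word d).

Section Compression.
Context {s : seq W} (us : uniq s).
Local Notation n := (size s).
Local Notation nw := (nth [::] s).

Definition extend (y : 'rV[C]_n) (w : W) : C := \sum_(j < n) y 0 j * (nw j == w)%:R.

Lemma extend_nth (y : 'rV[C]_n) (j : 'I_n) : extend y (nw j) = y 0 j.
Proof.
rewrite /extend (bigD1 j)//= eqxx mulr1 big1 ?addr0// => k kj.
by rewrite nth_uniq// (inj_eq val_inj) (negbTE kj) mulr0.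
Qed.

Lemma extend_notin (y : 'rV[C]_n) w : w \notin s -> extend y w = 0.
Proof.
move=> ws; rewrite /extend big1// => j _.
case: eqP => [e|_]; last by rewrite mulr0.
by move: ws; rewrite -e mem_nth.
Qed.

Lemma extend_row (q : W -> C) w :
  extend (\row_j q (nw j)) w = if w \in s then q w else 0.
Proof.
case: ifPn => [ws|/extend_notin//].
have iw : (index w s < n)%N by rewrite index_mem.
have := extend_nth (\row_j q (nw j)) (Ordinal iw).
by rewrite mxE /= nth_index.
Qed.

Lemma fro_row_seq (q : W -> C) :
  fro (\row_(j < n) q (nw j)) = \sum_(w <- s) nsq (q w).
Proof.
rewrite fro_rV (big_nth [::]) big_mkord.
by apply: eq_bigr => j _; rewrite mxE.
Qed.

Lemma extend_sum (y : 'rV[C]_n) (t : seq W) : uniq t ->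
  \sum_(w <- t) nsq (extend y w) <= fro y.
Proof.
move=> ut.
have -> : fro y = \sum_(w <- s) nsq (extend y w).
  by rewrite -fro_row_seq; congr fro; apply/rowP => j; rewrite mxE extend_nth.
apply: (@le_trans _ _ (\sum_(w <- [seq w <- t | w \in s]) nsq (extend y w))).
  rewrite big_filter [leLHS](bigID (mem s))/= [X in _ + X]big1 ?addr0//.
  by move=> w ws; rewrite extend_notin// nsq0.
apply: ler_sum_subset => //; first by move=> w; exact: nsq_ge0.
  exact: filter_uniq.
by move=> w; rewrite mem_filter => /andP[].
Qed.

(* The compression of [r] times the left creation operators to the span of the
   words of [s]. *)
Definition creation (r : R) : mtuple R d n :=
  fun i => \matrix_(j, k) (r%:C * (nw j == i :: nw k)%:R).

Lemma mul_creation (r : R) (y : 'rV[C]_n) i k :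
  (y *m creation r i) 0 k = r%:C * extend y (i :: nw k).
Proof.
rewrite mxE /extend mulr_sumr; apply: eq_bigr => j _.
by rewrite mxE mulrCA.
Qed.

Definition cons_words (l : seq L) : seq W := [seq i :: w | i <- l, w <- s].

Lemma cons_words_uniq l : uniq l -> uniq (cons_words l).
Proof. by move=> ul; apply: allpairs_uniq => // -[i v] [j w] _ _ /= [-> ->]. Qed.

Lemma sum_cons_words (l : seq L) (q : W -> R) :
  \sum_(i <- l) \sum_(k < n) q (i :: nw k) = \sum_(w <- cons_words l) q w.
Proof.
rewrite /cons_words big_allpairs_dep/=; apply: eq_bigr => i _.
by rewrite (big_nth [::]) big_mkord.
Qed.

Lemma creation_bounded (r : R) : row_bounded (r ^+ 2) (creation r).
Proof.
move=> l y ul.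
have -> : \sum_(i <- l) fro (y *m creation r i) =
    r ^+ 2 * \sum_(w <- cons_words l) nsq (extend y w).
  rewrite -sum_cons_words mulr_sumr; apply: eq_bigr => i _.
  rewrite fro_rV mulr_sumr; apply: eq_bigr => k _.
  by rewrite mul_creation nsqM nsqR.
by rewrite ler_wpM2l ?sqr_ge0// extend_sum// cons_words_uniq.
Qed.

Definition orbit_mx m (Z : mtuple R d m) (x : 'cV[C]_m) : 'M[C]_(m, n) :=
  \matrix_(a, k) (monomial Z (nw k) *m x) a 0.

Lemma mul_orbit m (Z : mtuple R d m) (x : 'cV[C]_m) (y : 'rV[C]_m) :
  y *m orbit_mx Z x = \row_k (y *m monomial Z (nw k) *m x) 0 0.
Proof.
apply/rowP => k; rewrite [RHS]mxE -mulmxA [LHS]mxE [RHS]mxE.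
by apply: eq_bigr => a _; rewrite mxE.
Qed.

(** Column k of the commutator is Z^(i w_k) x, reduced to its (1 - r)-fold when the word i w_k is in
    [s], where the creation operator acts. The errors are thus a factor (1 - r)^2 on the words of
    [s] and a tail [e] outside. *)
Lemma creation_almost_intertwines m (Z : mtuple R d m) (x : 'cV[C]_m) (r G e : R)
    (l : seq L) (y : 'rV[C]_m) : uniq l ->
  (forall t : seq W, uniq t -> \sum_(w <- t) fro (monomial Z w) <= G) ->
  (forall t : seq W, uniq t -> {in t, forall w, w \notin s} ->
     \sum_(w <- t) fro (monomial Z w) <= e) ->
  \sum_(i <- l) fro (y *m (Z i *m orbit_mx Z x - orbit_mx Z x *m creation r i)) <=
  ((1 - r) ^+ 2 * G + e) * fro x * fro y.
Proof.
move=> ul ZG Ze.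
have mxBE (A B : 'rV[C]_n) k : (A - B) 0 k = A 0 k - B 0 k by rewrite !mxE.
pose q w := (y *m monomial Z w *m x) 0 0.
have qle w : nsq (q w) <= fro (monomial Z w) * (fro x * fro y).
  rewrite -fro_11 -mulmxA; apply: le_trans (fro_mul _ _) _.
  rewrite mulrC mulrA ler_wpM2r ?fro_ge0//.
  exact: fro_mul.
(* A common majorant for both kinds of words; outside [s] the weight is at least 1. *)
pose p w := nsq (q w) * ((1 - r) ^+ 2 + (w \notin s)%:R).
apply: (@le_trans _ _ (\sum_(w <- cons_words l) p w)).
  rewrite -sum_cons_words; apply: ler_sum => i _.
  rewrite fro_rV; apply: ler_sum => k _.
  rewrite mulmxBr !mulmxA [y *m orbit_mx _ _]mul_orbit mxBE.
  have -> : (y *m Z i *m orbit_mx Z x) 0 k = q (i :: nw k).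
    by rewrite mul_orbit mxE /q monomial_cons !mulmxA.
  rewrite mul_creation (extend_row q) /p.
  case: ifPn => ws /=; last by rewrite mulr0 subr0 ler_peMr ?nsq_ge0// lerDr sqr_ge0.
  rewrite addr0 -mulN1r mulrA -{1}[q _]mul1r -mulrDl nsqM mulrC.
  rewrite mulN1r -[1]/(1%:C) -rmorphB nsqR lexx //.
apply: (@le_trans _ _ ((1 - r) ^+ 2 * (\sum_(w <- cons_words l) nsq (q w)) +
    \sum_(w <- cons_words l | w \notin s) nsq (q w))).
  rewrite mulr_sumr [X in _ <= _ + X]big_mkcond/= -big_split/=.
  apply: ler_sum => w _; rewrite /p mulrDr mulrC lerD2l.
  by case: ifP => _; rewrite ?mulr1 ?mulr0.
have xy0 : 0 <= fro x * fro y by rewrite mulr_ge0 ?fro_ge0.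
rewrite -mulrA mulrDl -mulrA; apply: lerD.
  rewrite ler_wpM2l ?sqr_ge0//.
  apply: (@le_trans _ _ ((\sum_(w <- cons_words l) fro (monomial Z w)) * (fro x * fro y))).
    by rewrite mulr_suml; apply: ler_sum.
  by rewrite ler_wpM2r// ZG// cons_words_uniq.
apply: (@le_trans _ _ ((\sum_(w <- cons_words l | w \notin s) fro (monomial Z w))
    * (fro x * fro y))).
  by rewrite mulr_suml; apply: ler_sum.
rewrite ler_wpM2r// -big_filter Ze//; first by rewrite filter_uniq// cons_words_uniq.
by move=> w; rewrite mem_filter => /andP[].
Qed.

End Compression.

(** The block matrix is the conjugate of Z (+) X by the unipotent matrix with corner [J]. Since [f]
    respects sums and similarities, its value there has corner f(Z) J - J f(X), and a corner is
    bounded by the whole. *)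
Lemma nc_function_intertwine (f : graded_fun R d) (M : R) m n
    (Z : mtuple R d m) (X : mtuple R d n) (J : 'M[C]_(m, n)) :
  nc_function f -> (forall k (Y : mtuple R d k), nc_ball Y -> opnorm (f k Y) <= M) ->
  nc_ball Z -> nc_ball X ->
  nc_ball (fun i => block_mx (Z i) (Z i *m J - J *m X i) 0 (X i)) ->
  forall y : 'rV[C]_m, fro (y *m (f m Z *m J - J *m f n X)) <= M ^+ 2 * fro y.
Proof.
move=> [fD fP] fM Zb Xb.
pose P : 'M[C]_(m + n) := block_mx 1%:M J 0 1%:M.
pose Q : 'M[C]_(m + n) := block_mx 1%:M (- J) 0 1%:M.
have QP : Q *m P = 1%:M.
  rewrite /P /Q mulmx_block !mul1mx !mulmx0 !mul0mx mulmx1 !addr0 add0r.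
  by rewrite subrr -scalar_mx_block.
have [_ Pu] := mulmx1_unit QP.
have iP : invmx P = Q by rewrite -[Q]mulmx1 -(mulmxV Pu) mulmxA QP mul1mx.
have conj (A : 'M[C]_m) (B : 'M[C]_n) :
    Q *m block_mx A 0 0 B *m P = block_mx A (A *m J - J *m B) 0 B.
  rewrite /P /Q !mulmx_block !mul1mx !mulmx0 !mul0mx !mulmx1 !addr0 !add0r.
  by rewrite mulNmx mul0mx add0r.
have -> : (fun i => block_mx (Z i) (Z i *m J - J *m X i) 0 (X i)) = simil P (dsum Z X).
  by apply/funext => i; rewrite /simil iP /dsum conj.
move=> Bb y.
have := fP _ P _ (nc_ball_dsum Zb Xb) Pu Bb; rewrite fD// iP conj => fB.
have := opnorm_mulr (row_mx y 0) (fM _ _ Bb).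
rewrite fB mul_row_block !mul0mx !addr0 !fro_row_mx fro0 addr0.
by apply: le_trans; rewrite lerDr fro_ge0.
Qed.

(** The factor [c] is arbitrarily large: a commutator small enough keeps the block point in the ball
    even after multiplication by [c], and dividing by [c] afterwards makes f(Z) J - J f(X) small.
    One compression serves all basis vectors. *)
Lemma compression_exists m (Z : mtuple R d m) (c : R) (F0 : seq W) :
  nc_ball Z -> 0 < c ->
  exists s : seq W, [/\ uniq s, {subset F0 <= s} & exists2 X : mtuple R d (size s),
    nc_ball X & forall l : 'I_m, let J := c%:C *: (@orbit_mx s _ Z (delta_mx l 0)) in
      nc_ball (fun i => block_mx (Z i) (Z i *m J - J *m X i) 0 (X i))].
Proof.
move=> Zb c0; have [m0 [t /andP[t0 t1] Zt]] := nc_ball_row_bounded Zb.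
have Zs := fro_monomial_summable Zb.
have f0 w : 0 <= fro (monomial Z w) by exact: fro_ge0.
pose G := rsum (fun w => fro (monomial Z w)).
have G0 : 0 <= G by exact: rsum_ge0.
(* [e] is used as the gap 1 - r of the creation operators, as the square root of the tail, and as
   the weight in Young's inequality. Its value ensures e <= 1/2 and 2 e c^2 (G + 1) < 1 - t. *)
pose e := (1 - t) / (4 * c ^+ 2 * (G + 1) + 2).
have cG : 0 <= c ^+ 2 * (G + 1).
  by apply: mulr_ge0; [exact: sqr_ge0|rewrite addr_ge0].
have den : 0 < 4 * c ^+ 2 * (G + 1) + 2.
  by rewrite -(mulrA 4); move: (c ^+ 2 * _) cG => a; lra.
have t1' : 0 < 1 - t by rewrite subr_gt0.
have e0 : 0 < e by rewrite divr_gt0.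
have e2 : e <= 1 / 2.
  rewrite ler_pdivrMr//.
  by rewrite -(mulrA 4); move: (c ^+ 2 * _) cG => a; lra.
have e3 : 2 * e * c ^+ 2 * (G + 1) < 1 - t.
  have -> : 2 * e * c ^+ 2 * (G + 1) = (2 * c ^+ 2 * (G + 1)) * e by ring.
  rewrite /e mulrA ltr_pdivrMr// mulrC ltr_pM2l//.
  by rewrite -!mulrA; move: (c ^+ 2 * _) cG => a; lra.
have [s0 _ hs0] := nsummable_tail f0 Zs (exprn_gt0 2 e0).
(* The empty word is included so that the compression has positive size, as membership in the ball
   demands. *)
pose s := undup ([::] :: F0 ++ s0).
have us : uniq s by exact: undup_uniq.
exists s; split=> //.
  by move=> w ws; rewrite mem_undup inE mem_cat ws orbT.
have s_pos : (0 < size s)%N.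
  by rewrite -has_predT; apply/hasP; exists [::] => //; rewrite mem_undup inE eqxx.
have r1 : (1 - e) ^+ 2 < 1 by nra.
exists (@creation s (1 - e)).
  apply: (row_bounded_nc_ball s_pos _ (creation_bounded us _)).
  by rewrite sqr_ge0.
move=> l J.
pose D := e ^+ 2 * G + e ^+ 2.
have D0 : 0 <= D by apply: addr_ge0; [apply: mulr_ge0 => //|]; exact: sqr_ge0.
have JD (y : 'rV[C]_m) (L0 : seq L) : uniq L0 ->
    \sum_(i <- L0) fro (y *m (Z i *m J - J *m (@creation s (1 - e) i))) <= c ^+ 2 * (D * fro y).
  move=> uL.
  have -> : \sum_(i <- L0) fro (y *m (Z i *m J - J *m (@creation s (1 - e) i))) =
    c ^+ 2 * \sum_(i <- L0) fro (y *m (Z i *m (@orbit_mx s _ Z (delta_mx l 0)) -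
      (@orbit_mx s _ Z (delta_mx l 0)) *m (@creation s (1 - e) i))).
    rewrite mulr_sumr; apply: eq_bigr => i _.
    by rewrite /J -scalemxAr -scalemxAl -scalerBr -scalemxAr froZ nsqR.
  rewrite ler_wpM2l ?sqr_ge0//.
  have x1 : fro (delta_mx l 0 : 'cV[C]_m) = 1.
    rewrite fro_cV (bigD1 l)//= big1 ?addr0 ?mxE ?eqxx//=; first by rewrite -[1]/(1%:C) nsqR expr1n.
    by move=> k kl; rewrite mxE (negbTE kl) nsq0.
  have := @creation_almost_intertwines s us m Z (delta_mx l 0) (1 - e) G (e ^+ 2) L0 y uL.
  rewrite x1 mulr1 (_ : (1 - (1 - e)) = e); last by ring.
  apply=> [u uu|u uu hu]; first exact: rsum_ge.
  apply: hs0 => // w /hu; apply: contra => ws.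
  by rewrite mem_undup inE mem_cat ws !orbT.
(* The coefficients of |y1|^2 and |y2|^2 after Young's inequality. The second equals (1 - e^2)(1 -
   e); the first is t + (1 + e) e c^2 (G + 1). Both are below 1. *)
pose T := Num.max (t + (1 + e^-1) * (c ^+ 2 * D)) ((1 + e) * (1 - e) ^+ 2).
have eD : (1 + e^-1) * (c ^+ 2 * D) <= 2 * e * c ^+ 2 * (G + 1).
  have -> : (1 + e^-1) * (c ^+ 2 * D) = (1 + e) * (e * c ^+ 2 * (G + 1)).
    by rewrite /D; field; rewrite gt_eqF.
  have -> : 2 * e * c ^+ 2 * (G + 1) = 2 * (e * c ^+ 2 * (G + 1)) by ring.
  apply: ler_wpM2r; last by lra.
  by rewrite -mulrA; apply: mulr_ge0 => //; exact: ltW.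
apply: (@row_bounded_nc_ball _ _ _ _ T).
- by rewrite addn_gt0 m0.
- rewrite le_max gt_max; apply/and3P; split.
  + apply/orP; left; apply: addr_ge0 => //; apply: mulr_ge0.
      by rewrite addr_ge0// invr_ge0 ltW.
    by rewrite mulr_ge0// sqr_ge0.
  + by move: e3 eD; lra.
  + by nra.
move=> L0 y uL; rewrite -[y]hsubmxK fro_row_mx.
set y1 := lsubmx y; set y2 := rsubmx y.
under eq_bigr do rewrite mul_row_block mulmx0 addr0 fro_row_mx [y1 *m _ + _]addrC.
apply: (@le_trans _ _ (\sum_(i <- L0) (fro (y1 *m Z i) +
   ((1 + e) * fro (y2 *m (@creation s (1 - e) i)) +
    (1 + e^-1) * fro (y1 *m (Z i *m J - J *m (@creation s (1 - e) i))))))).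
  by apply: ler_sum => i _; rewrite lerD2l; exact: fro_young.
rewrite !big_split/= -!mulr_sumr mulrDr.
have T1 : t + (1 + e^-1) * (c ^+ 2 * D) <= T by rewrite le_max lexx.
have T2 : (1 + e) * (1 - e) ^+ 2 <= T by rewrite le_max lexx orbT.
have ei0 : 0 <= 1 + e^-1 by rewrite addr_ge0// invr_ge0 ltW.
have h1 := Zt L0 y1 uL.
have h2 : (1 + e) * (\sum_(i <- L0) fro (y2 *m @creation s (1 - e) i)) <=
    (1 + e) * ((1 - e) ^+ 2 * fro y2).
  by apply: ler_wpM2l; [rewrite addr_ge0// ltW|exact: creation_bounded].
have h3 : (1 + e^-1) * (\sum_(i <- L0) fro (y1 *m (Z i *m J - J *m @creation s (1 - e) i))) <=
    (1 + e^-1) * (c ^+ 2 * (D * fro y1)).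
  by apply: ler_wpM2l => //; exact: JD.
have h4 : (t + (1 + e^-1) * (c ^+ 2 * D)) * fro y1 <= T * fro y1.
  by apply: ler_wpM2r => //; exact: fro_ge0.
have h5 : (1 + e) * (1 - e) ^+ 2 * fro y2 <= T * fro y2.
  by apply: ler_wpM2r => //; exact: fro_ge0.
apply: le_trans (lerD h1 (lerD h2 h3)) _.
apply: le_trans (lerD h4 h5).
by rewrite le_eqVlt; apply/orP; left; apply/eqP; ring.
Qed.

(* Intertwining [Z] approximately with a compression [X] of the creation
   operators turns [A *m f Z] into the action of the contraction [f X / M]. *)
Theorem kernel_contraction (f : graded_fun R d) (M : R) m (Z : mtuple R d m)
    (A : 'M[C]_m) :
  nc_function f -> (forall k (Y : mtuple R d k), nc_ball Y -> opnorm (f k Y) <= M) ->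
  nc_ball Z ->
  N2 (kernel_fun (A *m f m Z) Z) <= M ^+ 2 * N2 (kernel_fun A Z).
Proof.
move=> fN fM Zb; have kA := ell2_kernel A Zb.
have N0 := N2_ge0 (kernel_fun A Z).
apply: (ell2_le _).2 => F0 uF0.
have main (e : R) : 0 < e -> \sum_(w <- F0) nsq (kernel_fun (A *m f m Z) Z w) <=
    (1 + e) * (M ^+ 2 * N2 (kernel_fun A Z)) + e.
  move=> e0; pose K := (1 + e^-1) * (m%:R * (M ^+ 2 * fro A)).
  have ei0 : 0 <= 1 + e^-1 by rewrite addr_ge0// invr_ge0 ltW.
  have K0 : 0 <= K.
    do 2 (apply: mulr_ge0 => //); apply: mulr_ge0; [exact: sqr_ge0|exact: fro_ge0].
  (* Chosen so that K <= e c^2: the intertwining error, at most K / c^2, is then below [e]. *)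
  pose c := 1 + K / e.
  have c1 : 1 <= c by rewrite lerDl divr_ge0// ltW.
  have c0 : 0 < c by exact: lt_le_trans c1.
  have [s [us F0s [X Xb XJ]]] := compression_exists F0 Zb c0.
  pose kr B : 'rV[C]_(size s) := \row_j kernel_fun B Z (nth [::] s j).
  (* A trace is a sum over rows, so the restricted kernel is the sum of the rows of [B] times the
     orbit matrices of the basis vectors; an intertwining with [f] can be applied to each. *)
  have krE B : kr B = \sum_l row l B *m @orbit_mx s m Z (delta_mx l 0).
    apply/rowP => j; rewrite mxE summxE /kernel_fun /mxtrace; apply: eq_bigr => l _.
    by rewrite mul_orbit [RHS]mxE -colE [RHS]mxE -row_mul [RHS]mxE.
  have krD : kr (A *m f m Z) = kr A *m f _ X + \sum_l row l A *m
      (f m Z *m @orbit_mx s m Z (delta_mx l 0) - @orbit_mx s m Z (delta_mx l 0) *m f _ X).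
    rewrite !krE mulmx_suml -big_split/=; apply: eq_bigr => l _.
    by rewrite mulmxBr !mulmxA addrC subrK row_mul.
  have krX : fro (kr A *m f _ X) <= M ^+ 2 * N2 (kernel_fun A Z).
    apply: le_trans (opnorm_mulr _ (fM _ _ Xb)) _.
    rewrite ler_wpM2l ?sqr_ge0// fro_row_seq.
    exact: N2_ge.
  have krL (l : 'I_m) (y : 'rV[C]_m) : c ^+ 2 * fro (y *m (f m Z *m @orbit_mx s m Z (delta_mx l 0) -
      @orbit_mx s m Z (delta_mx l 0) *m f _ X)) <= M ^+ 2 * fro y.
    have := nc_function_intertwine fN fM Zb Xb (XJ l) y.
    rewrite -scalemxAr -scalemxAl -scalerBr -scalemxAr froZ nsqR//.
  apply: (@le_trans _ _ (fro (kr (A *m f m Z)))).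
    rewrite /kr fro_row_seq; apply: ler_sum_subset => // w; exact: nsq_ge0.
  rewrite krD; apply: le_trans (fro_young _ _ e0) _; apply: lerD.
    by apply: ler_wpM2l => //; rewrite addr_ge0// ltW.
  have sumle : c ^+ 2 * fro (\sum_l row l A *m
      (f m Z *m @orbit_mx s m Z (delta_mx l 0) - @orbit_mx s m Z (delta_mx l 0) *m f _ X)) <=
      m%:R * (M ^+ 2 * fro A).
    apply: (@le_trans _ _ (m%:R * \sum_l c ^+ 2 * fro (row l A *m
      (f m Z *m @orbit_mx s m Z (delta_mx l 0) - @orbit_mx s m Z (delta_mx l 0) *m f _ X)))).
      rewrite -mulr_sumr mulrCA ler_wpM2l ?sqr_ge0//.
      apply: le_trans (fro_sum_le _ _) _.
      by rewrite /index_enum -enumT size_enum_ord.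
    rewrite ler_wpM2l// fro_rows mulr_sumr; apply: ler_sum => l _; exact: krL.
  have ce : K / e <= c ^+ 2 by rewrite /c; move: (K / e) c1 => a; rewrite /c lerDl => a0; nra.
  have cp : 0 < c ^+ 2 by rewrite exprn_gt0.
  rewrite -(ler_pM2l cp) mulrCA.
  apply: le_trans (ler_wpM2l ei0 sumle) _; rewrite -/K.
  by rewrite -ler_pdivrMr.
apply/ler_addgt0Pr => e e0.
set B := M ^+ 2 * _ in main *.
have B0 : 0 <= B by rewrite mulr_ge0 ?sqr_ge0.
have p0 : 0 < B + 1 by rewrite ltr_wpDl.
apply: le_trans (main _ (divr_gt0 e0 p0)) _.
rewrite mulrDl mul1r -addrA lerD2l -[X in _ + X]mulr1 -mulrDr.
by rewrite divfK// gt_eqF.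
Qed.


End Contraction.

(** * Unconditional bounds and Riesz systems *)

Section Signs.
Context {R : realType} {I : choiceType}.
Local Notation C := R[i].
Implicit Types (H : nat -> set (I -> C)) (e : nat -> bool) (y : nat -> I -> C).

Definition sgn (b : bool) : C := (-1) ^+ b.

Lemma nsq_sgn b : nsq (sgn b : C) = 1.
Proof. by rewrite /sgn; case: b; rewrite ?expr0 ?expr1 ?nsqN -[1]/(1%:C) nsqR expr1n. Qed.

Lemma sgn_addb b c : sgn (b (+) c) = sgn b * sgn c.
Proof. by rewrite /sgn signr_addb. Qed.

Lemma N2_parallelogram (a b : I -> C) : ell2 a -> ell2 b ->
  N2 (fun k => a k + b k) + N2 (fun k => a k + (-1) * b k) = 2 * N2 a + 2 * N2 b.
Proof.
move=> a2 b2; have := N2_lin (-1) a2 b2.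
have -> : (-1)%:C = -1 :> C by rewrite rmorphN rmorph1.
by move=> ->; ring.
Qed.

Definition sign_sum e y N : I -> C := fun k => \sum_(n < N) sgn (e n) * y n k.

Lemma ell2_sign_sum e y N : (forall n, ell2 (y n)) -> ell2 (sign_sum e y N).
Proof. by move=> y2; apply: ell2_sum => n _; exact: (ell2Z _ (y2 n)).1. Qed.

Lemma sign_sum_eq e e' y N : (forall n, (n < N)%N -> e n = e' n) ->
  sign_sum e y N = sign_sum e' y N.
Proof. by move=> ee; apply/funext => k; apply: eq_bigr => n _; rewrite ee. Qed.

(** The averaging over signs, made one sign at a time: by the parallelogram law, one choice of the
    next sign is at most the mean and the other at least the mean. *)
Lemma sign_sum_extreme y N : (forall n, ell2 (y n)) ->
  (exists e, N2 (sign_sum e y N) <= \sum_(n < N) N2 (y n)) /\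
  (exists e, \sum_(n < N) N2 (y n) <= N2 (sign_sum e y N)).
Proof.
move=> y2; elim: N => [|N [[e he] [f hf]]].
  have E e : N2 (sign_sum e y 0) = 0.
    rewrite (_ : sign_sum e y 0 = 0) ?(ell20).2//.
    by apply/funext => k; rewrite /sign_sum big_ord0.
  by split; exists (fun=> false); rewrite E big_ord0.
pose ext (g : nat -> bool) b n := if n == N then b else g n.
have extE g b : sign_sum (ext g b) y N.+1 = (fun k => sign_sum g y N k + sgn b * y N k).
  apply/funext => k; rewrite /sign_sum big_ord_recr/= /ext eqxx; congr (_ + _).
  by apply: eq_bigr => n _; rewrite ltn_eqF.
have par g : N2 (sign_sum (ext g false) y N.+1) + N2 (sign_sum (ext g true) y N.+1) =
    2 * N2 (sign_sum g y N) + 2 * N2 (y N).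
  rewrite !extE -N2_parallelogram//; last exact: ell2_sign_sum.
  rewrite /sgn expr0 expr1; congr (N2 _ + _).
  by apply/funext => k; rewrite mul1r.
split.
- have := par e; set p := N2 _; set q := N2 (sign_sum (ext e true) _ _) => pq.
  case: (leP p q) => h; [exists (ext e false)|exists (ext e true)];
    by rewrite big_ord_recr/=; move: he pq h; rewrite /p /q; lra.
- have := par f; set p := N2 _; set q := N2 (sign_sum (ext f true) _ _) => pq.
  case: (leP p q) => h; [exists (ext f true)|exists (ext f false)];
    by rewrite big_ord_recr/=; move: hf pq h; rewrite /p /q; lra.
Qed.

Section UniformBound.
Context {H : nat -> set (I -> C)}.
Context (H_ell2 : forall n h, H n h -> ell2 h).
Context (H_scale : forall n c h, H n h -> H n (fun k => c * h k)).

Definition sign_bounded e (K : R) : Prop :=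
  forall y N, (forall n, H n (y n)) ->
    N2 (sign_sum e y N) <= K * N2 (sign_sum (fun=> false) y N).

Lemma sign_bounded_le e K K' : K <= K' -> sign_bounded e K -> sign_bounded e K'.
Proof.
move=> KK h y N yH; apply: le_trans (h y N yH) _.
by rewrite ler_wpM2r// N2_ge0.
Qed.

Lemma sign_bounded_addb e e' K K' : 0 <= K ->
  sign_bounded e K -> sign_bounded e' K' ->
  sign_bounded (fun n => e n (+) e' n) (K * K').
Proof.
move=> K0 h h' y N yH.
pose z n k := sgn (e' n) * y n k.
have zH n : H n (z n) by exact: H_scale.
have -> : sign_sum (fun n => e n (+) e' n) y N = sign_sum e z N.
  by apply/funext => k; apply: eq_bigr => n _; rewrite sgn_addb /z mulrA.
apply: le_trans (h z N zH) _; rewrite -mulrA ler_wpM2l//.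
apply: le_trans (h' y N yH).
rewrite le_eqVlt; apply/orP; left; apply/eqP; congr N2.
by apply/funext => k; apply: eq_bigr => n _; rewrite /sgn expr0 mul1r.
Qed.

Definition agree n e e' := forall k, (k < n)%N -> e k = e' k.

Context (all_bounded : forall e, exists K, sign_bounded e K).

Lemma bounded_nonneg e : exists2 K, 0 <= K & sign_bounded e K.
Proof.
have [K hK] := all_bounded e; exists (Num.max 0 K); first by rewrite le_max lexx.
by apply: sign_bounded_le hK; rewrite le_max lexx orbT.
Qed.

(** Flipping the n-th sign alone is itself a choice of signs, hence bounded. A bound uniform on a
    cylinder therefore passes to the cylinder with one sign less prescribed, and finally to all
    choices. *)
Lemma cylinder_bounded e0 n :
  (exists K, forall e, agree n e e0 -> sign_bounded e K) ->
  exists K, forall e, sign_bounded e K.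
Proof.
elim: n => [|n IH] [K hK]; first by exists K => e; apply: hK.
apply: IH; have [K' K'0 hK'] := bounded_nonneg (fun k => k == n).
pose K1 := Num.max 0 K.
have K10 : 0 <= K1 by rewrite le_max lexx.
have hK1 e : agree n.+1 e e0 -> sign_bounded e K1.
  by move=> /hK; apply: sign_bounded_le; rewrite le_max lexx orbT.
exists (K1 + K1 * K') => e en.
have [een|een] := eqVneq (e n) (e0 n).
  apply: (@sign_bounded_le _ K1); first by rewrite lerDl mulr_ge0.
  by apply: hK1 => k; rewrite ltnS leq_eqVlt => /orP[/eqP ->|/en].
apply: (@sign_bounded_le _ (K1 * K')); first by rewrite lerDr.
have -> : e = (fun k => (e k (+) (k == n)) (+) (k == n)).
  by apply/funext => k; rewrite -addbA addbb addbF.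
apply: sign_bounded_addb => //; apply: hK1 => k.
rewrite ltnS leq_eqVlt => /orP[/eqP ->|kn].
  by rewrite eqxx addbT; move: een; case: (e n); case: (e0 n).
by rewrite (ltn_eqF kn) addbF en.
Qed.

(* Gliding hump: otherwise one builds nested cylinders on which the bound is at
   least [j], whose intersection is a choice of signs without any bound. *)
Lemma uniform_sign_bound : exists K, forall e, sign_bounded e K.
Proof.
apply: contrapT => none.
have next (p : (nat -> bool) * nat * nat) : exists q : (nat -> bool) * nat,
    [/\ agree p.1.2 q.1 p.1.1, (p.1.2 < q.2)%N &
      forall e, agree q.2 e q.1 -> ~ sign_bounded e p.2%:R].
  case: p => -[e0 n] j /=; apply: contrapT => h.
  apply: none; apply: (@cylinder_bounded e0 n); exists j%:R => e en y N yH.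
  rewrite leNgt; apply/negP => bad.
  (* The violated inequality involves only the first [N] signs, so it persists on the whole cylinder
     of this length. *)
  apply: h; exists (e, (maxn n N).+1); split => //=.
    by rewrite ltnS leq_maxl.
  move=> e' ee' /(_ y N yH); rewrite leNgt => /negP; apply.
  rewrite (@sign_sum_eq e' e)// => k kN; apply: ee'.
  by rewrite ltnS (leq_trans (ltnW kN))// leq_maxr.
have [step stepP] := choice next.
pose fix st j : (nat -> bool) * nat :=
  if j is j'.+1 then step (st j', j') else (fun=> false, 0%N).
have stS j : [/\ agree (st j).2 (st j.+1).1 (st j).1, ((st j).2 < (st j.+1).2)%N &
    forall e, agree (st j.+1).2 e (st j.+1).1 -> ~ sign_bounded e j%:R].
  exact: (stepP (st j, j)).
have stj j : (j <= (st j).2)%N.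
  by elim: j => // j IH; have [_ h _] := stS j; exact: leq_ltn_trans h.
have st_agree j i : agree (st j).2 (st (j + i)%N).1 (st j).1.
  elim: i => [|i IH]; first by rewrite addn0.
  move=> k kj; rewrite addnS; have [h _ _] := stS (j + i)%N.
  rewrite h ?IH//; apply: (leq_trans kj).
  elim: i {IH h} => [|i IH]; first by rewrite addn0.
  by apply: (leq_trans IH); rewrite addnS; have [_ /ltnW ? _] := stS (j + i)%N.
(* The stage k + 1 prescribes at least k + 1 signs, so its k-th sign is final. *)
pose e k := (st k.+1).1 k.
have e_agree j : agree (st j).2 e (st j).1.
  move=> k kj; rewrite /e.
  have <- := st_agree j k.+1 k kj.
  by have <- := st_agree k.+1 j k (stj k.+1); rewrite addnC.
have [K hK] := all_bounded e.
(* A stage whose excluded bound exceeds [K]. *)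
have [_ _ h] := stS (Num.trunc `|K|).+1.
apply: (h e) => //; apply: sign_bounded_le hK.
by apply: le_trans (ler_norm K) _; apply: ltW; exact: truncnS_gt.
Qed.

(** The lower estimate applies the sign bound to the choice that makes the signed sum large. The
    upper one takes the choice that makes it small and applies the same signs again, which restores
    the original sum. *)
Lemma sign_bound_two_sided : exists2 K : R, 0 <= K & forall y N, (forall n, H n (y n)) ->
  \sum_(n < N) N2 (y n) <= K * N2 (fun k => \sum_(n < N) y n k) /\
  N2 (fun k => \sum_(n < N) y n k) <= K * \sum_(n < N) N2 (y n).
Proof.
have [K0 hK0] := uniform_sign_bound; pose K := Num.max 0 K0.
have Kp : 0 <= K by rewrite le_max lexx.
have hK e : sign_bounded e K.
  by apply: sign_bounded_le (hK0 e); rewrite le_max lexx orbT.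
exists K => // y N yH.
have E (z : nat -> I -> C) : sign_sum (fun=> false) z N = (fun k => \sum_(n < N) z n k).
  by apply/funext => k; apply: eq_bigr => n _; rewrite /sgn expr0 mul1r.
have [|[e he] [f hf]] := @sign_sum_extreme y N; first by move=> n; exact: H_ell2.
split; first by rewrite -E; exact: le_trans hf (hK f _ _ yH).
pose z n k := sgn (e n) * y n k.
have zH n : H n (z n) by exact: H_scale.
have := hK e z N zH.
have -> : sign_sum e z N = (fun k => \sum_(n < N) y n k).
  apply/funext => k; apply: eq_bigr => n _; rewrite /z mulrA -sgn_addb addbb.
  by rewrite /sgn expr0 mul1r.
rewrite E => /le_trans; apply; rewrite ler_wpM2l//.
Qed.

End UniformBound.
End Signs.

(** * Riesz systems and two-sided estimates for finite sums *)

Section Riesz.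
Context {R : realType} {I : choiceType}.
Local Notation C := R[i].

Lemma cauchy_cvgR (u : nat -> R) :
  (forall e, 0 < e -> exists P, forall N, (P <= N)%N -> `|u P - u N| < e) ->
  exists l : R, u @ \oo --> l.
Proof.
move=> h; apply/cvg_ex; apply: cauchy_cvg; apply: cauchy_exP => e e0.
have [P hP] := h e e0; by exists (u P); exists P.
Qed.

Lemma cauchy_cvgC (u : nat -> C) :
  (forall e, 0 < e -> exists P, forall N, (P <= N)%N -> nsq (u P - u N) < e) ->
  exists l : C, u @ \oo --> l.
Proof.
move=> h.
have hp (p : C -> R) : (forall z, p z ^+ 2 <= nsq z) -> (forall z w, p (z - w) = p z - p w) ->
    exists l : R, (fun n => p (u n)) @ \oo --> l.
  move=> pz pB; apply: cauchy_cvgR => e e0.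
  have [P hP] := h _ (exprn_gt0 2 e0); exists P => N /hP; rewrite -pB => hN.
  rewrite -(ltr_pXn2r (n := 2))// ?nnegrE//; last exact: ltW.
  by rewrite real_normK ?num_real//; exact: le_lt_trans (pz _) hN.
have [x hx] : exists l : R, (fun n => complex.Re (u n)) @ \oo --> l.
  by apply: hp => [z|z w]; [rewrite lerDl sqr_ge0|rewrite raddfB].
have [y hy] : exists l : R, (fun n => complex.Im (u n)) @ \oo --> l.
  by apply: hp => [z|z w]; [rewrite lerDr sqr_ge0|rewrite raddfB].
by exists (x +i* y); apply: cvgC.
Qed.

Lemma cvg_nsq_sum (u : nat -> I -> C) (s : I -> C) (t : seq I) :
  (forall k, (fun N => u N k) @ \oo --> s k) ->
  (fun N => \sum_(k <- t) nsq (u N k)) @ \oo --> \sum_(k <- t) nsq (s k).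
Proof.
move=> us; apply: cvg_big => [|k _]; first exact: add_continuous.
have [hr hi] := cvgC_Re (us k).
by apply: cvgD; under eq_fun do rewrite expr2; apply: cvgM.
Qed.

(** Only coordinatewise convergence is required: each finite partial sum of squares passes to the
    limit. Together with [cauchy_cvgC] this supplies the completeness of [ell2]. *)
Lemma fatou (u : nat -> I -> C) (s : I -> C) (c : R) :
  (forall k, (fun N => u N k) @ \oo --> s k) ->
  (\forall N \near \oo, ell2 (u N) /\ N2 (u N) <= c) -> ell2 s /\ N2 s <= c.
Proof.
move=> us uc; apply: ell2_le => t ut.
have h : (fun N => \sum_(k <- t) nsq (u N k)) @ \oo --> \sum_(k <- t) nsq (s k).
  exact: cvg_nsq_sum.
apply: (cvgr_to_le h); apply: filterS uc => N [u2 uN].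
exact: le_trans (N2_ge u2 ut) uN.
Qed.

Lemma ell2_nat_tail (a : nat -> C) (e : R) : ell2 a -> 0 < e ->
  exists P, forall Q N, (P <= Q)%N -> \sum_(Q <= n < N) nsq (a n) <= e.
Proof.
move=> a2 e0; have p0 k : 0 <= nsq (a k) by exact: nsq_ge0.
have [s _ hs] := nsummable_tail p0 ((ell2E a).1 a2) e0.
exists (\max_(n <- s) n).+1 => Q N PQ; rewrite /index_iota.
apply: hs; first exact: iota_uniq.
move=> n; rewrite mem_iota => /andP[Qn _]; apply/negP => ns.
have : (n <= \max_(n <- s) n)%N by exact: (@leq_bigmax_seq _ _ xpredT (fun n => n)).
by move=> h; have := leq_ltn_trans h PQ; rewrite ltnNge Qn.
Qed.

Lemma riesz_of_two_sided (H : nat -> set (I -> C)) (K : R) : 0 <= K ->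
  (forall n h, H n h -> ell2 h) ->
  (forall n c h, H n h -> H n (fun k => c * h k)) ->
  (forall (y : nat -> I -> C) N, (forall n, H n (y n)) ->
    \sum_(n < N) N2 (y n) <= K * N2 (fun k => \sum_(n < N) y n k) /\
    N2 (fun k => \sum_(n < N) y n k) <= K * \sum_(n < N) N2 (y n)) ->
  riesz_system H.
Proof.
move=> K0 H2 HZ bnd.
have K1 : 0 < 2 * K + 1 by rewrite ltr_wpDl// mulr_ge0.
(* The factor 2 is lost when the limit is compared with a partial sum; the 1 makes the constant
   positive when K = 0. *)
exists (Num.sqrt (2 * K + 1)) => [|h a hH a2]; first by rewrite sqrtr_gt0.
pose y n k := a n * h n k.
have yH n : H n (y n) by apply: HZ; case: (hH n).
have hN n : N2 (h n) = 1 by case: (hH n) => /H2 h2; rewrite normsq_N2// => -[].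
have y2 n : ell2 (y n) by exact: H2.
have yN n : N2 (y n) = nsq (a n).
  by rewrite (ell2Z _ (H2 _ _ (hH n).1)).2 hN mulr1.
pose u N k := \sum_(n < N) y n k.
have u2 N : ell2 (u N) by exact: ell2_sum.
have uB P N : (P <= N)%N -> ell2 (fun k => u P k - u N k) /\
    N2 (fun k => u P k - u N k) <= K * \sum_(P <= n < N) nsq (a n).
  (* The difference of two partial sums is again a sum of vectors of the spaces [H n], with zeros
     before [P], so the upper estimate applies to it. *)
  move=> PN; pose z n k := (if (P <= n)%N then -1 else 0) * y n k.
  have zH n : H n (z n) by exact: HZ.
  have -> : (fun k => u P k - u N k) = (fun k => \sum_(n < N) z n k).
    apply/funext => k; rewrite /u -!(big_mkord xpredT (fun n => y n k)).
    rewrite -(big_mkord xpredT (fun n => z n k)).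
    rewrite (big_cat_nat (leq0n P) PN)/= [RHS](big_cat_nat (leq0n P) PN)/=.
    have -> : \sum_(0 <= n < P) z n k = 0.
      by rewrite big_nat big1// => n /andP[_ nP]; rewrite /z leqNgt nP /= mul0r.
    rewrite opprD addrA subrr !add0r -sumrN !big_nat; apply: eq_bigr => n /andP[Pn _].
    by rewrite /z Pn mulN1r.
  split; first by apply: ell2_sum => n _; exact: H2 (zH n).
  have [_ /le_trans] := bnd z N zH; apply; rewrite ler_wpM2l//.
  rewrite -(big_mkord xpredT (fun n => N2 (z n))) (big_cat_nat (leq0n P) PN)/=.
  have -> : \sum_(0 <= n < P) N2 (z n) = 0.
    rewrite big_nat big1// => n /andP[_ nP].
    by rewrite /z leqNgt nP /= (ell2Z _ (y2 n)).2 nsq0 mul0r.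
  rewrite add0r !big_nat; apply: ler_sum => n /andP[Pn _].
  rewrite /z Pn (ell2Z _ (y2 n)).2 yN nsqN -[1]/(1%:C) nsqR expr1n mul1r//.
have tail (e : R) : 0 < e -> exists P, forall Q N, (P <= Q <= N)%N ->
    N2 (fun k => u Q k - u N k) <= e.
  move=> e0; have Kp : 0 < K + 1 by rewrite ltr_wpDl.
  have [P hP] := ell2_nat_tail a2 (divr_gt0 e0 Kp); exists P => Q N /andP[PQ QN].
  apply: le_trans (uB Q N QN).2 _.
  apply: (@le_trans _ _ (K * (e / (K + 1)))).
    by apply: ler_wpM2l => //; exact: hP.
  by rewrite mulrCA ler_piMr ?ltW// ltr_pdivrMr// mul1r ltrDl.
have [s us] : exists s : I -> C, forall k, (fun N => u N k) @ \oo --> s k.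
  suff ulim k : exists l : C, (fun N => u N k) @ \oo --> l.
    by have [s hs] := choice ulim; exists s.
  apply: cauchy_cvgC => e e0; have [P hP] := tail _ (divr_gt0 e0 (ltr0n _ 2)).
  exists P => N PN; apply: (@le_lt_trans _ _ (e / 2)); last by lra.
  apply: le_trans (hP P N _); last by rewrite leqnn.
  exact: (N2_ge1 k (uB P N PN).1).
have subs Q : forall k, (fun N => u Q k - u N k) @ \oo --> u Q k - s k.
  by move=> k; apply: cvgB; [exact: cvg_cst|exact: us].
have tails (e : R) : 0 < e -> exists P, forall Q, (P <= Q)%N ->
    ell2 (fun k => u Q k - s k) /\ N2 (fun k => u Q k - s k) <= e.
  move=> /tail [P hP]; exists P => Q PQ; apply: (fatou (subs Q)).
  exists Q => // N QN; split; first exact: (uB Q N QN).1.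
  by apply: hP; rewrite PQ.
have aN N : \sum_(n < N) nsq (a n) <= N2 a.
  rewrite -(big_mkord xpredT (fun n => nsq (a n))); apply: N2_ge => //.
  exact: iota_uniq.
have [s2 sK] : ell2 s /\ N2 s <= K * N2 a.
  apply: (fatou us); near=> N; split; first exact: u2.
  have [_ /le_trans] := bnd y N yH; apply; rewrite ler_wpM2l//.
  by under eq_bigr do rewrite yN.
have sK' : N2 a <= 2 * K * N2 s.
  apply: (ell2_le _).2 => t ut; apply/ler_addgt0Pr => e e0.
  have Kp : 0 < 2 * K + 1 by [].
  have [P hP] := tails _ (divr_gt0 e0 Kp).
  (* Large enough for the remainder to be small and for all indices of [t] to be covered. *)
  pose N := (P + \max_(n <- t) n).+1.
  have [d2 dN] := hP N (leqW (leq_addr _ _)).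
  apply: (@le_trans _ _ (\sum_(n < N) N2 (y n))).
    under [leRHS]eq_bigr do rewrite yN.
    rewrite -(big_mkord xpredT (fun n => nsq (a n))).
    apply: ler_sum_subset => //; [by move=> n; exact: nsq_ge0|exact: iota_uniq|].
    move=> n nt; rewrite mem_index_iota /= /N ltnS.
    by apply: leq_trans (leq_addl _ _); exact: (@leq_bigmax_seq _ _ xpredT (fun n => n)).
  have [/le_trans lo _] := bnd y N yH; apply: lo.
  have -> : 2 * K * N2 s + e = K * (2 * N2 s) + e by ring.
  apply: (@le_trans _ _ (K * (2 * N2 s + 2 * (e / (2 * K + 1))))).
    apply: ler_wpM2l => //.
    have -> : (fun k => \sum_(n < N) y n k) = (fun k => s k + (u N k - s k)).
      by apply/funext => k; rewrite addrC subrK.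
    apply: le_trans (ell2D s2 d2).2 _.
    by rewrite lerD2l ler_wpM2l.
  rewrite [K * (_ + _)]mulrDr lerD2l.
  rewrite mulrCA mulrA mulrA ler_pdivrMr//.
  by rewrite mulrC; apply: ler_wpM2l; [exact: ltW|lra].
have sC : Num.sqrt (2 * K + 1) ^+ 2 = 2 * K + 1 by rewrite sqr_sqrtr// ltW.
exists s; split => //.
- rewrite /norm_cvg.
  apply: cvg_EFin.
    have [P hP] := tails 1 ltr01; exists P => // Q /hP [d2 _].
    by rewrite normsq_N2.
  apply/cvgrPdist_le => e /tails [P hP]; exists P => // Q /hP [d2 dN].
  rewrite /= sub0r normrN ger0_norm; last by rewrite normsq_N2// N2_ge0.
  by rewrite normsq_N2.
- rewrite !normsq_N2// -EFinM lee_fin sC mulrC ler_pdivrMr// mulrC.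
  apply: le_trans sK' _; rewrite ler_wpM2r ?N2_ge0//; lra.
- rewrite !normsq_N2// -EFinM lee_fin sC.
  apply: le_trans sK _; rewrite ler_wpM2r ?N2_ge0//; lra.
Unshelve. all: by end_near. Qed.

(** A Riesz system speaks of unit vectors in all the spaces at once, which would say nothing if one
    space were zero; hence the nonzero vectors demanded here. *)
Lemma riesz_two_sided (H : nat -> set (I -> C)) :
  (forall n h, H n h -> ell2 h) ->
  (forall n c h, H n h -> H n (fun k => c * h k)) ->
  (forall n, exists2 h, H n h & N2 h != 0) ->
  riesz_system H ->
  exists2 K : R, 0 <= K & forall (y : nat -> I -> C) N, (forall n, H n (y n)) ->
    \sum_(n < N) N2 (y n) <= K * N2 (fun k => \sum_(n < N) y n k) /\
    N2 (fun k => \sum_(n < N) y n k) <= K * \sum_(n < N) N2 (y n).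
Proof.
move=> H2 HZ Hn0 [c c0 Hc]; exists (c ^+ 2) => [|y N yH]; first exact: sqr_ge0.
have normalize n g : H n g -> N2 g != 0 ->
    exists2 k, H n k & normsq k = 1%E /\ g = (fun i => (Num.sqrt (N2 g))%:C * k i).
  move=> gH g0; have q0 : Num.sqrt (N2 g) != 0.
    by rewrite sqrtr_eq0 -ltNge lt_def g0 N2_ge0.
  have [l2 lN] := ell2Z ((Num.sqrt (N2 g))^-1)%:C (H2 _ _ gH).
  exists (fun i => ((Num.sqrt (N2 g))^-1)%:C * g i); first exact: HZ.
  split.
    by rewrite normsq_N2// lN nsqR exprVn sqr_sqrtr ?N2_ge0// mulVf.
  by apply/funext => i; rewrite mulrA -rmorphM mulfV// mul1r.
have unit n : exists p : (I -> C) * C,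
    [/\ H n p.1, normsq p.1 = 1%E, nsq p.2 = N2 (y n) & y n = (fun i => p.2 * p.1 i)].
  (* A zero vector is written as coefficient 0 times an arbitrary unit vector of the space. *)
  have [y0|y0] := eqVneq (N2 (y n)) 0.
    have [g gH g0] := Hn0 n; have [k kH [k1 _]] := normalize n g gH g0.
    exists (k, 0); rewrite y0 nsq0; split => //=.
    by rewrite (N2_eq0 (H2 _ _ (yH n)) y0); apply/funext => i; rewrite mul0r.
  have [k kH [k1 yk]] := normalize n _ (yH n) y0.
  exists (k, (Num.sqrt (N2 (y n)))%:C); split => //=.
  by rewrite nsqR sqr_sqrtr ?N2_ge0.
have [p pP] := choice unit.
pose a n := if (n < N)%N then (p n).2 else 0.
have aE : \sum_(n < N) nsq (a n) = \sum_(n < N) N2 (y n).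
  by apply: eq_bigr => n _; rewrite /a ltn_ord; have [_ _ -> _] := pP n.
have [a2 aN] : ell2 a /\ N2 a <= \sum_(n < N) N2 (y n).
  apply: ell2_le => t ut; rewrite -aE -(big_mkord xpredT (fun n => nsq (a n))).
  apply: (@le_trans _ _ (\sum_(n <- [seq n <- t | (n < N)%N]) nsq (a n))).
    rewrite big_filter [leLHS](bigID (fun n => n < N)%N)/= [X in _ + X]big1 ?addr0//.
    by move=> n; rewrite /a => /negbTE ->; rewrite nsq0.
  apply: ler_sum_subset; [by move=> n; exact: nsq_ge0|exact: filter_uniq|exact: iota_uniq|].
  by move=> n; rewrite mem_filter mem_index_iota => /andP[].
have aN' : N2 a = \sum_(n < N) N2 (y n).
  apply/eqP; rewrite eq_le aN -aE -(big_mkord xpredT (fun n => nsq (a n))).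
  by apply: N2_ge => //; exact: iota_uniq.
have [|s [s2 sc lo hi]] := Hc (fun n => (p n).1) a _ a2.
  by move=> n; have [? ? _ _] := pP n.
(* The coefficients vanish from [N] on, so the partial sums are eventually constant and the norm
   limit is the finite sum. *)
have sE : s = (fun k => \sum_(n < N) y n k).
  pose g k := \sum_(n < N) y n k - s k.
  have uE M : (N <= M)%N -> (fun k => \sum_(n < M) a n * (p n).1 k - s k) = g.
    move=> NM; apply/funext => k; rewrite /g; congr (_ - _).
    rewrite -(big_mkord xpredT (fun n => a n * (p n).1 k)) (big_cat_nat (leq0n N) NM)/=.
    have -> : \sum_(N <= n < M) a n * (p n).1 k = 0.
      by rewrite big_nat big1// => n /andP[Nn _]; rewrite /a ltnNge Nn mul0r.
    rewrite addr0 big_mkord; apply: eq_bigr => n _; rewrite /a ltn_ord.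
    by have [_ _ _ ->] := pP n.
  have g0 : normsq g = 0%E.
    apply: (cvg_unique _ _ sc) => //.
    by apply: cvg_near_cst; exists N => // M /uE ->.
  have gz : g = 0.
    have g2 : ell2 g by rewrite /ell2 /= g0 ltry.
    by apply: N2_eq0 => //; move: g0; rewrite normsq_N2// => -[].
  apply/funext => k; apply/eqP; rewrite eq_sym -subr_eq0.
  by rewrite -[X in X == _]/(g k) gz.
move: lo hi; rewrite !normsq_N2// -!EFinM !lee_fin aN' -sE => lo hi; split=> //.
by rewrite mulrC -ler_pdivrMr ?exprn_gt0// mulrC.
Qed.

End Riesz.

(** * Norm-preserving extension of shift-invariant forms *)

Section HahnBanach.
Context {R : realType} {T : Type}.
Local Notation C := R[i].
Local Notation V := (T -> C).
Implicit Types (x y f : V) (D : set V) (G : set (V * R)).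

Definition lin x (c : C) y : V := fun w => x w + c * y w.

(** Homogeneity is stated for p (x + s y) with the positive factor already distributed, the form in
    which the Hahn-Banach step consumes it. *)
Definition sublinear D (p : V -> R) : Prop :=
  [/\ forall x y (t : R), D x -> D y -> D (lin x t%:C y),
      forall x y, D x -> D y -> p (lin x 1 y) <= p x + p y &
      forall x y (t s : R), 0 < t -> D x -> D y ->
        p (lin x s%:C y) = t * p (lin (fun w => t^-1%:C * x w) (t^-1 * s)%:C y)].

Definition real_linear_graph G : Prop :=
  forall x y a b (t : R), G (x, a) -> G (y, b) -> G (lin x t%:C y, a + t * b).

(** The real one-dimensional step. Subadditivity separates the numbers a - p (x - f) from the
    numbers p (y + f) - b, and [c] is the supremum of the former; scaling reduces a general [t] to 1
    or -1. *)
Lemma hahn_banach_step D (p : V -> R) G f :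
  sublinear D p -> D f -> real_linear_graph G -> G ((fun=> 0), 0) ->
  (forall x a, G (x, a) -> D x /\ a <= p x) ->
  exists c : R, forall x a t, G (x, a) -> a + t * c <= p (lin x t%:C f).
Proof.
move=> [Dlin psub phom] Df Glin G0 Gp.
have linA x y : lin x 1 (lin y (-1) f) = lin (lin x 1 y) (-1) f.
  by apply/funext => w; rewrite /lin; ring.
have m1 : (-1)%:C = -1 :> C by rewrite rmorphN rmorph1.
have sep x a y b : G (x, a) -> G (y, b) ->
    a - p (lin x (-1) f) <= p (lin y 1 f) - b.
  move=> Gx Gy; have [Dx _] := Gp _ _ Gx; have [Dy _] := Gp _ _ Gy.
  have := Glin _ _ _ _ 1 Gx Gy; rewrite mul1r => /Gp [_].
  have -> : lin x 1%:C y = lin (lin x (-1) f) 1 (lin y 1 f).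
    by apply/funext => w; rewrite /lin; ring.
  have D1 : D (lin x (-1) f) by rewrite -m1; exact: Dlin.
  have D2 : D (lin y 1 f) by rewrite -[1]/(1%:C); exact: Dlin.
  have := psub _ _ D1 D2; move: (p _) (p _) (p _) => u v w; lra.
pose S := [set r : R | exists x a, G (x, a) /\ r = a - p (lin x (-1) f)].
have S0 : S !=set0 by exists (0 - p (lin (fun=> 0) (-1) f)), (fun=> 0), 0.
exists (sup S) => x a t Gx.
have Gscale (k : R) : G ((fun w => k%:C * x w), k * a).
  have := Glin _ _ _ _ k G0 Gx; rewrite add0r.
  by have -> : lin (fun=> 0) k%:C x = (fun w => k%:C * x w);
    first by apply/funext => w; rewrite /lin add0r.
have [Dx ap] := Gp _ _ Gx.
have [t0|t0|->] := ltgtP t 0.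
- have s0 : 0 < - t by rewrite oppr_gt0.
  rewrite (phom x f (- t) t s0 Dx Df).
  have tn : t != 0 by rewrite lt_eqF.
  have -> : (- t)^-1 * t = -1 by rewrite invrN mulNr mulVf.
  rewrite m1.
  have : (- t)^-1 * a - p (lin (fun w => (- t)^-1%:C * x w) (-1) f) <= sup S.
    apply: ub_le_sup.
      exists (p (lin (fun=> 0) 1 f) - 0) => _ [x' [a' [Gx' ->]]].
      exact: sep Gx' G0.
    by exists (fun w => (- t)^-1%:C * x w), ((- t)^-1 * a).
  move: (p _) (sup S) => P s h.
  have : (- t) * ((- t)^-1 * a - P) <= (- t) * s by rewrite ler_wpM2l// ltW.
  by rewrite mulrBr mulrA mulfV ?oppr_eq0// mul1r; lra.
- have tn : t != 0 by rewrite gt_eqF.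
  rewrite (phom x f t t t0 Dx Df) mulVf//.
  have : sup S <= p (lin (fun w => t^-1%:C * x w) 1 f) - t^-1 * a.
    apply: sup_le_ub => // _ [x' [a' [Gx' ->]]].
    exact: sep Gx' (Gscale t^-1).
  rewrite rmorph1.
  move: (p _) (sup S) => P s h.
  have : t * s <= t * (P - t^-1 * a) by rewrite ler_wpM2l// ltW.
  by rewrite mulrBr mulrA mulfV// mul1r; lra.
- rewrite mul0r addr0; have -> // : lin x 0%:C f = x.
  by apply/funext => w; rewrite /lin mul0r addr0.
Qed.

(** The hypothesis is a nonnegative quadratic polynomial with values A at 0 and S at 1 and leading
    coefficient B. Its discriminant bounds S - A - B by twice the square root of A B. *)
Lemma quadratic_triangle (A B S : R) : 0 <= A -> 0 <= B -> 0 <= S ->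
  (forall t : R, 0 <= (1 - t) * A + t * S + (t ^+ 2 - t) * B) ->
  Num.sqrt S <= Num.sqrt A + Num.sqrt B.
Proof.
move=> A0 B0 S0 h; pose b := S - A - B.
have {}h t : 0 <= A + t * b + t ^+ 2 * B.
  by have := h t; rewrite /b; congr (_ <= _); ring.
have bAB : b <= 2 * (Num.sqrt A * Num.sqrt B).
  have [b0|b0] := leP b 0; first by apply: le_trans b0 _; rewrite !mulr_ge0// sqrtr_ge0.
  have [Bz|Bn] := eqVneq B 0.
    (* For B = 0 and b > 0 the polynomial is affine and takes the value -1 here. *)
    have := h (- (A + 1) / b); rewrite Bz mulr0 addr0 divfK ?gt_eqF//.
    by move=> ?; exfalso; lra.
  have Bp : 0 < B by rewrite lt_def Bn.
  (* The minimum of the polynomial. *)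
  have := h (- b / (2 * B)).
  have -> : A + - b / (2 * B) * b + (- b / (2 * B)) ^+ 2 * B = A - b ^+ 2 / (4 * B).
    by field.
  rewrite subr_ge0 ler_pdivrMr ?mulr_gt0// => bb.
  rewrite -(ler_pXn2r (n := 2))// ?nnegrE ?(ltW b0)//.
  apply: le_trans bb _; rewrite !exprMn !sqr_sqrtr//.
  by rewrite le_eqVlt; apply/orP; left; apply/eqP; ring.
rewrite -(ler_pXn2r (n := 2))// ?nnegrE ?addr_ge0 ?sqrtr_ge0//.
rewrite sqrrD !sqr_sqrtr// -mulr_natl.
by move: bAB; rewrite /b; move: (Num.sqrt A * _) => z; lra.
Qed.

End HahnBanach.

(** * Adjoining one vector to a shift-invariant form *)

Section Extension.
Context {R : realType} {d : option nat}.
Local Notation C := R[i].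
Local Notation L := (letter d).
Local Notation W := (word d).
Local Notation V := (W -> C).
Context (K : R).
Implicit Types (M : set (V * C)) (g h f : V).

Definition shift (v : W) h : V := fun w => h (w ++ v).

Lemma shift_nil h : shift [::] h = h.
Proof. by apply/funext => w; rewrite /shift cats0. Qed.

Lemma shift_rcons v i h : shift (rcons v i) h = shift v (shift [:: i] h).
Proof. by apply/funext => w; rewrite /shift -cats1 !catA. Qed.

Lemma shift_lin v h c g : shift v (lin h c g) = lin (shift v h) c (shift v g).
Proof. by []. Qed.

(* [M] is the graph of a linear form; the operator that it defines maps [h] to the
   family of the values of the form at the shifts of [h]. *)
Definition admissible M : Prop :=
  [/\ forall h g c e k, M (h, c) -> M (g, e) -> M (lin h k g, c + k * e),
      forall h c i, M (h, c) -> exists e, M (shift [:: i] h, e),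
      forall h c, M (h, c) -> ell2 h &
      forall h c (b : W -> C), M (h, c) -> (forall v, M (shift v h, b v)) ->
        (nsum (fun v => nsq (b v)) <= (K ^+ 2 * N2 h)%:E)%E].

Section OneStep.
Context (M : set (V * C)) (f : V).
Context (Madm : admissible M) (M0 : M ((fun=> 0), 0)).
Context (f2 : ell2 f) (fM : forall i, exists c, M (shift [:: i] f, c)).

Let Mlin : forall h g c e k, M (h, c) -> M (g, e) -> M (lin h k g, c + k * e).
Proof. by case: Madm. Qed.

Let Mell2 : forall h c, M (h, c) -> ell2 h.
Proof. by case: Madm. Qed.

Definition dom h : Prop := exists c, M (h, c).
Definition form h : C := xget 0 [set c | M (h, c)].

Lemma dom_form h : dom h -> M (h, form h).
Proof. by case=> c Mc; rewrite /form; case: xgetP => [y ->|/(_ c)]. Qed.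

Lemma dom_shift v h : dom h -> dom (shift v h).
Proof.
elim/last_ind: v h => [|v i IH] h [c Mc]; first by rewrite shift_nil; exists c.
rewrite shift_rcons; apply: IH; case: Madm => _ /(_ h c i Mc) [e Me] _ _.
by exists e.
Qed.

Lemma nsq_le_nsum (I : choiceType) (b : I -> C) (k : I) (c : R) :
  (nsum (fun v => nsq (b v)) <= c%:E)%E -> nsq (b k) <= c.
Proof.
move/nsum_leP => h; have := h (fun v => nsq_ge0 _) [:: k] isT.
by rewrite big_seq1.
Qed.

Lemma admissible_le h c : M (h, c) -> nsq c <= K ^+ 2 * N2 h.
Proof.
(* Single-valuedness of [M] is not yet known, so the given value [c] is placed at the empty word by
   hand. *)
move=> Mc; pose b v := if v == [::] then c else form (shift v h).
rewrite -[c]/(b [::]); apply: (@nsq_le_nsum _ b).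
case: Madm => _ _ _; apply; first exact: Mc.
move=> v; rewrite /b; case: eqP => [->|_]; first by rewrite shift_nil.
by apply: dom_form; apply: dom_shift; exists c.
Qed.

(** The difference of two values is a value at 0, which the norm bound forces to be 0. *)
Lemma form_unique h c : M (h, c) -> c = form h.
Proof.
move=> Mc; have Mf := dom_form (ex_intro _ c Mc).
have := Mlin (-1) Mc Mf => /admissible_le.
have -> : lin h (-1) h = (0 : V).
  by apply/funext => w; rewrite /lin mulN1r subrr.
rewrite (ell20).2 mulr0 mulN1r => le0; apply/eqP; rewrite -subr_eq0.
by apply/eqP/nsq_eq0/eqP; rewrite eq_le le0 nsq_ge0.
Qed.

(** The vectors that may be adjoined: every coefficient of their image but the one at the empty word
    is already determined. *)
Definition predom h : Prop := ell2 h /\ forall i, dom (shift [:: i] h).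

Lemma dom_predom h : dom h -> predom h.
Proof.
by move=> hd; split=> [|i]; [case: hd => c /Mell2|exact: dom_shift].
Qed.

Lemma dom_lin h g c : dom h -> dom g -> dom (lin h c g).
Proof. by move=> [a Ma] [b Mb]; exists (a + c * b); exact: Mlin. Qed.

Lemma form_lin h g c : dom h -> dom g -> form (lin h c g) = form h + c * form g.
Proof.
by move=> hd gd; apply/esym/form_unique/Mlin; exact: dom_form.
Qed.

Lemma ell2_lin (I : choiceType) (x y : I -> C) c : ell2 x -> ell2 y -> ell2 (lin x c y).
Proof. by move=> x2 y2; apply: (ell2D x2 (ell2Z c y2).1).1. Qed.

Lemma predom_lin h g c : predom h -> predom g -> predom (lin h c g).
Proof.
move=> [h2 hs] [g2 gs]; split; first exact: ell2_lin.
by move=> i; rewrite shift_lin; exact: dom_lin.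
Qed.

(** The index (i, v) stands for the nonempty word [rcons v i]; this is the image without its
    coefficient at the empty word. *)
Definition image g : L * W -> C := fun p => form (shift p.2 (shift [:: p.1] g)).

Lemma image_lin h g c : predom h -> predom g ->
  image (lin h c g) = lin (image h) c (image g).
Proof.
move=> [_ hs] [_ gs]; apply/funext => -[i v]; rewrite /image !shift_lin form_lin//.
- exact: dom_shift.
- exact: dom_shift.
Qed.

(** Admissibility applies to each [shift [:: i] g], and the squared norms of these add up to that of
    [g] without its coefficient at the empty word. *)
Lemma image_bound g : predom g -> ell2 (image g) /\ N2 (image g) <= K ^+ 2 * N2 g.
Proof.
move=> [g2 gs].
have p0 (I : choiceType) (b : I -> C) k : 0 <= nsq (b k) by exact: nsq_ge0.
apply: ell2_le; apply/nsum_leP => //.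
rewrite nsum_pair//.
have gi i : ell2 (shift [:: i] g) by case: (gs i) => c /Mell2.
apply: (@le_trans _ _ (\esum_(i in [set: L]) nsum (fun v => K ^+ 2 * nsq (g (rcons v i))))).
  apply: le_esum => i _.
  have -> : nsum (fun v => K ^+ 2 * nsq (g (rcons v i))) = (K ^+ 2 * N2 (shift [:: i] g))%:E.
    rewrite EFinM -normsq_N2// normsqE nsumZ ?sqr_ge0//.
    - congr (_ * _)%E; apply: eq_esum => v _; by rewrite /shift cats1.
    - have /ell2E := gi i; rewrite /nsummable => gio.
      rewrite (_ : (fun v => nsq (g (rcons v i))) = (fun v => nsq (shift [:: i] g v)))//.
      by apply/funext => v; rewrite /shift cats1.
  case: Madm => _ _ _; apply; first exact: dom_form (gs i).
  by move=> v; apply: dom_form; apply: dom_shift; exact: gs.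
rewrite -(nsum_pair (a := fun p : L * W => K ^+ 2 * nsq (g (rcons p.2 p.1)))); last first.
  by move=> p; apply: mulr_ge0; [exact: sqr_ge0|exact: nsq_ge0].
have /ell2E gso := g2.
have Eg : normsq g = ((nsq (g [::]))%:E + nsum (fun p : L * W => nsq (g (rcons p.2 p.1))))%E.
  by rewrite normsqE nsum_rcons.
have le1 : (nsum (fun p : L * W => nsq (g (rcons p.2 p.1))) <= normsq g)%E.
  by rewrite Eg leeDr// lee_fin nsq_ge0.
rewrite nsumZ ?sqr_ge0//; last 2 first.
- by move=> p; exact: nsq_ge0.
- exact: le_lt_trans le1 g2.
by rewrite (EFinM (K ^+ 2)) -normsq_N2// lee_wpmul2l ?lee_fin ?sqr_ge0.
Qed.

(* Admissible extensions to [f] correspond to extensions of the form that stay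
   dominated by [sqrt (defect g)], which is a seminorm because [defect] is a
   nonnegative quadratic form; hence Hahn-Banach applies. *)
Definition defect g : R := K ^+ 2 * N2 g - N2 (image g).

Lemma defect_ge0 g : predom g -> 0 <= defect g.
Proof. by move=> /image_bound [_ h]; rewrite subr_ge0. Qed.

Lemma defect_scale g c : predom g -> defect (fun w => c * g w) = nsq c * defect g.
Proof.
move=> gp; have [i2 _] := image_bound gp; case: (gp) => g2 _.
have zp : predom (fun=> 0) by apply: dom_predom; exists 0.
have E : (fun w => c * g w) = lin (fun=> 0) c g.
  by apply/funext => w; rewrite /lin add0r.
have iz : image (fun=> 0) = (fun=> 0).
  apply/funext => -[i v]; rewrite /image -[shift _ _]/(fun=> 0 : C).
  exact/esym/form_unique.
rewrite /defect (ell2Z c g2).2 E image_lin// iz.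
have -> : lin (fun=> 0) c (image g) = (fun k => c * image g k).
  by apply/funext => k; rewrite /lin add0r.
by rewrite (ell2Z c i2).2; ring.
Qed.

Lemma defect_line g h (t : R) : predom g -> predom h ->
  defect (lin g t%:C h) =
  (1 - t) * defect g + t * defect (lin g 1 h) + (t ^+ 2 - t) * defect h.
Proof.
move=> gp hp; have [i2 _] := image_bound gp; have [j2 _] := image_bound hp.
have [g2 _] := gp; have [h2 _] := hp.
rewrite /defect !image_lin// /lin (N2_lin t g2 h2) (N2_lin t i2 j2).
have E (I : choiceType) (x y : I -> C) : (fun w => x w + 1 * y w) = (fun w => x w + y w).
  by apply/funext => w; rewrite mul1r.
by rewrite !E; ring.
Qed.

Lemma form_defect h : dom h -> nsq (form h) <= defect h.
Proof.
move=> hd; have [i2 _] := image_bound (dom_predom hd).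
rewrite lerBrDr -lee_fin EFinD -normsq_N2// normsqE.
have := @nsum_rcons _ _ (fun v : W => nsq (form (shift v h))) (fun v => nsq_ge0 _).
rewrite shift_nil.
have -> : nsum (fun p : L * W => nsq (form (shift (rcons p.2 p.1) h))) =
    nsum (fun p => nsq (image h p)).
  by apply: eq_esum => p _; rewrite shift_rcons.
move=> <-; case: Madm => _ _ _; apply; first exact: dom_form hd.
by move=> v; apply: dom_form; exact: dom_shift.
Qed.

Definition seminorm g : R := Num.sqrt (defect g).

Lemma seminorm_sublinear : sublinear predom seminorm.
Proof.
split.
- by move=> x y t; exact: predom_lin.
- move=> x y xp yp; apply: quadratic_triangle; try exact: defect_ge0.
    by apply: defect_ge0; exact: predom_lin.
  move=> t; rewrite -defect_line//; apply: defect_ge0; exact: predom_lin.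
- move=> x y t s t0 xp yp; rewrite /seminorm.
  have zp : predom (fun=> 0) by apply: dom_predom; exists 0.
  have tx : predom (fun w => t^-1%:C * x w).
    have -> : (fun w => t^-1%:C * x w) = lin (fun=> 0) t^-1%:C x.
      by apply/funext => w; rewrite /lin add0r.
    exact: predom_lin.
  rewrite -[X in X * _](ger0_norm (ltW t0)) -sqrtr_sqr -sqrtrM ?sqr_ge0//.
  rewrite -nsqR -defect_scale; last exact: predom_lin.
  congr (Num.sqrt (defect _)); apply/funext => w; rewrite /lin.
  have tn : t != 0 by rewrite gt_eqF.
  rewrite mulrDr !mulrA -!rmorphM/= mulrA mulfV// mul1r.
  by rewrite !mul1r.
Qed.

(** Complex Hahn-Banach by real parts: the real part of the form is extended first along f, then
    along i f, both times below [seminorm]. *)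
Lemma extension_step : exists M', [/\ admissible M', M `<=` M' & exists c, M' (f, c)].
Proof.
have fp : predom f by split.
pose G0 := [set x : V * R | exists2 c, M (x.1, c) & x.2 = complex.Re c].
have G0lin : real_linear_graph G0.
  move=> x y a b t [c Mc /= ->] [e Me /= ->]; exists (c + t%:C * e); first exact: Mlin.
  by rewrite /= raddfD /=; case: e Me => p q _ /=; rewrite mul0r subr0.
have G0p x a : G0 (x, a) -> predom x /\ a <= seminorm x.
  move=> [c /= Mc ->]; have xd : dom x by exists c.
  split; first exact: dom_predom.
  apply: le_trans (ler_norm _) _; rewrite -sqrtr_sqr ler_sqrt; last first.
    by apply: defect_ge0; exact: dom_predom.
  apply: le_trans (form_defect xd); rewrite -(form_unique Mc).
  by rewrite lerDl sqr_ge0.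
have G00 : G0 ((fun=> 0), 0) by exists 0.
have [c1 h1] := hahn_banach_step seminorm_sublinear fp G0lin G00 G0p.
pose G1 := [set x : V * R | exists y a t, [/\ G0 (y, a), x.1 = lin y t%:C f & x.2 = a + t * c1]].
have G1lin : real_linear_graph G1.
  move=> _ _ _ _ t [y [a [u [Gy /= -> ->]]]] [z [b [v [Gz /= -> ->]]]].
  exists (lin y t%:C z), (a + t * b), (u + t * v); split; first exact: G0lin.
    apply/funext => w; rewrite /lin /= rmorphD rmorphM /=; ring.
  by rewrite /=; ring.
have G1p x a : G1 (x, a) -> predom x /\ a <= seminorm x.
  move=> [y [b [t [Gy /= -> ->]]]]; split; last exact: h1.
  by apply: predom_lin => //; have [] := G0p _ _ Gy.
have G10 : G1 ((fun=> 0), 0).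
  exists (fun=> 0), 0, 0; split => //=; last by rewrite mul0r addr0.
  by apply/funext => w; rewrite /lin mul0r addr0.
pose g : V := fun w => 'i%C * f w.
have gp : predom g.
  have zp : predom (fun=> 0) by apply: dom_predom; exists 0.
  have -> : g = lin (fun=> 0) 'i%C f by apply/funext => w; rewrite /lin add0r.
  exact: predom_lin.
have [c2 h2] := hahn_banach_step seminorm_sublinear gp G1lin G10 G1p.
(* The complex number for which [cf] has real part [c1] and i times [cf] has real part [c2]. *)
pose cf : C := c1 -i* c2.
have key h c k : M (h, c) -> nsq (c + k * cf) <= defect (lin h k f).
  move=> Mc; set z := c + k * cf.
  have hp : predom (lin h k f) by apply: predom_lin => //; apply: dom_predom; exists c.
  (* Multiplying the vector by the conjugate of its value [z] makes the value the real number |z|^2,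
     so the bound on real parts gives |z|^2 <= |z| times the seminorm. *)
  have : nsq z <= seminorm (fun w => z^* * lin h k f w).
    have G0z : G0 ((fun w => z^* * h w), complex.Re (z^* * c)).
      exists (z^* * c) => //=.
      have := Mlin z^* M0 Mc; rewrite add0r.
      by have -> : lin (fun=> 0) z^* h = (fun w => z^* * h w);
        first by apply/funext => w; rewrite /lin add0r.
    pose l := z^* * k.
    have G1z : G1 (lin (fun w => z^* * h w) (complex.Re l)%:C f,
        complex.Re (z^* * c) + complex.Re l * c1).
      by exists (fun w => z^* * h w), (complex.Re (z^* * c)), (complex.Re l).
    have := h2 _ _ (complex.Im l) G1z.
    have -> : complex.Re (z^* * c) + complex.Re l * c1 + complex.Im l * c2 = nsq z.
      transitivity (complex.Re (z^* * z)).
        have -> : z^* * z = z^* * c + l * cf by rewrite /l -mulrA -mulrDr.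
        have ReM (u : C) : complex.Re (u * cf) = complex.Re u * c1 + complex.Im u * c2.
          by case: u => p q; rewrite /cf /=; ring.
        have ReD (u v : C) : complex.Re (u + v) = complex.Re u + complex.Re v.
          by case: u v => p q [].
        by rewrite ReD ReM addrA.
      by rewrite mulrC mulCJ.
    have -> // : lin (lin (fun w => z^* * h w) (complex.Re l)%:C f) (complex.Im l)%:C g =
       (fun w => z^* * lin h k f w).
    apply/funext => w; rewrite /lin /g mulrDr -addrA; congr (_ + _).
    rewrite [z^* * (k * _)]mulrA -/l [in RHS](complexE l).
    by rewrite mulrDl mulrA ['i%C * _]mulrC.
  rewrite /seminorm defect_scale// nsqJ.
  have z0 := nsq_ge0 z; have d0 := defect_ge0 hp.
  rewrite -(ler_pXn2r (n := 2))// ?nnegrE ?sqrtr_ge0// sqr_sqrtr; last exact: mulr_ge0.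
  have [->|zn] := eqVneq (nsq z) 0; first by [].
  by rewrite expr2 ler_pM2l// lt_def zn.
pose M' := [set x : V * C | exists h c k, [/\ M (h, c), x.1 = lin h k f & x.2 = c + k * cf]].
have MM' : M `<=` M'.
  move=> [h c] Mc; exists h, c, 0; split => //=; last by rewrite mul0r addr0.
  by apply/funext => w; rewrite /lin mul0r addr0.
have M'lin h g' c e k : M' (h, c) -> M' (g', e) -> M' (lin h k g', c + k * e).
  move=> [h1' [c1' [k1 [Mc /= -> ->]]]] [h2' [c2' [k2 [Me /= -> ->]]]].
  exists (lin h1' k h2'), (c1' + k * c2'), (k1 + k * k2); split; first exact: Mlin.
    by apply/funext => w; rewrite /lin /=; ring.
  by rewrite /=; ring.
have M'key h c : M' (h, c) -> predom h /\ nsq c <= defect h.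
  move=> [h' [c' [k [Mc /= -> ->]]]]; split; last exact: key.
  by apply: predom_lin => //; apply: dom_predom; exists c'.
have M'unique h c e : M' (h, c) -> M' (h, e) -> c = e.
  move=> Mc Me; have := M'lin _ _ _ _ (-1) Mc Me => /M'key [_].
  have -> : lin h (-1) h = (fun w => 0 * h w).
    by apply/funext => w; rewrite /lin; ring.
  rewrite defect_scale; last by have [] := M'key _ _ Mc.
  rewrite nsq0 mul0r mulN1r => le0; apply/eqP; rewrite -subr_eq0.
  by apply/eqP/nsq_eq0/eqP; rewrite eq_le le0 nsq_ge0.
exists M'; split => //; last first.
  exists cf, (fun=> 0), 0, 1; split => //=; last by ring.
  by apply/funext => w; rewrite /lin; ring.
split => //.
- move=> h c i /M'key [[_ /(_ i) [e Me]] _]; exists e; exact: MM'.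
- by move=> h c /M'key [[]].
(* The shifts of [h] lie in the old domain, so the nonempty words contribute the norm of [image h]
   and the new value is covered by [defect h]. *)
- move=> h c b Mc Mb; have [hp _] := M'key _ _ Mc.
  have [i2 _] := image_bound hp.
  rewrite nsum_rcons; last by move=> v; exact: nsq_ge0.
  have -> : nsum (fun p : L * W => nsq (b (rcons p.2 p.1))) = (N2 (image h))%:E.
    rewrite -normsq_N2// normsqE; apply: eq_esum => -[i v] _ /=.
    congr (nsq _)%:E; apply: (@M'unique (shift (rcons v i) h)) => //.
    rewrite shift_rcons; apply: MM'; apply: dom_form; apply: dom_shift.
    by case: hp.
  have [_] := M'key _ _ (Mb [::]); rewrite shift_nil /defect => hb.
  by rewrite -EFinD lee_fin -lerBrDr.
Qed.

End OneStep.
End Extension.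

(** * Maximal admissible forms and the multiplier that they define *)

Section Maximal.
Context {R : realType} {d : option nat}.
Local Notation C := R[i].
Local Notation L := (letter d).
Local Notation W := (word d).
Local Notation V := (W -> C).
Context (K : R).
Implicit Types (M A : set (V * C)) (g h f : V).

Lemma admissible_functional M h c e : admissible K M ->
  M (h, c) -> M (h, e) -> c = e.
Proof. by move=> Ma /(form_unique Ma) -> /(form_unique Ma) ->. Qed.

Lemma admissible_chain (F : set (set (V * C))) : F !=set0 ->
  (forall X, F X -> admissible K X) -> total_on F subset ->
  admissible K (\bigcup_(X in F) X).
Proof.
move=> [X0 FX0] Fadm Ftot.
have common x y : (\bigcup_(X in F) X) x -> (\bigcup_(X in F) X) y ->
    exists X, [/\ F X, X x & X y].
  move=> [X FX Xx] [Y FY Yy]; have [XY|YX] := Ftot X Y FX FY.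
    by exists Y; split => //; exact: XY.
  by exists X; split => //; exact: YX.
split.
- move=> h g c e k Uh Ug; have [X [FX Xh Xg]] := common _ _ Uh Ug.
  by exists X => //; have [Xlin _ _ _] := Fadm X FX; exact: Xlin.
- move=> h c i [X FX Xh]; have [_ Xs _ _] := Fadm X FX.
  by have [e Xe] := Xs h c i Xh; exists e, X.
- by move=> h c [X FX Xh]; have [_ _ X2 _] := Fadm X FX; exact: X2 Xh.
(* The values [b v] may come from different members of the chain; comparison inside a common larger
   member moves them all into [X]. *)
- move=> h c b [X FX Xh] Ub; have Xa := Fadm X FX.
  have [_ _ _ Xb] := Xa; apply: (Xb h c b Xh) => v.
  have hd : dom X h by exists c.
  have [e Xe] := dom_shift Xa v hd.
  suff -> : b v = e by [].
  have [|Y [FY Yb Ye]] := common _ _ (Ub v) (_ : _ (shift v h, e)).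
    by exists X.
  have Ya := Fadm Y FY; exact: admissible_functional Ya Yb Ye.
Qed.

Lemma admissible_maximal M0 : admissible K M0 -> M0 ((fun=> 0), 0) ->
  exists M, [/\ admissible K M, M0 `<=` M & forall f, ell2 f ->
    (forall i, exists c, M (shift [:: i] f, c)) -> exists c, M (f, c)].
Proof.
move=> M0a M00.
(* Zorn's lemma also has to serve the empty chain; joining [M0] to every candidate settles this and
   keeps [M0] inside the result. *)
pose P := [set A | admissible K (A `|` M0)].
have [|A [PA Amax]] := @Zorn_bigcup _ P.
  move=> F FP Ftot; rewrite /P /=.
  pose F' := [set M0] `|` [set X `|` M0 | X in F].
  have -> : \bigcup_(X in F) X `|` M0 = \bigcup_(X in F') X.
    apply/seteqP; split=> [x [[X FX Xx]|Mx]|x [X [->|[Y FY <-]]]].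
    - by exists (X `|` M0); [right; exists X|left].
    - by exists M0; [left|].
    - by right.
    - by case=> [Yx|Mx]; [left; exists Y|right].
  apply: admissible_chain.
  - by exists M0; left.
  - by move=> X [->//|[Y FY <-]]; exact: FP.
  - move=> X Y [->|[X' FX' <-]] [->|[Y' FY' <-]].
    + by left.
    + by left; exact: subsetUr.
    + by right; exact: subsetUr.
    + by have [XY|YX] := Ftot _ _ FX' FY'; [left|right]; exact: setSU.
exists (A `|` M0); split => // f f2 fM.
have [M' [M'a MM' [c M'f]]] := extension_step PA (or_intror M00) f2 fM.
have [->|neq] := pselect (A `|` M0 = M'); first by exists c.
exfalso; apply: (Amax M'); last first.
  rewrite /P /= (_ : M' `|` M0 = M')//; apply/setUidPl => x Mx.
  by apply: MM'; right.
split; first by move=> x Ax; apply: MM'; left.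
move=> M'A; apply: neq; apply/seteqP; split => // x /M'A; left.
by [].
Qed.

Definition delta (w : W) : V := fun u => (u == w)%:R.

Lemma ell2_finite (I : choiceType) (s : seq I) (f : I -> C) :
  (forall k, k \notin s -> f k = 0) -> ell2 f.
Proof.
move=> f0; apply: (ell2_le (c := \sum_(k <- undup s) nsq (f k)) _).1 => t ut.
apply: (@le_trans _ _ (\sum_(k <- [seq k <- t | k \in s]) nsq (f k))).
  rewrite big_filter [leLHS](bigID (mem s))/= [X in _ + X]big1 ?addr0//.
  by move=> k /f0 ->; rewrite nsq0.
apply: ler_sum_subset; [by move=> k; exact: nsq_ge0|exact: filter_uniq|exact: undup_uniq|].
by move=> k; rewrite mem_filter mem_undup => /andP[].
Qed.

Theorem multiplier_of_admissible M0 : admissible K M0 -> M0 ((fun=> 0), 0) ->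
  exists2 b : W -> C, multiplier_bounded K b &
    forall h c, M0 (h, c) -> c = pair b h.
Proof.
move=> M0a M00; have [M [Ma M0M Mmax]] := admissible_maximal M0a M00.
have Mz : M ((fun=> 0), 0) by exact: M0M.
have [Mlin _ M2 Mb] := Ma.
(* Induction on the word: a one-letter shift of the point mass at [rcons w j] is the point mass at
   [w] or 0, so maximality puts the longer word into the domain. *)
have Mdelta w : exists c, M (delta w, c).
  elim/last_ind: w => [|w j IH]; apply: Mmax.
  - by apply: (@ell2_finite _ [:: [::]]) => u; rewrite inE /delta => /negbTE ->.
  - move=> i; exists 0.
    have -> // : shift [:: i] (delta [::]) = (fun=> 0).
    by apply/funext => u; rewrite /shift /delta; case: u.
  - by apply: (@ell2_finite _ [:: rcons w j]) => u; rewrite inE /delta => /negbTE ->.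
  - move=> i; have [<-|ij] := eqVneq i j.
      have [c Mc] := IH; exists c.
      have -> // : shift [:: i] (delta (rcons w i)) = delta w.
      by apply/funext => u; rewrite /shift /delta cats1 eqseq_rcons eqxx andbT.
    exists 0.
    have -> // : shift [:: i] (delta (rcons w j)) = (fun=> 0).
    by apply/funext => u; rewrite /shift /delta cats1 eqseq_rcons (negbTE ij) andbF.
have [b Mbd] := choice Mdelta.
have Mfin (s : seq W) f : (forall w, w \notin s -> f w = 0) -> M (f, pair b f).
  move=> f0; have us := undup_uniq s.
  rewrite (@pair_restrict _ _ (undup s))//; last by move=> w; rewrite mem_undup; exact: f0.
  have H t : M ((fun u => \sum_(w <- t) f w * delta w u), \sum_(w <- t) b w * f w).
    elim: t => [|w t IH].
      rewrite big_nil; have -> // : (fun u => \sum_(w <- [::]) f w * delta w u) = (fun=> 0).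
      by apply/funext => u; rewrite big_nil.
    have := Mlin _ _ _ _ (f w) IH (Mbd w).
    rewrite big_cons addrC [f w * b w]mulrC.
    have -> // : lin (fun u => \sum_(w0 <- t) f w0 * delta w0 u) (f w) (delta w) =
      (fun u => \sum_(w0 <- w :: t) f w0 * delta w0 u).
    by apply/funext => u; rewrite /lin big_cons addrC.
  have := H (undup s).
  have -> // : (fun u => \sum_(w <- undup s) f w * delta w u) = f.
  apply/funext => u; have [us'|us'] := boolP (u \in undup s).
    rewrite (bigD1_seq u)//= /delta eqxx mulr1 big1 ?addr0// => w wu.
    by rewrite eq_sym (negbTE wu) mulr0.
  have -> : f u = 0 by apply: f0; move: us'; rewrite mem_undup.
  rewrite big_seq; apply: big1 => w ws.
  rewrite /delta; case: eqP => [e|_]; last by rewrite mulr0.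
  by move: us'; rewrite e ws.
have bK : multiplier_bounded K b.
  move=> s Vs f uV f0.
  (* A shift of a finitely supported family is supported on these prefixes. *)
  have fs v w : w \notin [seq take (size u - size v) u | u <- s] -> shift v f w = 0.
    move=> ws; apply: f0; apply: contra ws => ws; apply/mapP; exists (w ++ v) => //.
    by rewrite size_cat addnK take_size_cat.
  have Ms v : M (shift v f, pair b (shift v f)) by exact: Mfin (fs v).
  have := Mb f _ (fun v => pair b (shift v f)) (Mfin s f f0) Ms.
  by move/nsum_leP; apply => // v; exact: nsq_ge0.
(* Vectors of [M0] may have infinite support; the form and the pairing with [b] are both continuous
   and agree on finite restrictions. [D] bounds the cost of the tail in both together. *)
exists b => // h c /M0M Mh; have b2 := multiplier_ell2 bK; have h2 := M2 _ _ Mh.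
apply/eqP; rewrite -subr_eq0; apply/eqP/nsq_eq0/eqP; rewrite eq_le nsq_ge0 andbT.
pose D := 2 * K ^+ 2 + 2 * N2 b.
have D0 : 0 <= D by apply: addr_ge0; apply: mulr_ge0 => //; [exact: sqr_ge0|exact: N2_ge0].
have D1 : 0 < D + 1 by rewrite ltr_wpDl.
apply/ler_addgt0Pr => e e0; rewrite add0r.
have [s us [g2 gN]] := ell2_tail h2 (divr_gt0 e0 D1).
set g := fun k => h k - _ in g2 gN.
have r0 w : w \notin s -> restrict s h w = 0 by rewrite /restrict => /negbTE ->.
have [r2 _] := ell2_restrict s h2.
have Mg : M (g, c - pair b (restrict s h)).
  have := Mlin _ _ _ _ (-1) Mh (Mfin _ _ r0); rewrite mulN1r.
  have -> // : lin h (-1) (restrict s h) = g.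
  by apply/funext => w; rewrite /lin mulN1r.
have -> : c - pair b h = (c - pair b (restrict s h)) + (- pair b g).
  have -> : pair b h = pair b (restrict s h) + pair b g.
    rewrite pairC [pair b (restrict _ _)]pairC [pair b g]pairC -[pair g b]mul1r.
    rewrite -pair_linl//; congr pair; apply/funext => w.
    by rewrite mul1r /g addrC subrK.
  by rewrite opprD addrA.
apply: le_trans (nsq_add _ _) _; rewrite nsqN.
have h1 := admissible_le Ma Mg.
have h3 := nsq_pair b2 g2.
apply: (@le_trans _ _ (D * N2 g)).
  have -> : D * N2 g = 2 * (K ^+ 2 * N2 g) + 2 * (N2 b * N2 g) by rewrite /D; ring.
  by apply: lerD; apply: ler_wpM2l.
apply: (@le_trans _ _ (D * (e / (D + 1)))); first exact: ler_wpM2l.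
rewrite mulrCA; apply: ler_piMr; first exact: ltW.
by rewrite ler_pdivrMr// mul1r lerDl.
Qed.

End Maximal.

(** * Interpolation *)

Section ModelSpace.
Context {R : realType} {d : option nat}.
Local Notation C := R[i].
Local Notation L := (letter d).
Local Notation W := (word d).

Lemma kernel_fun_mulr m (A : 'M[C]_m) (X : mtuple R d m) (c : C) w :
  kernel_fun (c *: A) X w = c * kernel_fun A X w.
Proof. by rewrite /kernel_fun -scalemxAl mxtraceZ. Qed.

Lemma kernel_funD m (A B : 'M[C]_m) (X : mtuple R d m) w :
  kernel_fun (A + B) X w = kernel_fun A X w + kernel_fun B X w.
Proof. by rewrite /kernel_fun mulmxDl mxtraceD. Qed.

Lemma kernel_fun0 m (X : mtuple R d m) w : kernel_fun 0 X w = 0.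
Proof. by rewrite /kernel_fun mul0mx mxtrace0. Qed.

Lemma kernel_fun_sum m (A : 'M[C]_m) (X : mtuple R d m) w :
  kernel_fun A X w = \sum_j \sum_k A j k * monomial X w k j.
Proof.
by rewrite /kernel_fun /mxtrace; apply: eq_bigr => j _; rewrite mxE.
Qed.

Lemma conj_kernel_model m (A : 'M[C]_m) (X : mtuple R d m) : nc_ball X ->
  model_space X (fun w => (kernel_fun A X w)^*).
Proof.
move=> Xb; have k2 := ell2_kernel A Xb; split; first exact: (ell2J k2).1.
move=> f [f2 fX]; rewrite innerE -conj_pair// pairC -mxtrace_nc_eval// fX mulmx0.
by rewrite mxtrace0; exact: conjc0.
Qed.

(** Project [h] onto the finite-dimensional span of the conjugated entries of the monomials. The
    remainder vanishes at [X], so it is orthogonal to [h] as well as to the span, hence to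
    itself. *)
Lemma model_conj_kernel m (X : mtuple R d m) (h : W -> C) : nc_ball X ->
  model_space X h -> exists A : 'M[C]_m, h = (fun w => (kernel_fun A X w)^*).
Proof.
move=> Xb [h2 hX].
pose F (p : 'I_m * 'I_m) (w : W) := (monomial X w p.2 p.1)^*.
have F2 p : ell2 (F p) by exact: (ell2J (ell2_monomial _ _ Xb)).1.
have [c hc] := ell2_projection F2 h2.
set g := fun k => h k - _ in hc.
have FJ p : (fun k => (F p k)^*) = (fun w => monomial X w p.2 p.1).
  by apply/funext => w; rewrite /F conjcK.
have S2 : ell2 (fun k => \sum_i c i * F i k).
  by apply: ell2_sum => p _; exact: (ell2Z _ (F2 p)).1.
have g2 : ell2 g.
  rewrite /g; under eq_fun do rewrite -mulN1r.
  exact: (ell2D h2 (ell2Z _ S2).1).1.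
(* The entries of g(X) are the pairings of [g] with the entries of the monomials. *)
have gX : nc_eval g X = 0.
  apply/matrixP => k j; rewrite mxE -[LHS]mxtrace_delta mxtrace_nc_eval//.
  have := hc (j, k); rewrite FJ /=.
  have -> // : (fun w => monomial X w k j) = kernel_fun (delta_mx j k) X.
  by apply/funext => w; rewrite kernel_delta.
have gh : pair g (fun w => (h w)^*) = 0.
  have := congr1 (@conjc R) (hX g (conj g2 gX)); rewrite innerE conj_pair//; last first.
    exact: (ell2J g2).1.
  under [X in pair _ X = _ -> _]eq_fun do rewrite conjcK.
  by rewrite pairC => ->; exact: conjc0.
have gS : pair g (fun w => (\sum_i c i * F i w)^*) = 0.
  by rewrite pair_sumr// big1// => p _; rewrite hc mulr0.
have g0 : N2 g = 0.
  apply: complexI; rewrite -pairJ//.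
  have -> : (fun k => (g k)^*) = (fun k => (h k)^* + (-1) * (\sum_i c i * F i k)^*).
    by apply/funext => k; rewrite /g rmorphB mulN1r.
  rewrite pairC pair_linl//; [|exact: (ell2J h2).1|exact: (ell2J S2).1].
  by rewrite pairC gh pairC gS mulr0 addr0.
exists (\matrix_(j, k) (c (j, k))^*); apply/funext => w.
have /eqP := N2_eq0 g2 g0; move/eqP => /(congr1 (fun f => f w)) /eqP.
rewrite /g subr_eq0 => /eqP ->.
rewrite (eq_bigr (fun p => c (p.1, p.2) * F (p.1, p.2) w)); last by case.
rewrite -(pair_bigA _ (fun j k => c (j, k) * F (j, k) w))/=.
rewrite kernel_fun_sum rmorph_sum; apply: eq_bigr => j _; rewrite rmorph_sum; apply: eq_bigr => k _.
by rewrite mxE rmorphM /= conjcK.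
Qed.

Lemma model_space_scale m (X : mtuple R d m) (c : C) (h : W -> C) : nc_ball X ->
  model_space X h -> model_space X (fun w => c * h w).
Proof.
move=> Xb /(model_conj_kernel Xb) [A ->].
have -> : (fun k => c * (kernel_fun A X k)^*) =
    (fun w => (kernel_fun (c^* *: A) X w)^*).
  by apply/funext => w; rewrite kernel_fun_mulr rmorphM /= conjcK.
exact: conj_kernel_model.
Qed.

(** A sum of kernels at several points is a single kernel at their direct sum, so the contraction
    estimate for one point covers finite sums. *)
Lemma finite_direct_sum (f : graded_fun R d) (m : nat -> nat)
    (Z : forall n, mtuple R d (m n)) (A : forall n, 'M[C]_(m n)) N :
  nc_function f -> (forall n, nc_ball (Z n)) ->
  exists M (X : mtuple R d M) (B : 'M[C]_M), [/\ nc_ball X,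
    kernel_fun B X = (fun w => \sum_(n < N) kernel_fun (A n) (Z n) w) &
    kernel_fun (B *m f M X) X =
      (fun w => \sum_(n < N) kernel_fun (A n *m f (m n) (Z n)) (Z n) w)].
Proof.
move=> [fD _] Zb; elim: N => [|N [M [X [B [Xb BX BfX]]]]].
  (* The ball has no point of size 0, so the empty sum is represented at [Z 0] with the zero
     matrix. *)
  exists (m 0%N), (Z 0%N), 0; split => //; apply/funext => w;
    by rewrite ?mul0mx kernel_fun0 big_ord0.
exists (M + m N)%N, (dsum X (Z N)), (block_mx B 0 0 (A N)).
have E (U : 'M[C]_M) (V : 'M[C]_(m N)) w : kernel_fun (block_mx U 0 0 V) (dsum X (Z N)) w =
    kernel_fun U X w + kernel_fun V (Z N) w.
  by rewrite /kernel_fun monomial_dsum mulmx_block !mulmx0 !mul0mx !addr0 !add0r mxtrace_block.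
split; first exact: nc_ball_dsum.
- by apply/funext => w; rewrite E BX big_ord_recr.
- apply/funext => w; rewrite fD// mulmx_block !mulmx0 !mul0mx !addr0 !add0r.
  by rewrite E BfX big_ord_recr.
Qed.

Lemma hinf_norm_le (f : graded_fun R d) (c : R) : (hinf_norm f <= c%:E)%E ->
  forall k (Y : mtuple R d k), nc_ball Y -> opnorm (f k Y) <= c.
Proof.
move=> fc k Y Yb; rewrite -lee_fin; apply: le_trans fc.
by apply: ereal_sup_ubound; exists k, Y.
Qed.

Lemma hinf_bound (f : graded_fun R d) : hinf f ->
  exists c : R, forall k (Y : mtuple R d k), nc_ball Y -> opnorm (f k Y) <= c.
Proof.
move=> [_ fo]; suff [c hc] : exists c : R, (hinf_norm f <= c%:E)%E.
  by exists c; exact: hinf_norm_le.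
by move: fo; case: (hinf_norm f) => [r|//|] _; [exists r|exists 0; rewrite leNye].
Qed.

Lemma kernel_sum_contraction (f : graded_fun R d) (c : R) (m : nat -> nat)
    (Z : forall n, mtuple R d (m n)) (A : forall n, 'M[C]_(m n)) N :
  nc_function f -> (forall k (Y : mtuple R d k), nc_ball Y -> opnorm (f k Y) <= c) ->
  (forall n, nc_ball (Z n)) ->
  N2 (fun w => \sum_(n < N) kernel_fun (A n *m f (m n) (Z n)) (Z n) w) <=
  c ^+ 2 * N2 (fun w => \sum_(n < N) kernel_fun (A n) (Z n) w).
Proof.
move=> fN fc Zb; have [M [X [B [Xb <- <-]]]] := finite_direct_sum A N fN Zb.
exact: kernel_contraction.
Qed.

Definition constant_fun (c : C) : graded_fun R d := fun m _ => c%:M.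

Lemma constant_hinf (c : C) : nsq c = 1 ->
  hinf (constant_fun c) /\ (hinf_norm (constant_fun c) <= 1%:E)%E.
Proof.
move=> c1; have cb k : opnorm (c%:M : 'M[C]_k) <= 1.
  by apply: opnorm_le => // v; rewrite mul_scalar_mx froZ c1 expr1n.
have cn : (hinf_norm (constant_fun c) <= 1%:E)%E.
  by apply: ge_ereal_sup => _ [m [X [_ ->]]]; rewrite lee_fin.
split => //; split; last by apply: le_lt_trans cn _; rewrite ltry.
split.
  split=> [m n X Y _ _|m P X _ Pu _]; first exact: scalar_mx_block.
  by rewrite /constant_fun mul_mx_scalar -scalemxAl mulVmx// scalemx1.
move=> m X Xb; exists (@nc_space R d); split.
- exact: nc_open_space.
- by case: Xb.
- by exists 1.
Qed.

Lemma conj_sgn b : (sgn b : C)^* = sgn b.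
Proof. by rewrite /sgn rmorphXn rmorphN1. Qed.

Lemma interpolating_riesz (m : nat -> nat) (Z : forall n, mtuple R d (m n)) :
  (forall n, nc_ball (Z n)) -> interpolating Z ->
  riesz_system (fun n => model_space (Z n)).
Proof.
move=> Zb Zi; pose H n := model_space (Z n).
have H2 n h : H n h -> ell2 h by case.
have HZ n c h : H n h -> H n (fun k => c * h k).
  exact: model_space_scale.
suff Hs e : exists K, @sign_bounded _ _ H e K.
  have [K K0 HK] := sign_bound_two_sided H2 HZ Hs.
  exact: riesz_of_two_sided K0 H2 HZ HK.
have [||psi [psiH psiZ]] := Zi (fun n => constant_fun (sgn (e n))).
- by move=> n; exact: (constant_hinf (nsq_sgn (e n))).1.
- by exists 1 => n; exact: (constant_hinf (nsq_sgn (e n))).2.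
(* At each [Z n] the interpolant is a signed identity, so it acts on the kernels by the signs [e];
   its sup norm bounds this action. *)
have [c hc] := hinf_bound psiH; exists (c ^+ 2) => y N yH.
pose A n := sval (cid (model_conj_kernel (Zb n) (yH n))).
have hA n : y n = (fun w => (kernel_fun (A n) (Z n) w)^*).
  exact: svalP (cid (model_conj_kernel (Zb n) (yH n))).
have S2 (B : forall n, 'M[C]_(m n)) : ell2 (fun w => \sum_(n < N) kernel_fun (B n) (Z n) w).
  by apply: ell2_sum => n _; exact: ell2_kernel.
have := kernel_sum_contraction A N psiH.1.1 hc Zb.
rewrite -(ell2J (S2 A)).2 -(ell2J (S2 (fun n => A n *m psi (m n) (Z n)))).2.
have -> : (fun w => (\sum_(n < N) kernel_fun (A n *m psi (m n) (Z n)) (Z n) w)^*) =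
    sign_sum e y N.
  apply/funext => w; rewrite rmorph_sum; apply: eq_bigr => n _ /=.
  by rewrite psiZ /constant_fun mul_mx_scalar kernel_fun_mulr rmorphM /= conj_sgn hA.
have -> // : (fun w => (\sum_(n < N) kernel_fun (A n) (Z n) w)^*) =
    sign_sum (fun=> false) y N.
apply/funext => w; rewrite rmorph_sum; apply: eq_bigr => n _ /=.
by rewrite hA /sgn expr0 mul1r.
Qed.

Lemma riesz_interpolating (m : nat -> nat) (Z : forall n, mtuple R d (m n)) :
  (forall n, nc_ball (Z n)) -> riesz_system (fun n => model_space (Z n)) ->
  interpolating Z.
Proof.
move=> Zb Zr phi phiH [c0 hc0].
pose H n := model_space (Z n).
have H2 n h : H n h -> ell2 h by case.
have [||K0 K00 HK] := @riesz_two_sided _ _ H H2 _ _ Zr.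
- by move=> n c h; exact: model_space_scale.
- move=> n; have [m0 _] := nc_ball_row_bounded (Zb n).
  (* The kernel of this matrix takes the value 1 at the empty word, so the model space is
     nonzero. *)
  pose A : 'M[C]_(m n) := delta_mx (Ordinal m0) (Ordinal m0).
  exists (fun w => (kernel_fun A (Z n) w)^*); first exact: conj_kernel_model.
  have A2 := ell2_kernel A (Zb n).
  rewrite (ell2J A2).2; apply/eqP => /(N2_eq0 A2) /(congr1 (fun f => f [::])).
  rewrite kernel_delta monomial_nil mxE eqxx /= => /eqP.
  by rewrite oner_eq0.
pose c := Num.max 0 c0.
have cp : 0 <= c by rewrite le_max lexx.
have hc n k (Y : mtuple R d k) : nc_ball Y -> opnorm (phi n k Y) <= c.
  move=> Yb; apply: (@le_trans _ _ c0); last by rewrite le_max lexx orbT.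
  exact: hinf_norm_le (hc0 n) _ _ Yb.
pose Phi n := phi n (m n) (Z n).
pose S (A : forall n, 'M[C]_(m n)) N : W -> C := fun w => \sum_(n < N) kernel_fun (A n) (Z n) w.
have S2 (A : forall n, 'M[C]_(m n)) N : ell2 (S A N) by apply: ell2_sum => n _; exact: ell2_kernel.
have two (A : forall n, 'M[C]_(m n)) N : \sum_(n < N) N2 (kernel_fun (A n) (Z n)) <= K0 * N2 (S A N) /\
    N2 (S A N) <= K0 * \sum_(n < N) N2 (kernel_fun (A n) (Z n)).
  have Hk n : H n (fun w => (kernel_fun (A n) (Z n) w)^*) by exact: conj_kernel_model.
  have E1 : \sum_(n < N) N2 (fun w => (kernel_fun (A n) (Z n) w)^*) =
      \sum_(n < N) N2 (kernel_fun (A n) (Z n)).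
    by apply: eq_bigr => n _; exact: (ell2J (ell2_kernel (A n) (Zb n))).2.
  have E2 : N2 (fun k => \sum_(n < N) (kernel_fun (A n) (Z n) k)^*) = N2 (S A N).
    rewrite -(ell2J (S2 A N)).2; congr N2.
    by apply/funext => w; rewrite rmorph_sum.
  have := HK (fun n w => (kernel_fun (A n) (Z n) w)^*) N Hk.
  by rewrite E1 E2 => -[].
(* The Riesz estimate is used once for the image and once for the source, and the contraction by c^2
   termwise in between: K0 c^2 K0 = K^2. *)
pose K := K0 * c.
pose AP (A : forall n, 'M[C]_(m n)) n : 'M[C]_(m n) := A n *m Phi n.
have bound (A : forall n, 'M[C]_(m n)) N : N2 (S (AP A) N) <= K ^+ 2 * N2 (S A N).
  apply: le_trans (two (AP A) N).2 _.
  apply: (@le_trans _ _ (K0 * \sum_(n < N) c ^+ 2 * N2 (kernel_fun (A n) (Z n)))).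
    apply: ler_wpM2l => //; apply: ler_sum => n _.
    apply: kernel_contraction => //; [exact: (phiH n).1.1|exact: hc].
  rewrite -mulr_sumr.
  have -> : K ^+ 2 * N2 (S A N) = K0 * (c ^+ 2 * (K0 * N2 (S A N))) by rewrite /K; ring.
  do 2 (apply: ler_wpM2l; rewrite ?sqr_ge0//).
  exact: (two A N).1.
have widen (A : forall n, 'M[C]_(m n)) N N' : (forall n, (N <= n)%N -> A n = 0) -> (N <= N')%N -> S A N' = S A N.
  move=> A0 NN'; apply/funext => w; rewrite /S.
  rewrite -!(big_mkord xpredT (fun n => kernel_fun (A n) (Z n) w)).
  rewrite (big_cat_nat (leq0n N) NN')/= [X in _ + X]big_nat [X in _ + X]big1 ?addr0//.
  by move=> n /andP[Nn _]; rewrite A0// kernel_fun0.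
have AP0 (A : forall n, 'M[C]_(m n)) N : (forall n, (N <= n)%N -> A n = 0) -> forall n, (N <= n)%N -> AP A n = 0.
  by move=> A0 n Nn; rewrite /AP A0// mul0mx.
(* The form takes the coefficient at the empty word of the image. Finite sums are encoded by
   families of matrices that vanish from [N] on, so that sums of different lengths can be added by
   [widen]. *)
pose M0 := [set x : (W -> C) * C | exists N (A : forall n, 'M[C]_(m n)), [/\ forall n, (N <= n)%N -> A n = 0,
   x.1 = S A N & x.2 = S (AP A) N [::]]].
have M0lin h g s e k : M0 (h, s) -> M0 (g, e) -> M0 (lin h k g, s + k * e).
  move=> [N [A [A0 /= -> ->]]] [N1 [B [B0 /= -> ->]]].
  exists (maxn N N1), (fun n => A n + k *: B n); split.
  - by move=> n; rewrite geq_max => /andP[/A0 -> /B0 ->]; rewrite scaler0 addr0.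
  - apply/funext => w; rewrite /lin /= -(widen A N (maxn N N1))// ?leq_maxl//.
    rewrite -(widen B N1 (maxn N N1))// ?leq_maxr// /S mulr_sumr -big_split/=.
    by apply: eq_bigr => n _; rewrite kernel_funD kernel_fun_mulr.
  - rewrite /= -(widen (AP A) N (maxn N N1))// ?leq_maxl//; last exact: AP0.
    rewrite -(widen (AP B) N1 (maxn N N1))// ?leq_maxr//; last exact: AP0.
    rewrite /S mulr_sumr -big_split/=; apply: eq_bigr => n _.
    by rewrite /AP mulmxDl -scalemxAl kernel_funD kernel_fun_mulr.
have M0le h s : M0 (h, s) -> nsq s <= K ^+ 2 * N2 h.
  move=> [N [A [_ /= -> ->]]].
  exact: le_trans (N2_ge1 [::] (S2 _ _)) (bound A N).
have M0fun h s e : M0 (h, s) -> M0 (h, e) -> s = e.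
  move=> Ms Me; have := M0lin _ _ _ _ (-1) Ms Me => /M0le.
  have -> : lin h (-1) h = (0 : W -> C).
    by apply/funext => w; rewrite /lin mulN1r subrr.
  rewrite (ell20).2 mulr0 mulN1r => le0; apply/eqP; rewrite -subr_eq0.
  by apply/eqP/nsq_eq0/eqP; rewrite eq_le le0 nsq_ge0.
(* A shift multiplies [A n] by a monomial on the left, the operator multiplies it by the data on the
   right; hence they commute, and the image at [v] is the form at the shift by [v]. *)
have M0shift v N (A : forall n, 'M[C]_(m n)) : (forall n, (N <= n)%N -> A n = 0) ->
    M0 (shift v (S A N), S (AP A) N v).
  move=> A0; exists N, (fun n => monomial (Z n) v *m A n); split => /=.
  - by move=> n Nn; rewrite A0// mulmx0.
  - by apply/funext => w; apply: eq_bigr => n _; rewrite kernel_shift.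
  - apply: eq_bigr => n _; rewrite -[v in LHS]cat0s kernel_shift.
    by rewrite /AP mulmxA.
have M0adm : admissible K M0.
  split => //.
  - move=> h s i [N [A [A0 /= -> _]]]; exists (S (AP A) N [:: i]); exact: M0shift.
  - by move=> h s [N [A [_ /= -> _]]].
  - move=> h s b [N [A [A0 /= hE _]]] Mb.
    have bE v : b v = S (AP A) N v.
      by apply: (M0fun _ _ _ (Mb v)); rewrite hE; exact: M0shift.
    rewrite (_ : nsum _ = nsum (fun v => nsq (S (AP A) N v))); last first.
      by congr nsum; apply/funext => v; rewrite bE.
    by rewrite -normsqE normsq_N2// lee_fin hE.
have M00 : M0 ((fun=> 0), 0).
  by exists 0%N, (fun=> 0); split => //=; [apply/funext => w|]; rewrite /S big_ord0.
have [b bK hb] := multiplier_of_admissible M0adm M00.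
have Kp : 0 <= K by rewrite mulr_ge0.
exists (@nc_eval R d b); split; first exact: multiplier_hinf Kp bK.
move=> n; have b2 := multiplier_ell2 bK.
apply/matrixP => k j; rewrite -[LHS]mxtrace_delta -[RHS]mxtrace_delta mxtrace_nc_eval//.
(* It remains to see that the form takes the kernel of a matrix unit at [Z n] to the corresponding
   entry of the prescribed value. *)
apply/esym/hb; rewrite -/(Phi n).
pose A0 : 'M[C]_(m n) := delta_mx j k.
(* [conform_mx] adapts the size, being the identity at l = n and giving a matrix that is multiplied
   by 0 elsewhere. *)
pose A l : 'M[C]_(m l) := (l == n)%:R *: conform_mx 0 A0.
have An : A n = A0 by rewrite /A eqxx scale1r conform_mx_id.
have A1 l : l != n -> A l = 0 by move=> /negbTE ln; rewrite /A ln scale0r.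
have last_term (B : forall l, 'M[C]_(m l)) w : (forall l, l != n -> B l = 0) ->
    S B n.+1 w = kernel_fun (B n) (Z n) w.
  move=> B1; rewrite /S big_ord_recr/= big1 ?add0r// => l _.
  by rewrite B1 ?kernel_fun0// ltn_eqF.
exists n.+1, A; split => /=.
- by move=> l nl; rewrite A1// gtn_eqF.
- by apply/funext => w; rewrite last_term// An.
- rewrite last_term; last by move=> l ln; rewrite /AP A1// mul0mx.
  by rewrite /AP An /kernel_fun monomial_nil mulmx1.
Qed.

End ModelSpace.

Theorem theorem1p14 (R : realType) (d : option nat) (m : nat -> nat)
    (Z : forall n : nat, mtuple R d (m n))
    (hZ : forall n : nat, nc_ball (Z n)) :
  interpolating Z <-> riesz_system (fun n => model_space (Z n)).
Proof. by split; [exact: interpolating_riesz|exact: riesz_interpolating]. Qed.
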